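(* Under the setting described in the context, suppose there exists an open set $N_1\subset\mathbb R^d$ with $\partial_1 O\subset N_1$ such that $\mathbb P^x(\hat\Pi\in\bar N_1)=0$ for all $x\in\bar O$. Then the function $v$ is a generalized viscosity solution of the Dirichlet problem $-\mathcal L u+\lambda u-\ell=0$ on $O$, $u=g$ on $O^c$. Moreover, $\partial_0 O\subset\Gamma_{out}:=\{x\in\partial O: v(x)=g(x)\}$.
   Context: Let $d\ge 1$. Let $\Omega=\mathbb D^d$ be the space of càdlàg functions $[0,\infty)\to\mathbb R^d$ with the Skorokhod metric, and $X_t(\omega)=\omega(t)$ the coordinate process; $\mathcal F^0_t=\sigma(X_s:s\le t)$. Let $\{P_t\}_{t\ge0}$ be a Feller semigroup on $C_0(\mathbb R^d)$ whose infinitesimal generator $\mathcal L$ has domain containing $C_0^\infty(\mathbb R^d)$. For each probability measure $\nu$ on $\mathbb R^d$, $\mathbb P^\nu$ is the probability on $(\Omega,\sigma(X_s:s\ge0))$ under which $X$ is the càdlàg Feller (Markov) process with transition semigroup $\{P_t\}$ and initial law $\nu$; $\mathbb P^x=\mathbb P^{\delta_x}$, $\mathbb E^x$ its expectation. The filtration is $\mathcal F_t=\bigcap_\nu\sigma(\mathcal F^0_t,\mathcal N^\nu)$, $\mathcal N^\nu$ the $\mathbb P^\nu$-null sets. $O\subset\mathbb R^d$ is a connected bounded open set; $g,\ell:\mathbb R^d\to\mathbb R$ are Lipschitz and vanish at infinity; $\lambda>0$. For a Borel set $B$ and $\omega\in\mathbb D^d$: $\tau_B(\omega)=\inf\{t>0:\omega(t)\notin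 B\}$, $\Pi_B(\omega)=\omega(\tau_B(\omega))$. Set $\zeta=\tau_{\bar O}$, $\Pi=\Pi_{\bar O}$, $\hat\zeta=\tau_O$, $\hat\Pi=\Pi_O$. Define $v(x)=\mathbb E^x\big[\int_0^\zeta e^{-\lambda s}\ell(X_s)ds+e^{-\lambda\zeta}g(X_\zeta)\big]$. A point $x$ is regular for a set $B$ if $\mathbb P^x(\tau_{B^c}=0)=1$. $\partial_0 O=\{x\in\partial O: x$ regular for $\bar O^c\}$, $\partial_1O=\partial O\setminus\partial_0O$. Viscosity notions: let $G(\phi,x)=-\mathcal L\phi(x)+\lambda\phi(x)-\ell(x)$. For $u\in USC(\bar O)$, $x\in\bar O$: $J^+(u,x)=\{\phi\in C_0^\infty(\mathbb R^d):\phi\ge(uI_{\bar O}+gI_{\bar O^c})^*,\ \phi(x)=u(x)\}$; for $u\in LSC(\bar O)$: $J^-(u,x)=\{\phi\in C_0^\infty(\mathbb R^d):\phi\le(uI_{\bar O}+gI_{\bar O^c})_*,\ \phi(x)=u(x)\}$ ($^*$, $_*$ denote upper/lower semicontinuous envelopes). $u$ has the subsolution property at $x$ if $G(\phi,x)\le0$ for all $\phi\in J^+(u,x)$, the supersolution property if $G(\phi,x)\ge0$ for all $\phi\in J^-(u,x)$. $u\in USC(\bar O)$ is a generalized viscosity subsolution if it has the subsolution property at each $x\in O$ and $\min\{G(\phi,x),u(x)-g(x)\}\le0$ for all $x\in\partial O$, $\phi\in J^+(u,x)$; $u\in LSC(\bar O)$ is a generalized viscosity supersolution if it has the supersolution property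 at each $x\in O$ and $\max\{G(\phi,x),u(x)-g(x)\}\ge0$ for all $x\in\partial O$, $\phi\in J^-(u,x)$; $u\in C(\bar O)$ is a generalized viscosity solution if it is both. *)

(* Defs.v *)
From HB Require Import structures.
From mathcomp Require Import all_boot all_order all_algebra.
From mathcomp Require Import all_classical all_reals all_analysis.

Set Implicit Arguments.
Unset Strict Implicit.
Unset Printing Implicit Defensive.

Import Order.TTheory GRing.Theory Num.Theory.
Import numFieldNormedType.Exports.
Local Open Scope classical_set_scope.
Local Open Scope ring_scope.

Section Defs.
Variables (R : realType) (d : nat).
Local Notation E := 'rV[R]_d.

Definition vanish_at_infinity (f : E -> R) : Prop :=
  forall e : R, 0 < e -> exists M : R, forall x : E, M < `|x| -> `|f x| < e.

Definition C0 (f : E -> R) : Prop := continuous f /\ vanish_at_infinity f.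

(* smooth_n n f : all iterated directional derivatives of order <= n
   exist everywhere and the n-th ones (hence all) are continuous. *)
Fixpoint smooth_n (n : nat) (f : E -> R) : Prop :=
  match n with
  | 0%N => continuous f
  | n.+1 => (forall x v : E, derivable f x v) /\
            (forall v : E, smooth_n n (fun x => derive f x v))
  end.

Definition smooth (f : E -> R) : Prop := forall n, smooth_n n f.

Definition Ccinf (f : E -> R) : Prop :=
  smooth f /\ exists K : set E, compact K /\ forall x, ~ K x -> f x = 0.

Definition feller_semigroup (Pt : R -> (E -> R) -> (E -> R)) : Prop :=
  [/\ (forall t f, 0 <= t -> C0 f -> C0 (Pt t f)),
      (forall t (a : R) f g, 0 <= t -> C0 f -> C0 g ->
          Pt t (fun x => a * f x + g x) = (fun x => a * Pt t f x + Pt t g x)),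
      (forall t f, 0 <= t -> C0 f -> (forall x, 0 <= f x <= 1) ->
          forall x, 0 <= Pt t f x <= 1),
      (forall f, C0 f -> Pt 0 f = f) /\
      (forall s t f, 0 <= s -> 0 <= t -> C0 f -> Pt (s + t) f = Pt s (Pt t f)) &
      (forall f, C0 f -> forall e : R, 0 < e ->
          \forall t \near 0^'+, forall x, `|Pt t f x - f x| < e)].

Definition is_generator (Pt : R -> (E -> R) -> (E -> R)) (f g : E -> R) : Prop :=
  [/\ C0 f, C0 g &
      forall e : R, 0 < e ->
        \forall t \near 0^'+, forall x, `|(Pt t f x - f x) / t - g x| < e].

(* A path is a function R -> E, frozen (= w 0) on negative times, so that
   these are in bijection with cadlag maps [0,oo) -> R^d. *)
Definition is_cadlag (w : R -> E) : Prop :=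
  [/\ (forall t, t < 0 -> w t = w 0),
      (forall t, 0 <= t -> w x @[x --> t^'+] --> w t) &
      (forall t, 0 < t -> cvg (w x @[x --> t^'-]))].

Record cadlag := Cadlag { cpath :> R -> E ; cpathP : is_cadlag cpath }.

Lemma cadlag_cst (a : E) : is_cadlag (fun _ => a).
Proof.
split=> // t _; last exact: is_cvg_cst.
exact: cvg_cst.
Qed.

HB.instance Definition _ := gen_eqMixin cadlag.
HB.instance Definition _ := gen_choiceMixin cadlag.
HB.instance Definition _ := isPointed.Build cadlag (Cadlag (cadlag_cst 0)).

Definition Xc (t : R) (w : cadlag) : E := w t.

Definition cylinders : set (set cadlag) :=
  [set A | exists (s : R) (B : set E), [/\ 0 <= s, open B & A = Xc s @^-1` B]].

Definition Omega := g_sigma_algebraType cylinders.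

Definition X (t : R) (w : Omega) : E := Xc t w.

Definition F0 (s : R) : set (set Omega) :=
  <<s [set A | exists (r : R) (B : set E),
               [/\ 0 <= r <= s, open B & A = X r @^-1` B] ] >>.

Definition feller_process (Pt : R -> (E -> R) -> (E -> R))
    (P : E -> probability Omega R) : Prop :=
  (forall x, P x [set w | X 0 w = x] = 1%E) /\
  (forall x s t f A, 0 <= s -> 0 <= t -> C0 f -> F0 s A ->
     (\int[P x]_(w in A) (f (X (s + t) w))%:E =
      \int[P x]_(w in A) (Pt t f (X s w))%:E)%E).

Definition exit_time (B : set E) (w : Omega) : \bar R :=
  ereal_inf [set t%:E | t in [set t : R | 0 < t /\ ~ B (X t w)]].

Definition exit_pos_in (B C : set E) : set Omega :=
  [set w | exists t : R, exit_time B w = t%:E /\ C (X t w)].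

Definition payoff (O : set E) (lam : R) (g l : E -> R) (w : Omega) : \bar R :=
  let zeta := exit_time (closure O) w in
  (\int[@lebesgue_measure R]_(s in [set s : R | (0 <= s)%R /\ (s%:E < zeta)%E])
      (expR (- lam * s)%R * l (X s w))%:E
   + match zeta with
     | EFin z => (expR (- lam * z)%R * g (X z w))%:E
     | _ => 0%E
     end)%E.

Definition value (P : E -> probability Omega R) (O : set E) (lam : R)
    (g l : E -> R) (x : E) : R :=
  fine (\int[P x]_w payoff O lam g l w).

Definition boundary (O : set E) : set E := closure O `\` O.

(* points of dO regular for the complement of closure O:
   P^x(tau_{closure O} = 0) = 1 (in the completed sense) *)
Definition boundary0 (P : E -> probability Omega R) (O : set E) : set E :=
  [set x | boundary O x /\
     (P x).-negligible [set w | exit_time (closure O) w != 0%E]].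

Definition boundary1 (P : E -> probability Omega R) (O : set E) : set E :=
  boundary O `\` boundary0 P O.

Definition usc_env (w : E -> R) (y : E) : \bar R :=
  ereal_inf [set ereal_sup [set (w z)%:E | z in ball y e] | e in [set e : R | 0 < e]].

Definition lsc_env (w : E -> R) (y : E) : \bar R :=
  ereal_sup [set ereal_inf [set (w z)%:E | z in ball y e] | e in [set e : R | 0 < e]].

Definition usc_on (A : set E) (u : E -> R) : Prop :=
  forall x, A x -> forall e : R, 0 < e -> \forall y \near x, A y -> u y < u x + e.

Definition lsc_on (A : set E) (u : E -> R) : Prop :=
  forall x, A x -> forall e : R, 0 < e -> \forall y \near x, A y -> u x - e < u y.

Definition extend (O : set E) (u g : E -> R) (y : E) : R :=
  if `[< closure O y >] then u y else g y.

Definition Jplus (O : set E) (g u : E -> R) (x : E) (phi : E -> R) : Prop :=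
  [/\ Ccinf phi, (forall y, (usc_env (extend O u g) y <= (phi y)%:E)%E) & phi x = u x].

Definition Jminus (O : set E) (g u : E -> R) (x : E) (phi : E -> R) : Prop :=
  [/\ Ccinf phi, (forall y, ((phi y)%:E <= lsc_env (extend O u g) y)%E) & phi x = u x].

Definition Gop (L : (E -> R) -> E -> R) (lam : R) (l : E -> R)
    (phi : E -> R) (x : E) : R :=
  - L phi x + lam * phi x - l x.

Definition gen_visc_sub (L : (E -> R) -> E -> R) (lam : R) (l g : E -> R)
    (O : set E) (u : E -> R) : Prop :=
  [/\ usc_on (closure O) u,
      (forall x phi, O x -> Jplus O g u x phi -> Gop L lam l phi x <= 0) &
      (forall x phi, boundary O x -> Jplus O g u x phi ->
          Num.min (Gop L lam l phi x) (u x - g x) <= 0)].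

Definition gen_visc_super (L : (E -> R) -> E -> R) (lam : R) (l g : E -> R)
    (O : set E) (u : E -> R) : Prop :=
  [/\ lsc_on (closure O) u,
      (forall x phi, O x -> Jminus O g u x phi -> 0 <= Gop L lam l phi x) &
      (forall x phi, boundary O x -> Jminus O g u x phi ->
          0 <= Num.max (Gop L lam l phi x) (u x - g x))].

Definition gen_visc_sol (L : (E -> R) -> E -> R) (lam : R) (l g : E -> R)
    (O : set E) (u : E -> R) : Prop :=
  [/\ {within closure O, continuous u},
      gen_visc_sub L lam l g O u & gen_visc_super L lam l g O u].

End Defs.

(* Main.v *)
(* Proof idea. Let R f x = E^x int_0^oo lam e^{-lam s} f(X_s) ds ([res]) and, for f in C_0,
   H f x = E^x[e^{-lam zeta} f(X_zeta)] ([exit_value]).  Then v = R l / lam + H(g - R l / lam), so everything reduces to H.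
   Continuity of H on closure O: the range of R is dense in C_0, so take f = R h with h >= 0.  Penalizing outside closure O
   (killing with a charge concentrated on the complement) gives continuous y_n = R k_n, with k_n = 0 on closure O, which
   increase to H f up to 1/n.  Off N1, points are either outside closure O or regular, so H f = f there and Dini's theorem
   makes the convergence uniform on the complement of O and N1.  Since X does not leave O through closure N1, the process
   started in closure O is on that set before zeta, and the supermartingale e^{-lam t} y_n(X_t) propagates the uniform
   estimate to closure O.
   Viscosity inequalities: phi = R(phi - L phi / lam) for every test function, so phi - R l / lam = R m with
   lam m = G(phi, .), and the claim becomes: if H psi <= R m, psi <= R m off closure O, with equality H psi x = R m x and
   P^x(zeta > 0) > 0, then m x <= 0.  Dynamic programming for H (again through y_n) and Dynkin's formula for R m give
   E^x int_0^{zeta /\ h} e^{-lam s} m(X_s) ds <= 0; divide by h and let h tend to 0. *)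

(* The process is given through the Markov property at constant times, tested on C_0 functions,
   while H f is not known beforehand to be C_0 or even measurable. This obstacle shapes the proof:
   statements about stopping are first proved for functions R k, where Dynkin's formula at optional
   times does the work of a strong Markov property, and they reach H only as limits along y_n. The
   factor lam in R makes the discount an exponential probability law. Cost integrals become means
   over an independent clock, R becomes a sup-norm contraction, and the Markov property at time t
   combines with the lack of memory of the clock. Killing is not constructed on paths: y_n solves a
   fixed-point equation for R, and every comparison between such functions is a maximum principle
   for R. Dini's theorem does not apply verbatim, since y_n increases only up to an error 1/n along
   ranks that at least double, and since the set in question may be unbounded; the decay of R f at
   infinity leaves a compact piece. *)
Require Import Defs.
From HB Require Import structures.
From mathcomp Require Import all_boot all_order all_algebra.
From mathcomp Require Import all_classical all_reals all_analysis.
From mathcomp Require Import measurable_realfun ring lra.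

Set Implicit Arguments.
Unset Strict Implicit.
Unset Printing Implicit Defensive.

Import Order.TTheory GRing.Theory Num.Theory.
Import numFieldNormedType.Exports.
Local Open Scope classical_set_scope.
Local Open Scope ring_scope.

(** * Means of bounded measurable functions *)

Section BoundedMeasurable.
Context {d : measure_display} {T : measurableType d} {R : realType}.
Implicit Types f g : T -> R.

(** Such functions are integrable for every probability, so linearity and monotonicity of [mean]
    carry no further integrability conditions. *)
Definition bmeas f := measurable_fun setT f /\ exists M : R, forall x, `|f x| <= M.

Lemma bmeas_cst (c : R) : bmeas (fun _ => c).
Proof. by split; [exact: measurable_cst | exists `|c|]. Qed.

Lemma bmeasD f g : bmeas f -> bmeas g -> bmeas (fun x => f x + g x).
Proof.
move=> [mf [M fM]] [mg [N gN]]; split; first exact: measurable_funD.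
by exists (M + N) => x; rewrite (le_trans (ler_normD _ _))// lerD.
Qed.

Lemma bmeasM f g : bmeas f -> bmeas g -> bmeas (fun x => f x * g x).
Proof.
move=> [mf [M fM]] [mg [N gN]]; split; first exact: measurable_funM.
by exists (M * N) => x; rewrite normrM ler_pM.
Qed.

Lemma bmeasZ (c : R) f : bmeas f -> bmeas (fun x => c * f x).
Proof. exact/bmeasM/bmeas_cst. Qed.

Lemma bmeasB f g : bmeas f -> bmeas g -> bmeas (fun x => f x - g x).
Proof.
move=> bf bg; have := bmeasD bf (bmeasZ (-1) bg).
by under eq_fun do rewrite mulN1r.
Qed.

Lemma bmeas_indic (A : set T) : measurable A -> bmeas (\1_A : T -> R).
Proof.
move=> mA; split; first exact: measurable_indic.
by exists 1 => x; rewrite indicE; case: (_ \in _); rewrite ?normr1 ?normr0.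
Qed.

Variable mu : probability T R.

Definition mean f : R := \int[mu]_x f x.

Lemma bmeas_integrable f : bmeas f -> mu.-integrable setT (EFin \o f).
Proof.
move=> [mf [M fM]]; apply: measurable_bounded_integrable => //.
  by rewrite (le_lt_trans (probability_le1 mu measurableT))// ltry.
exists M; split; first exact: num_real.
by move=> N MN x _ /=; rewrite (le_trans (fM x))// ltW.
Qed.

Lemma EFin_mean f : bmeas f -> (\int[mu]_x (f x)%:E)%E = (mean f)%:E.
Proof.
by move=> bf; rewrite /mean /Rintegral fineK// integrable_fin_num// bmeas_integrable.
Qed.

Lemma meanD f g : bmeas f -> bmeas g ->
  mean (fun x => f x + g x) = mean f + mean g.
Proof. by move=> bf bg; rewrite /mean RintegralD//; exact: bmeas_integrable. Qed.

Lemma meanB f g : bmeas f -> bmeas g ->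
  mean (fun x => f x - g x) = mean f - mean g.
Proof. by move=> bf bg; rewrite /mean RintegralB//; exact: bmeas_integrable. Qed.

Lemma meanZ (c : R) f : bmeas f -> mean (fun x => c * f x) = c * mean f.
Proof. by move=> bf; rewrite /mean RintegralZl//; exact: bmeas_integrable. Qed.

Lemma mean_cst (c : R) : mean (fun _ => c) = c.
Proof.
rewrite /mean Rintegral_cst//.
by have /(congr1 fine) /= -> := probability_setT mu; rewrite mulr1.
Qed.

Lemma mean_indic (A : set T) : measurable A -> mean (\1_A) = fine (mu A).
Proof. by move=> mA; rewrite /mean /Rintegral integral_indic// setIT. Qed.

Lemma le_mean f g : bmeas f -> bmeas g -> (forall x, f x <= g x) ->
  mean f <= mean g.
Proof. by move=> bf bg fg; apply: le_Rintegral => //; exact: bmeas_integrable. Qed.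

Lemma eq_mean f g : (forall x, f x = g x) -> mean f = mean g.
Proof. by move=> fg; congr mean; apply/funext. Qed.

Lemma mean_ge0 f : (forall x, 0 <= f x) -> 0 <= mean f.
Proof. by move=> f0; apply: Rintegral_ge0. Qed.

Lemma mean_bound f M : bmeas f -> (forall x, `|f x| <= M) -> `|mean f| <= M.
Proof.
move=> bf fM; rewrite ler_norml; apply/andP; split.
  rewrite -(mean_cst (- M)); apply: le_mean => //; first exact: bmeas_cst.
  by move=> x; have := fM x; rewrite ler_norml => /andP[].
rewrite -(mean_cst M); apply: le_mean => //; first exact: bmeas_cst.
by move=> x; have := fM x; rewrite ler_norml => /andP[].
Qed.

Lemma eq_mean_ae f g (N : set T) : mu.-negligible N -> bmeas f -> bmeas g ->
  (forall x, ~ N x -> f x = g x) -> mean f = mean g.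
Proof.
move=> [A [mA A0 NA]] bf bg fg; congr fine.
apply: ae_eq_integral => //; [exact/measurable_EFinP/bf.1 |
  exact/measurable_EFinP/bg.1 |].
exists A; split => // x /=.
rewrite not_implyP => -[_ fgx]; apply: NA; apply: contrapT => nN.
by apply: fgx; rewrite fg.
Qed.

Lemma le_mean_ae f g (N : set T) : mu.-negligible N -> bmeas f -> bmeas g ->
  (forall x, ~ N x -> f x <= g x) -> mean f <= mean g.
Proof.
move=> [A [mA A0 NA]] bf bg fg.
have bI : bmeas (\1_(~` A) : T -> R) by apply/bmeas_indic/measurableC.
have nA : mu.-negligible A by exists A; split.
have eqA h : bmeas h -> mean h = mean (fun x => \1_(~` A) x * h x).
  move=> bh; apply: (eq_mean_ae nA bh); first exact: (bmeasM bI bh).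
  by move=> x Ax; rewrite indicE mem_set// mul1r.
rewrite (eqA _ bf) (eqA _ bg); apply: le_mean; [exact: bmeasM bI bf | exact: bmeasM bI bg |].
move=> x; rewrite indicE; have [xA|xA] := boolP (x \in ~` A); last by rewrite !mul0r.
rewrite !mul1r; apply: fg => Nx; move: xA; rewrite inE; apply; exact: NA.
Qed.

(** Dominated convergence with a constant bound. Measurability of the limit belongs to the
    conclusion because the exit value along a path is later known to be measurable only as such a
    limit. *)
Lemma mean_cvg (f_ : (T -> R)^nat) f M :
  (forall n, measurable_fun setT (f_ n)) -> (forall n x, `|f_ n x| <= M) ->
  (forall x, f_ ^~ x @ \oo --> f x) ->
  bmeas f /\ mean (f_ n) @[n --> \oo] --> mean f.
Proof.
move=> mf fM f_f.
have bf : bmeas f.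
  split; first by apply: (measurable_fun_cvg mf) => x _; exact: f_f.
  exists M => x; rewrite -(cvg_lim (@Rhausdorff R) (f_f x)).
  have -> : `|limn (f_ ^~ x)| = limn (fun n => `|f_ n x|).
    by apply/esym/cvg_lim => //; apply: cvg_norm; rewrite (cvg_lim _ (f_f x)).
  apply: limr_le; last by apply: nearW => n; exact: fM.
  by apply: cvgP; apply: cvg_norm; exact: f_f.
split=> //.
have bfn n : bmeas (f_ n) by split=> //; exists M.
have [] := @dominated_convergence _ _ _ mu setT measurableT
  (fun n x => (f_ n x)%:E) (EFin \o f) (fun=> M%:E).
- by move=> n; exact/measurable_EFinP.
- exact/measurable_EFinP/bf.1.
- apply: aeW => x _; apply: cvg_EFin; [exact: nearW | exact: f_f].
- exact/bmeas_integrable/bmeas_cst.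
- by apply: aeW => x n _; rewrite lee_fin.
move=> _ _ h; rewrite (EFin_mean bf) in h.
exact: (fine_cvg h).
Qed.

End BoundedMeasurable.

(** * Fubini's theorem for bounded functions *)

Section Fubini.
Context {d1 d2 : measure_display} {T1 : measurableType d1} {T2 : measurableType d2}.
Context {R : realType}.
Variables (mu : probability T1 R) (nu : probability T2 R).
Variables (F : T1 * T2 -> R) (bF : bmeas F).

Lemma bmeas_pair1 x : bmeas (fun y => F (x, y)).
Proof.
case: bF => mF [M FM]; split; last by exists M => y; exact: FM.
exact: measurable_fun_pair2.
Qed.

Lemma bmeas_pair2 y : bmeas (fun x => F (x, y)).
Proof.
case: bF => mF [M FM]; split; last by exists M => x; exact: FM.
exact: measurable_fun_pair1.
Qed.

Let iF : (mu \x nu)%E.-integrable setT (EFin \o F).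
Proof. exact: (bmeas_integrable (mu \x nu)%E). Qed.

Lemma bmeas_mean1 : bmeas (fun x => mean nu (fun y => F (x, y))).
Proof.
split.
  have := measurable_fubini_F iF.
  move=> /(measurableT_comp (@fine_measurable R setT measurableT)).
  exact.
have [_ [M FM]] := bF; exists M => x; apply: mean_bound; first exact: bmeas_pair1.
by move=> y; exact: FM.
Qed.

Lemma bmeas_mean2 : bmeas (fun y => mean mu (fun x => F (x, y))).
Proof.
split.
  have := measurable_fubini_G iF.
  move=> /(measurableT_comp (@fine_measurable R setT measurableT)).
  exact.
have [_ [M FM]] := bF; exists M => x; apply: mean_bound; first exact: bmeas_pair2.
by move=> y; exact: FM.
Qed.

Lemma mean_swap : mean mu (fun x => mean nu (fun y => F (x, y))) =
                  mean nu (fun y => mean mu (fun x => F (x, y))).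
Proof.
apply: EFin_inj; rewrite -(EFin_mean mu bmeas_mean1) -(EFin_mean nu bmeas_mean2).
under eq_integral do rewrite -(EFin_mean nu (bmeas_pair1 _)).
under [RHS]eq_integral do rewrite -(EFin_mean mu (bmeas_pair2 _)).
exact: Fubini iF.
Qed.

End Fubini.

(** * Right approximation of times and joint measurability *)

Section Grid.
Variable R : realType.

(** The first point of the mesh of width 1/(n+1) strictly after s. Strictness lets right limits
    apply, and lets a time known only through the events [tau < t] be discretized. *)
Definition grid (n : nat) (s : R) : R := (Num.floor (s * n.+1%:R) + 1)%:~R / n.+1%:R.

Lemma grid_gt n s : s < grid n s.
Proof. by rewrite /grid ltr_pdivlMr//; exact: floorD1_gt. Qed.

Lemma grid_le n s : grid n s <= s + n.+1%:R^-1.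
Proof.
rewrite /grid ler_pdivrMr// mulrDl mulVf// intrD lerD2r.
exact: floor_le.
Qed.

Lemma cvg_grid (s : R) : grid n s @[n --> \oo] --> s^'+.
Proof.
move=> A [e /= e0 sA].
change (\forall n \near \oo, A (grid n s)).
near=> n; apply: (sA (grid n s) _ (grid_gt n s)) => /=.
rewrite ltr0_norm ?subr_lt0 ?grid_gt// opprB ltrBlDl.
apply: le_lt_trans (grid_le n s) _; rewrite ltrD2l.
by near: n; exact: near_infty_natSinv_lt (PosNum e0).
Unshelve. all: by end_near. Qed.

(** At the times [grid n s] the function is constant in s on each mesh interval, hence jointly
    measurable; right continuity carries this to the limit. *)
Lemma measurable_right_cvg {d} {T : measurableType d} (F : R -> T -> R) :
  (forall s, measurable_fun setT (F s)) ->
  (forall w s, F x w @[x --> s^'+] --> F s w) ->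
  measurable_fun setT (fun z : measurableTypeR R * T => F z.1 z.2).
Proof.
move=> mF rF.
have mG n : measurable_fun setT (fun z : measurableTypeR R * T => F (grid n z.1) z.2).
  move=> _ B mB; rewrite setTI.
  pose S (k : int) : set (measurableTypeR R * T) :=
    `[k%:~R / n.+1%:R, (k + 1)%:~R / n.+1%:R[%classic `*` (F ((k + 1)%:~R / n.+1%:R) @^-1` B).
  rewrite (_ : _ @^-1` _ = \bigcup_k S k).
    apply: countable_bigcupT_measurable => // k.
    apply: measurableX; first exact: measurable_itv.
    by rewrite -[X in measurable X]setTI; exact: mF.
  apply/seteqP; split => -[s w] /=.
    move=> FB; exists (Num.floor (s * n.+1%:R)) => //; split => //=.
    rewrite in_itv /= ler_pdivrMr// ltr_pdivlMr// floor_le /=.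
    exact: floorD1_gt.
  move=> [k _ [/=]]; rewrite in_itv /= ler_pdivrMr// ltr_pdivlMr// => kn.
  by rewrite /grid (floor_def kn).
apply: (measurable_fun_cvg mG) => -[s w] _ /=.
by apply: (cvg_comp (fun n => grid n s) (fun x => F x w)); [exact: cvg_grid|exact: rF].
Qed.

End Grid.

(** * Exponential time *)

Section Exponential.
Variables (R : realType) (lam : R).
Hypothesis lam0 : 0 < lam.

Local Notation time := (measurableTypeR R).

Definition expo : probability time R :=
  exponential_distribution.exponential_distribution_exponential_prob__canonical__probability_measure_Probability lam0.

Local Notation leb := (@lebesgue_measure R).

Lemma expoE (A : set R) : expo A = (\int[leb]_(x in A) (exponential_pdf lam x)%:E)%E.
Proof. by []. Qed.

Lemma expo_dominated : expo `<< leb.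
Proof.
apply/null_content_dominatesP => A mA A0; rewrite expoE.
apply: null_set_integral => //.
apply/measurable_EFinP/measurable_funTS.
exact: measurable_exponential_pdf.
Qed.

(** The Radon-Nikodym derivative agrees almost everywhere with [exponential_pdf], since both have
    the same integral over every measurable set. *)
Lemma integral_expo (f : R -> \bar R) (A : set R) : measurable A ->
  expo.-integrable A f ->
  (\int[expo]_(x in A) f x = \int[leb]_(x in A) (f x * (exponential_pdf lam x)%:E))%E.
Proof.
move=> mA intf; have mf := measurable_int _ intf.
have mpdf := measurable_exponential_pdf lam.
rewrite -(Radon_Nikodym_change_of_variables expo_dominated)//=.
apply: ae_eq_integral => //.
- apply: emeasurable_funM => //; apply: (measurable_int leb).
  apply: (integrableS _ _ (@subsetT _ _)) => //=.
  by apply: Radon_Nikodym_integrable; exact: expo_dominated.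
- apply: emeasurable_funM => //=; apply/measurableT_comp => //=.
  exact/measurable_funTS.
- apply: ae_eqe_mul2l => /=.
  rewrite Radon_NikodymE//=; first exact: expo_dominated.
  move=> abmu; case: cid => /= h [h1 h2 h3].
  apply: integral_ae_eq => //=.
  + exact: integrableS h2.
  + exact/measurable_funTS/measurableT_comp.
  + by move=> E E01 mE; rewrite -h3.
Qed.

(** Turns discounted Lebesgue integrals, as in [payoff], into means under [expo]; the factor lam^-1
    undoes the normalization of the density. *)
Lemma integral_discount (f : time -> R) (A : set R) : measurable A ->
  A `<=` [set s | 0 <= s] -> bmeas f ->
  (\int[leb]_(s in A) (expR (- lam * s) * f s)%:E =
   (lam^-1 * mean expo (fun s => \1_A s * f s))%:E)%E.
Proof.
move=> mA A0 bf.
have bI : bmeas (\1_A : time -> R) by exact: bmeas_indic.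
rewrite EFinM -EFin_mean; last exact: bmeasM.
have -> : (\int[expo]_s (\1_A s * f s)%:E = \int[expo]_(s in A) (f s)%:E)%E.
  rewrite [RHS]integral_mkcond; apply: eq_integral => s _.
  by rewrite patchE indicE; case: (_ \in _); rewrite ?mul1r ?mul0r.
have intf : expo.-integrable A (EFin \o f).
  by apply: (integrableS measurableT) => //; exact: bmeas_integrable.
rewrite integral_expo// -integralZl//.
  apply: eq_integral => s; rewrite inE => /A0 /= s0.
  rewrite exponential_pdfE// -!EFinM; congr EFin.
  by field; rewrite gt_eqF.
have [mf [M fM]] := bf.
apply: (@integrableMr _ _ _ leb A mA f (EFin \o exponential_pdf lam)).
- exact: measurable_funTS.
- exists M; split; first exact: num_real.
  by move=> N MN s _ /=; rewrite (le_trans (fM s))// ltW.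
- by apply: (integrableS measurableT) => //; exact: integrable_exponential_pdf.
Qed.

Lemma expo_neg : expo `]-oo, 0[%classic = 0%E.
Proof.
rewrite expoE integral0_eq// => s /=; rewrite in_itv /= => s0.
by rewrite lt0_exponential_pdf.
Qed.

Lemma expo_ge (x : R) : expo `[x, +oo[%classic = (expR (- lam * Num.max 0 x))%:E.
Proof.
have neg := expo_neg.
have -> : `[x, +oo[%classic = ~` `]-oo, x[%classic :> set R by rewrite setCitvl.
rewrite probability_setC; last exact: measurable_itv.
have [x0|x0] := ltP x 0.
  rewrite mulr0 expR0.
  suff -> : expo `]-oo, x[%classic = 0%E by rewrite sube0.
  apply: (subset_measure0 _ _ _ neg) => //; try exact: measurable_itv.
  by move=> s /=; rewrite !in_itv /= => /lt_trans; apply.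
have -> : `]-oo, x[%classic = `]-oo, 0[%classic `|` `[0, x[%classic :> set R.
  by rewrite -itv_bndbnd_setU// bnd_simp.
rewrite measureU//; last first.
  rewrite -subset0 => s [/=]; rewrite !in_itv /= => s0 /andP[].
  by rewrite leNgt s0.
rewrite [X in (1 - (X + _))%E]neg add0e.
rewrite [X in (_ - X)%E](_ : _ = (1 - (expR (- lam * x))%:E)%E).
  change ((1 - (1 - expR (- lam * x)))%:E = (expR (- lam * x))%:E).
  by congr EFin; ring.
move: x0; rewrite le_eqVlt => /orP[/eqP <-|x0].
  by rewrite set_itvco0 measure0 mulr0 expR0 subee.
rewrite -(exponential_prob_itv0c _ x0) /exponential_prob.
apply: integral_itv_bndo_bndc.
apply/measurable_EFinP/measurable_funTS.
exact: measurable_exponential_pdf.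
Qed.

Let measurable_shift (t : R) : measurable_fun [set: time] (fun s : time => (s + t)%R : time).
Proof. exact: measurable_funD. Qed.

Definition shifted_expo (t : R) : {measure set time -> \bar R} :=
  measure_function.measure_function_pushforward__canonical__measure_function_Measure
    expo (measurable_shift t).

(** Lack of memory. The half-lines [[x, +oo[] are stable under intersection and generate the Borel
    sets, so two finite measures need only be compared there. *)
Lemma expo_shift_measure (t : R) (A : set R) : 0 <= t -> measurable A ->
  A `<=` [set s | t <= s] ->
  expo A = ((expR (- lam * t))%:E * expo ((fun s => (s + t)%R) @^-1` A))%E.
Proof.
move=> t0 mA At.
have mD : measurable (`[t, +oo[%classic : set time) by exact: measurable_itv.
have k0 : 0 <= expR (- lam * t) by exact: expR_ge0.
pose pm := shifted_expo t.
pose m2 := mscale (NngNum k0) pm.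
pose m1 := mrestr expo mD.
suff h : m1 A = m2 A.
  rewrite -[RHS]h /m1 /mrestr setIidl// => s /At /=.
  by rewrite in_itv /= andbT.
apply: (@measure_unique _ R time (@RGenCInfty.G R)
  (fun n => `[(- n%:R)%R, +oo[%classic)) => //.
- exact: RGenCInfty.measurableE.
- move=> B C [x ->] [y ->]; exists (Num.max x y).
  by apply/seteqP; split => s /=; rewrite !in_itv /= !andbT ge_max => /andP.
- by move=> n; exists (- n%:R).
- apply/seteqP; split => // x _.
  exists (Num.truncn `|x|).+1 => //=; rewrite in_itv /= andbT.
  rewrite lerNl; apply/ltW; apply: le_lt_trans (truncnS_gt _).
  by rewrite ler_normr lexx orbT.
- move=> B [x ->].
  transitivity (expo `[Num.max x t, +oo[%classic).
    congr (expo _); apply/seteqP; split => s /=; rewrite !in_itv /= !andbT ge_max.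
      by move=> [? ?]; apply/andP.
    by move=> /andP.
  transitivity ((expR (- lam * t))%:E * expo `[(x - t)%R, +oo[%classic)%E; last first.
    congr (_ * expo _)%E; apply/seteqP; split => s /=; rewrite !in_itv /= !andbT lerBlDr//.
  rewrite !expo_ge -EFinM -expRD; congr (expR _)%:E.
  rewrite -mulrDr; congr (_ * _).
  have -> : t + Num.max 0 (x - t) = Num.max t x by rewrite addr_maxr addr0 addrC subrK.
  by rewrite [Num.max x t]maxC maxA [Num.max 0 t]max_r.
- move=> n; rewrite /m1 /mrestr; apply: le_lt_trans (ltry 1).
  by apply: probability_le1; exact: measurableI.
Qed.

Lemma expo_shift (t : R) (f : time -> R) : 0 <= t -> bmeas f ->
  mean expo (fun s => \1_[set r | t <= r] s * f s) =
  expR (- lam * t) * mean expo (fun s : time => f (s + t)).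
Proof.
move=> t0.
have mphi : measurable_fun [set: time] (fun s : time => (s + t)%R : time).
  by apply: measurable_funD => //.
have mD : measurable (`[t, +oo[%classic : set time) by exact: measurable_itv.
have De : [set r | t <= r] = `[t, +oo[%classic :> set R.
  by apply/seteqP; split => s /=; rewrite in_itv /= andbT.
have bI : bmeas (\1_[set r | t <= r] : time -> R) by apply: bmeas_indic; rewrite De.
have k0 : 0 <= expR (- lam * t) by exact: expR_ge0.
have bt (g : time -> R) : bmeas g -> bmeas (fun s : time => g (s + t)).
  move=> [mg [M gM]]; split; last by exists M => s; exact: gM.
  exact: (measurableT_comp mg mphi).
(* Adding the bound M makes f nonnegative; the identity for the constant M is subtracted
   afterwards. *)
suff pos (g : time -> R) : bmeas g -> (forall s, 0 <= g s) ->
    mean expo (fun s => \1_[set r | t <= r] s * g s) =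
    expR (- lam * t) * mean expo (fun s : time => g (s + t)).
  move=> bf; have [mf [M fM]] := bf.
  have bM := @bmeas_cst _ time R M.
  have M0 (s : time) : 0 <= M by exact: le_trans (normr_ge0 _) (fM s).
  have eM := pos _ bM M0.
  have eFM : mean expo (fun s => \1_[set r | t <= r] s * (f s + M)) =
    expR (- lam * t) * mean expo (fun s => f (s + t) + M).
    apply: (pos (fun s => f s + M)); first exact: bmeasD.
    move=> s; rewrite -lerBlDr sub0r.
    by have := fM s; rewrite ler_norml => /andP[].
  have := eFM; under eq_mean do rewrite mulrDr.
  rewrite (meanD _ (bmeasM bI bf) (bmeasM bI bM)) eM (meanD _ (bt _ bf) bM).
  by rewrite mulrDr => /addIr.
move=> bg g0; apply: EFin_inj; rewrite EFinM -(EFin_mean _ (bt _ bg)) -(EFin_mean _ (bmeasM bI bg)).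
have -> : (\int[expo]_s (\1_[set r | (t <= r)%R] s * g s)%:E =
           \int[expo]_(s in `[t, +oo[) (g s)%:E)%E.
  rewrite [RHS]integral_mkcond De; apply: eq_integral => s _.
  by rewrite patchE indicE; case: (_ \in _); rewrite ?mul1r ?mul0r.
rewrite (eq_measure_integral (mscale (NngNum k0) (shifted_expo t))); last first.
  move=> A mA At; apply: (expo_shift_measure t0 mA).
  by move=> s /At /=; rewrite in_itv /= andbT.
have mg : measurable_fun `[t, +oo[%classic (EFin \o g).
  by apply/measurable_EFinP/measurable_funTS; case: bg.
rewrite (ge0_integral_mscale _ mD _ mg); last by move=> s _; rewrite lee_fin.
rewrite ge0_integral_pushforward//; last by move=> s _; rewrite lee_fin.
congr (_ * _)%E.
have bgt := bt _ bg.
have -> : (fun s : time => s + t : time) @^-1` `[t, +oo[ = `[0, +oo[%classic.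
  by apply/seteqP; split => s /=; rewrite !in_itv /= !andbT lerDr.
(* The negative half-line is null for the clock, so the integral over [[0, +oo[] is the full
   mean. *)
have -> : `[0, +oo[%classic = setT `\` `]-oo, 0[%classic :> set time.
  by rewrite setTD setCitvl.
apply/esym/ge0_negligible_integral => //.
- by apply/measurable_EFinP; case: bgt.
- by move=> s _; rewrite lee_fin.
- exact: expo_neg.
Qed.

End Exponential.

(** * Continuous functions vanishing at infinity *)

Section VanishingFunctions.
Variables (R : realType) (d : nat).
Local Notation E := 'rV[R]_d.
Implicit Types f g q : E -> R.

Lemma continuous_distP f :
  continuous f <-> forall x e, 0 < e -> \forall y \near x, `|f x - f y| <= e.
Proof.
split=> [cf x e e0|fP x].
  have /cvgrPdist_le := cf x; exact.
apply: (proj2 (@cvgrPdist_le R R^o E (nbhs x) (nbhs_filter x) f (f x))) => e e0.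
exact: fP.
Qed.

Lemma C0_bounded f : C0 f -> exists2 M : R, 0 <= M & forall x, `|f x| <= M.
Proof.
move=> [cf vf]; have [N fN] := vf 1 ltr01.
pose K := [set x : E | `|x| <= Num.max 0 N].
have cK : compact K.
  apply: bounded_closed_compact.
    exists (Num.max 0 N); split; first exact: num_real.
    by move=> M NM x /= /le_trans; apply; exact: ltW.
  have -> : K = (fun x : E => `|x|) @^-1` [set r : R | r <= Num.max 0 N] by [].
  apply: closed_comp; last exact: closed_le.
  by move=> x _; exact: norm_continuous.
have [M [_ fM]] : bounded_set (f @` K).
  by apply: compact_bounded; apply: continuous_compact => //; exact: continuous_subspaceT.
have M0 : 0 <= Num.max 1 (M + 1) by rewrite le_max ler01.
exists (Num.max 1 (M + 1)) => // x.
have [xN|Nx] := leP `|x| (Num.max 0 N).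
  by rewrite le_max; apply/orP; right; apply: (fM (M + 1)); rewrite ?ltrDl//; exists x.
rewrite le_max; apply/orP; left; apply/ltW/fN.
by apply: le_lt_trans Nx; rewrite le_max lexx orbT.
Qed.

Lemma C0_cst0 : C0 (fun _ : E => 0 : R).
Proof. by split; [exact: cst_continuous | move=> e e0; exists 0 => x _; rewrite normr0]. Qed.

Lemma C0D f g : C0 f -> C0 g -> C0 (fun x => f x + g x).
Proof.
move=> [cf vf] [cg vg]; split; first by move=> x; exact: (continuousD (cf x) (cg x)).
move=> e e0; have e20 : 0 < e / 2 by rewrite divr_gt0.
have [M fM] := vf _ e20; have [N gN] := vg _ e20.
exists (Num.max M N) => x; rewrite gt_max => /andP[Mx Nx].
rewrite [e]splitr; apply: le_lt_trans (ler_normD _ _) _.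
by apply: ltrD; [exact: fM | exact: gN].
Qed.

Lemma C0Ml q f : continuous q -> (exists M : R, forall x, `|q x| <= M) -> C0 f ->
  C0 (fun x => q x * f x).
Proof.
move=> cq [M qM] [cf vf]; split; first by move=> x; exact: (continuousM (cq x) (cf x)).
move=> e e0.
have M0 : 0 < Num.max 1 M by rewrite lt_max ltr01.
have [N fN] := vf _ (divr_gt0 e0 M0).
exists N => x /fN; rewrite ltr_pdivlMr// normrM => h.
apply: le_lt_trans h; rewrite mulrC ler_wpM2l//.
by rewrite (le_trans (qM x))// le_max lexx orbT.
Qed.

Lemma C0Z (c : R) f : C0 f -> C0 (fun x => c * f x).
Proof.
by apply: C0Ml; [exact: cst_continuous | exists `|c|].
Qed.

Lemma C0N f : C0 f -> C0 (fun x => - f x).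
Proof. by move=> /(C0Z (-1)); under eq_fun do rewrite mulN1r. Qed.

Lemma C0B f g : C0 f -> C0 g -> C0 (fun x => f x - g x).
Proof. by move=> cf cg; apply: C0D => //; exact: C0N. Qed.

Lemma C0_le f g : continuous f -> (forall x, `|f x| <= `|g x|) -> C0 g -> C0 f.
Proof.
move=> cf fg [_ vg]; split => // e /vg[M gM]; exists M => x /gM.
exact: le_lt_trans.
Qed.

Lemma C0_max f : C0 f -> C0 (fun x => Num.max 0 (f x)).
Proof.
move=> cf; apply: (C0_le _ _ cf).
  by move=> x; apply: (continuous_max (@cst_continuous _ _ 0 x)); case: cf => + _; exact.
by move=> x; have [f0|f0] := leP 0 (f x); rewrite ?normr0.
Qed.

Lemma C0_uniform f :
  (forall e : R, 0 < e -> exists2 g, C0 g & forall x, `|f x - g x| <= e) -> C0 f.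
Proof.
move=> fg; split.
  apply/continuous_distP => x e e0.
  have e30 : 0 < e / 3 by rewrite divr_gt0.
  have [g [cg _] gf] := fg _ e30.
  have /continuous_distP/(_ x _ e30) := cg; apply: filterS => y gxy.
  have := gf x; have := gf y; move: gxy; rewrite !ler_norml => /andP[? ?] /andP[? ?] /andP[? ?].
  by apply/andP; split; lra.
move=> e e0; have e20 : 0 < e / 2 by rewrite divr_gt0.
have [g [_ vg] gf] := fg _ e20; have [M gM] := vg _ e20; exists M => x /gM.
have := gf x; rewrite !ler_norml !ltr_norml => /andP[? ?] /andP[? ?].
by apply/andP; split; lra.
Qed.

(** Banach's fixed point theorem in C_0, with sup-norm bounds spelled out pointwise. *)
Lemma C0_banach (T : (E -> R) -> (E -> R)) (r : R) : 0 <= r < 1 ->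
  (forall f, C0 f -> C0 (T f)) ->
  (forall f g (c : R), C0 f -> C0 g -> (forall x, `|f x - g x| <= c) ->
    forall x, `|T f x - T g x| <= r * c) ->
  exists2 f, C0 f & T f = f.
Proof.
move=> /andP[r0 r1] CT cT.
pose y n := iter n T (fun _ => 0).
have Cy n : C0 (y n) by elim: n => [|n ih]; [exact: C0_cst0 | exact: CT].
have [c c0 yc] := C0_bounded (Cy 1%N).
have yS n x : `|y n.+1 x - y n x| <= c * r ^+ n.
  elim: n x => [|n ih] x; first by rewrite expr0 mulr1 subr0; exact: yc.
  by rewrite exprS mulrCA; exact: cT (Cy _) (Cy _) ih x.
pose K := c / (1 - r).
have K0 : 0 <= K by rewrite divr_ge0// subr_ge0 ltW.
have yD n m x : `|y (n + m)%N x - y n x| <= K * r ^+ n.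
  (* Since c = K (1 - r), the increments telescope when the bound is kept in this form. *)
  suff : `|y (n + m)%N x - y n x| <= K * (r ^+ n - r ^+ (n + m)).
    move=> /le_trans; apply; rewrite ler_wpM2l// gerBl exprn_ge0//.
  elim: m => [|m ih]; first by rewrite addn0 !subrr normr0 mulr0.
  rewrite addnS; have -> : y (n + m).+1 x - y n x =
    (y (n + m).+1 x - y (n + m)%N x) + (y (n + m)%N x - y n x) by ring.
  apply: (le_trans (ler_normD _ _)).
  apply: (le_trans (lerD (yS _ _) ih)).
  have -> : c = K * (1 - r) by rewrite divfK// subr_eq0 gt_eqF.
  by rewrite exprS le_eqVlt; apply/orP; left; apply/eqP; ring.
have geo : K * r ^+ n @[n --> \oo] --> 0.
  by apply: cvg_geometric; rewrite ger0_norm.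
have cvgy x : cvgn (fun n => y n x).
  apply/cauchy_cvgP/cauchy_ballP => e e0.
  have /cvgrPdist_lt/(_ _ (divr_gt0 e0 (ltr0Sn _ 1))) [N _ hN] := geo.
  have := hN N (leqnn N); rewrite sub0r normrN => geoN.
  pose V : set R := [set z | `|z - y N x| < e / 2].
  exists (V, V).
    have VN : \forall n \near \oo, V (y n x).
      exists N => // n /= Nn; rewrite /V /= -(subnKC Nn).
      by apply: le_lt_trans (yD _ _ _) _; apply: le_lt_trans geoN; exact: ler_norm.
    by split.
  move=> [z z'] [/=]; rewrite /V /ball /= !ltr_norml => /andP[? ?] /andP[? ?].
  by apply/andP; split; lra.
pose f x := limn (fun n => y n x).
have fy n x : `|f x - y n x| <= K * r ^+ n.
  have h : (`|y m x - y n x| @[m --> \oo]) --> `|f x - y n x|.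
    by apply: cvg_norm; apply: cvgB; [exact: cvgy | exact: cvg_cst].
  rewrite -(cvg_lim (@Rhausdorff R) h); apply: limr_le; first exact: cvgP h.
  by exists n => // m /= nm; rewrite -(subnKC nm).
have geoe e : 0 < e -> exists n, K * r ^+ n <= e.
  move=> e0; have /cvgrPdist_le/(_ _ e0) [N _ hN] := geo.
  exists N; have := hN N (leqnn N); rewrite sub0r normrN.
  by apply: le_trans; exact: ler_norm.
have Cf : C0 f.
  apply: C0_uniform => e /geoe[n ne]; exists (y n) => // x.
  exact: le_trans (fy n x) ne.
exists f => //; apply/funext => x; apply/eqP; rewrite -subr_eq0 -normr_le0.
apply/ler_addgt0Pr => e e0; rewrite add0r.
have [n ne] := geoe _ (divr_gt0 e0 (ltr0Sn _ 1)).
have h1 := cT _ _ _ Cf (Cy n) (fy n) x.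
have h2 := fy n.+1 x.
have h3 : r * (K * r ^+ n) <= K * r ^+ n.
  by rewrite ler_piMl ?(ltW r1)// mulr_ge0 ?exprn_ge0.
rewrite exprS mulrCA in h2.
have -> : T f x - f x = (T f x - T (y n) x) - (f x - y n.+1 x) by rewrite /=; ring.
apply: (le_trans (ler_normB _ _)); lra.
Qed.

End VanishingFunctions.

(** * Feller semigroup and its resolvent *)

Section Semigroup.
Variables (R : realType) (d : nat).
Local Notation E := 'rV[R]_d.
Local Notation time := (measurableTypeR R).
Implicit Types f g : E -> R.

Variable Pt : R -> (E -> R) -> (E -> R).
Hypothesis feller : feller_semigroup Pt.

Let PtC t f : 0 <= t -> C0 f -> C0 (Pt t f).
Proof. by case: feller => + _ _ _ _; exact. Qed.

Let Ptlin t (a : R) f g : 0 <= t -> C0 f -> C0 g ->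
  Pt t (fun x => a * f x + g x) = (fun x => a * Pt t f x + Pt t g x).
Proof. by case: feller => _ + _ _ _; exact. Qed.

Let Pt_cst0 t : 0 <= t -> Pt t (fun _ => 0) = (fun _ => 0).
Proof.
move=> t0; have := Ptlin 1 t0 (C0_cst0 R d) (C0_cst0 R d).
under eq_fun do rewrite mulr0 addr0.
move=> h; apply/funext => x; have := congr1 (fun f => f x) h => /= /eqP.
by rewrite mul1r -subr_eq0 opprD addrA subrr sub0r oppr_eq0 => /eqP.
Qed.

Lemma PtZ t (a : R) f : 0 <= t -> C0 f ->
  Pt t (fun x => a * f x) = (fun x => a * Pt t f x).
Proof.
move=> t0 cf; have := Ptlin a t0 cf (C0_cst0 R d).
rewrite Pt_cst0//; under eq_fun do rewrite addr0.
by under [RHS]eq_fun do rewrite addr0.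
Qed.

Lemma PtD t f g : 0 <= t -> C0 f -> C0 g ->
  Pt t (fun x => f x + g x) = (fun x => Pt t f x + Pt t g x).
Proof.
move=> t0 cf cg; have := Ptlin 1 t0 cf cg.
under eq_fun do rewrite mul1r.
by under [RHS]eq_fun do rewrite mul1r.
Qed.

Lemma PtB t f g : 0 <= t -> C0 f -> C0 g ->
  Pt t (fun x => f x - g x) = (fun x => Pt t f x - Pt t g x).
Proof.
move=> t0 cf cg; have := PtD t0 cf (C0Z (-1) cg); rewrite PtZ//.
under eq_fun do rewrite mulN1r.
by under [RHS]eq_fun do rewrite mulN1r.
Qed.

Let Pt_pos t f (M : R) : 0 <= t -> C0 f -> 0 < M -> (forall x, 0 <= f x <= M) ->
  forall x, 0 <= Pt t f x <= M.
Proof.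
move=> t0 cf M0 fM x; have [_ _ P01 _ _] := feller.
have cMf : C0 (fun x => M^-1 * f x) by exact: C0Z.
have /P01 : forall x, 0 <= M^-1 * f x <= 1.
  move=> y; have /andP[f0 f1] := fM y.
  by rewrite mulr_ge0 ?invr_ge0 ?(ltW M0)//= mulrC ler_pdivrMr// mul1r.
move=> /(_ t t0 cMf x); rewrite PtZ// => /andP[].
by rewrite pmulr_rge0 ?invr_gt0// => -> /=; rewrite mulrC ler_pdivrMr// mul1r.
Qed.

(** The semigroup axioms control functions with values in [0, 1], so f is split into positive and
    negative parts and each is rescaled; e keeps the scale positive when M = 0. *)
Lemma Pt_contraction t f (M : R) : 0 <= t -> C0 f -> (forall x, `|f x| <= M) ->
  forall x, `|Pt t f x| <= M.
Proof.
move=> t0 cf fM x; apply/ler_addgt0Pr => e e0.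
have M0 : 0 <= M by exact: le_trans (normr_ge0 _) (fM x).
have Me : 0 < M + e by rewrite ltr_wpDl.
pose fp x := Num.max 0 (f x); pose fn x := Num.max 0 (- f x).
have cp : C0 fp by exact: C0_max.
have cn : C0 fn by apply: C0_max; exact: C0N.
have fE : f = (fun x => fp x - fn x).
  by apply/funext => y; rewrite /fp /fn; case: (leP 0 (f y)); case: (leP 0 (- f y)); lra.
have /andP[p0 p1] : 0 <= Pt t fp x <= M + e.
  apply: Pt_pos => // y; rewrite /fp le_max lexx /= ge_max (ltW Me) /=.
  by have := fM y; rewrite ler_norml => /andP[_ ?]; rewrite ler_wpDr ?(ltW e0).
have /andP[n0 n1] : 0 <= Pt t fn x <= M + e.
  apply: Pt_pos => // y; rewrite /fn le_max lexx /= ge_max (ltW Me) /=.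
  by have := fM y; rewrite ler_norml => /andP[? _]; rewrite ler_wpDr ?(ltW e0)// lerNl.
by rewrite fE PtB// ler_norml; apply/andP; split; lra.
Qed.

(** P_t f - P_s f is P_s applied to P_(t-s) f - f, so the modulus at time 0 serves at all times,
    uniformly in space. *)
Lemma Pt_modulus f (e : R) : C0 f -> 0 < e -> exists2 r : R, 0 < r &
  forall s t, 0 <= s -> s <= t -> t < s + r -> forall x, `|Pt t f x - Pt s f x| <= e.
Proof.
move=> cf e0; have [_ _ _ [P0 PD] Pc] := feller.
have [r /= r0 hr] := Pc f cf e e0.
exists r => // s t s0 st tsr x.
have ts0 : 0 <= t - s by rewrite subr_ge0.
have -> : Pt t f = Pt s (Pt (t - s) f) by rewrite -PD// addrC subrK.
have -> : Pt s (Pt (t - s) f) x - Pt s f x = Pt s (fun y => Pt (t - s) f y - f y) x.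
  by rewrite PtB//; exact: PtC.
apply: Pt_contraction => //; first by apply: C0B => //; exact: PtC.
move=> y; move: ts0; rewrite le_eqVlt => /orP[/eqP <-|ts0].
  by rewrite P0// subrr normr0 ltW.
apply/ltW/hr => //=; rewrite sub0r normrN gtr0_norm//; lra.
Qed.

(* Negative times are frozen, as for paths, so that [s] may range over all of R in integrals. *)
Definition Qt (s : R) f : E -> R := Pt (Num.max 0 s) f.

Let max0 (s : R) : 0 <= Num.max 0 s. Proof. by rewrite le_max lexx. Qed.

Lemma Qt_C0 s f : C0 f -> C0 (Qt s f).
Proof. exact: PtC. Qed.

Lemma Qt_contraction s f (M : R) : C0 f -> (forall x, `|f x| <= M) ->
  forall x, `|Qt s f x| <= M.
Proof. exact: Pt_contraction. Qed.

Lemma continuous_Qt f x : C0 f -> continuous (fun s => Qt s f x).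
Proof.
move=> cf s; apply/cvgrPdist_le => e e0.
have [r r0 hr] := Pt_modulus cf e0.
near=> t.
have : `|s - t| < r by near: t; exact: cvgr_dist_lt.
rewrite ltr_norml => /andP[st ts].
rewrite /Qt; have [le_st|/ltW le_ts] := leP s t.
  rewrite distrC; apply: hr => //.
    by rewrite ge_max !le_max lexx le_st orbT.
  by rewrite /Order.max; case: ifP; case: ifP; lra.
apply: hr => //.
  by rewrite ge_max !le_max lexx le_ts orbT.
by rewrite /Order.max; case: ifP; case: ifP; lra.
Unshelve. all: by end_near. Qed.

Lemma bmeas_Qt f x : C0 f -> bmeas (fun s : time => Qt s f x).
Proof.
move=> cf; split.
  have h : measurable_fun setT (fun s : R => Qt s f x).
    by apply: continuous_measurable_fun; exact: continuous_Qt.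
  by [].
have [M _ fM] := C0_bounded cf.
by exists M => s; exact: Qt_contraction.
Qed.

Section Resolvent.
Variables (lam : R) (lam0 : 0 < lam).

(* [lam] times the resolvent operator at [lam]: the semigroup at an exponential time. *)
Definition res f x : R := mean (expo lam0) (fun s => Qt s f x).

Lemma resZ (a : R) f : C0 f -> res (fun x => a * f x) = (fun x => a * res f x).
Proof.
move=> cf; apply/funext => x; rewrite /res -meanZ; last exact: bmeas_Qt.
by apply: eq_mean => s; rewrite /Qt PtZ.
Qed.

Lemma resB f g : C0 f -> C0 g -> res (fun x => f x - g x) = (fun x => res f x - res g x).
Proof.
move=> cf cg; apply/funext => x; rewrite /res -meanB; [|exact: bmeas_Qt..].
by apply: eq_mean => s; rewrite /Qt PtB.
Qed.

Lemma res_contraction f (M : R) : C0 f -> (forall x, `|f x| <= M) ->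
  forall x, `|res f x| <= M.
Proof.
move=> cf fM x; apply: mean_bound; first exact: bmeas_Qt.
by move=> s; exact: Qt_contraction.
Qed.

(** Dominated convergence is sequential, so a failure of continuity or of decay is first turned into
    a sequence of points. *)
Lemma res_C0 f : C0 f -> C0 (res f).
Proof.
move=> cf; have [M M0 fM] := C0_bounded cf.
have seqcvg (u : nat -> E) (a : R -> R) : (forall s, Qt s f (u n) @[n --> \oo] --> a s) ->
    res f (u n) @[n --> \oo] --> mean (expo lam0) (a : time -> R).
  move=> ua; apply: (fun h1 h2 h3 => proj2 (@mean_cvg _ _ _ _ _ _ M h1 h2 h3)) => //.
    by move=> n; case: (bmeas_Qt (u n) cf).
  by move=> n s; exact: Qt_contraction.
split.
  apply/continuous_distP => x e e0; apply: contrapT => hn.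
  have {hn}/choice[u hu] : forall n : nat, exists y : E,
      `|x - y| < n.+1%:R^-1 /\ e < `|res f x - res f y|.
    move=> n; apply: contrapT => hn2; apply: hn.
    have n0 : 0 < n.+1%:R^-1 :> R by rewrite invr_gt0.
    have /cvgrPdist_lt/(_ _ n0) := @cvg_id _ (nbhs x).
    apply: filterS => y xy; rewrite leNgt; apply/negP => ey.
    by apply: hn2; exists y.
  have ux : u n @[n --> \oo] --> x.
    apply/cvgrPdist_lt => r r0; near=> n; apply: lt_trans (hu n).1 _.
    by near: n; exact: (near_infty_natSinv_lt (PosNum r0)).
  have /cvgrPdist_lt/(_ _ e0) [N _ /(_ N (leqnn N))] : res f (u n) @[n --> \oo] --> res f x.
    apply: (seqcvg u (fun s => Qt s f x)) => s.
    exact: (cvg_comp _ _ ux ((Qt_C0 s cf).1 x)).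
  by rewrite ltNge (ltW (hu N).2).
move=> e e0; apply: contrapT => hn.
have {hn}/choice[u hu] : forall n : nat, exists y : E, n%:R < `|y| /\ e <= `|res f y|.
  move=> n; apply: contrapT => hn2; apply: hn; exists n%:R => y ny.
  by rewrite ltNge; apply/negP => ey; apply: hn2; exists y.
have : res f (u n) @[n --> \oo] --> mean (expo lam0) (fun _ : time => 0).
  apply: seqcvg => s; apply/cvgrPdist_lt => r r0.
  have [_ /(_ _ r0) [N hN]] := Qt_C0 s cf.
  near=> n; rewrite sub0r normrN; apply: hN; apply: lt_trans (hu n).1.
  by near: n; exact: nbhs_infty_gtr.
rewrite mean_cst => /cvgrPdist_lt/(_ _ e0) [N _ /(_ N (leqnn N))].
by rewrite sub0r normrN ltNge (hu N).2.
Unshelve. all: by end_near. Qed.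

End Resolvent.
End Semigroup.

(** * Paths and the Markov property *)

Section Paths.
Variables (R : realType) (d : nat).
Local Notation E := 'rV[R]_d.
Local Notation time := (measurableTypeR R).
Local Notation Om := (Omega R d).
Implicit Types (f g : E -> R) (w : Om).

Lemma X_neg (s : R) w : s < 0 -> X s w = X 0 w.
Proof. by have [h _ _] := cpathP w; exact: h. Qed.

Lemma right_cont_X (s : R) w : X x w @[x --> s^'+] --> X s w.
Proof.
have [s0|s0] := leP 0 s.
  by have [_ h _] := cpathP w; exact: h.
have -> : X s w = X 0 w by exact: X_neg.
apply: cvg_near_cst; near=> x.
apply: X_neg; near: x; exact: nbhs_right_lt.
Unshelve. all: by end_near. Qed.

Lemma right_cont_fX f (s : R) w : continuous f ->
  f (X x w) @[x --> s^'+] --> f (X s w).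
Proof.
by move=> cf; apply: (cvg_comp (fun x => X x w) f); [exact: right_cont_X | exact: cf].
Qed.

Lemma measurable_X_open (s : R) (B : set E) : open B -> measurable (X s @^-1` B : set Om).
Proof.
move=> oB; have [s0|s0] := leP 0 s; first by apply: sub_sigma_algebra; exists s, B.
have -> : X s @^-1` B = X 0 @^-1` B :> set Om.
  by apply/seteqP; split => w /=; rewrite X_neg.
by apply: sub_sigma_algebra; exists 0, B.
Qed.

Lemma measurable_X_closed (s : R) (B : set E) : closed B -> measurable (X s @^-1` B : set Om).
Proof.
move=> cB; rewrite -[X in measurable X]setCK; apply: measurableC.
rewrite preimage_setC; apply: measurable_X_open; exact: closed_openC.
Qed.

Lemma measurable_fX (s : R) f : continuous f -> measurable_fun setT (fun w : Om => f (X s w)).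
Proof.
move=> /continuousP cf; apply: (measurability _ (RGenOpens.measurableE R)).
move=> _ [_ [a [b ->]] <-]; rewrite setTI.
rewrite (_ : _ @^-1` _ = X s @^-1` (f @^-1` `]a, b[%classic))//.
by apply: measurable_X_open; apply: cf; exact: interval_open.
Qed.

Lemma bmeas_fX (s : R) f : C0 f -> bmeas (fun w : Om => f (X s w)).
Proof.
move=> cf; split; first by apply: measurable_fX; case: cf.
by have [M _ fM] := C0_bounded cf; exists M.
Qed.

Lemma bmeas_fX_joint f : C0 f -> bmeas (fun z : time * Om => f (X z.1 z.2)).
Proof.
move=> cf; split; last by have [M _ fM] := C0_bounded cf; exists M.
apply: (@measurable_right_cvg _ _ _ (fun s w => f (X s w))).
  by move=> s; apply: measurable_fX; case: cf.
by move=> w s; apply: right_cont_fX; case: cf.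
Qed.

Lemma F0_measurable (t : R) (A : set Om) : F0 t A -> measurable A.
Proof.
apply: smallest_sub; first exact: sigma_algebra_measurable.
by move=> _ [r [B [_ oB ->]]]; exact: measurable_X_open.
Qed.

Lemma F0_mono (s t : R) (A : set Om) : s <= t -> F0 s A -> F0 t A.
Proof.
move=> st; apply: sub_smallest2r; first exact: smallest_sigma_algebra.
move=> _ [r [B [/andP[r0 rs] oB ->]]]; exists r, B; split => //.
by rewrite r0 (le_trans rs).
Qed.

Lemma F0T (t : R) : F0 t (setT : set Om).
Proof. exact: (@measurableT _ (g_sigma_algebraType _)). Qed.

Lemma F0C (t : R) (A : set Om) : F0 t A -> F0 t (~` A).
Proof. exact: (@measurableC _ (g_sigma_algebraType _)). Qed.

Lemma F0I (t : R) (A B : set Om) : F0 t A -> F0 t B -> F0 t (A `&` B).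
Proof. exact: (@measurableI _ (g_sigma_algebraType _)). Qed.

Lemma F0_X_open (s t : R) (B : set E) : 0 <= s <= t -> open B -> F0 t (X s @^-1` B : set Om).
Proof. by move=> st oB; apply: sub_sigma_algebra; exists s, B. Qed.

(* Stopping times of the right-continuous filtration generated by [F0]. *)
Definition optional (tau : Om -> \bar R) :=
  (forall w, (0 <= tau w)%E) /\
  forall t : R, 0 < t -> F0 t [set w | (tau w < t%:E)%E].

Lemma optional_measurable tau : optional tau -> measurable_fun setT tau.
Proof.
move=> [t0 tF]; apply: (measurability _ (ErealGenInftyO.measurableE R)).
move=> _ [_ [r ->] <-]; rewrite setTI.
have [r0|r0] := ltP 0 r.
  apply: (@F0_measurable r).
  rewrite (_ : _ @^-1` _ = [set w | (tau w < r%:E)%E]); first exact: tF.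
  by apply/seteqP; split => w /=; rewrite in_itv.
rewrite (_ : _ @^-1` _ = set0) //; apply/seteqP; split => w //=.
rewrite in_itv /= => /lt_le_trans/(_ (_ : (r%:E <= 0)%E)).
by rewrite lee_fin => /(_ r0); rewrite ltNge t0.
Qed.

(** The complement of B is open and paths are right-continuous, so leaving B before t is witnessed
    at a rational time in ]0, t[. *)
Lemma optional_exit (B : set E) : closed B -> optional (exit_time B).
Proof.
move=> cB; split=> [w|t t0].
  by apply: le_ereal_inf_tmp => _ [t [t0 _] <-]; rewrite lee_fin ltW.
have -> : [set w | (exit_time B w < t%:E)%E] =
  \bigcup_(q in [set q : rat | 0 < ratr q :> R /\ ratr q < t :> R]) (X (ratr q) @^-1` (~` B)).
  apply/seteqP; split => w /=.
    move=> /ereal_inf_lt[_ [s [s0 nB] <-]]; rewrite lte_fin => st.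
    have nbB : nbhs (X s w) (~` B).
      by apply: open_nbhs_nbhs; split => //; exact: closed_openC.
    have nearB : \forall x \near s^'+, (~` B) (X x w) by exact: (right_cont_X nbB).
    have : \forall x \near s^'+, (~` B) (X x w) /\ x < t.
      by near=> x; split; near: x => //; exact: nbhs_right_lt.
    move=> [e /= e0 he].
    have [q] : exists q : rat, ratr q \in `]s, (s + e)[.
      by apply: rat_in_itvoo; rewrite ltrDl.
    rewrite in_itv /= => /andP[sq qe].
    have [||h1 h2] := he (ratr q).
    - by rewrite /= ltr0_norm ?subr_lt0// opprB ltrBlDl.
    - exact: sq.
    - by exists q => //; split => //; exact: lt_trans sq.
  move=> [q [q0 qt] nB]; apply: le_lt_trans (_ : (ratr q)%:E < _)%E; last by rewrite lte_fin.
  by apply: ereal_inf_lbound; exists (ratr q).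
rewrite bigcup_mkcond; apply: (@bigcupT_measurable_rat _ (g_sigma_algebraType _)) => q.
case: ifPn => [|_]; last exact: (@measurable0 _ (g_sigma_algebraType _)).
rewrite inE => -[q0 qt]; apply: F0_X_open; last exact: closed_openC.
by rewrite !ltW.
Unshelve. all: by end_near. Qed.

End Paths.

Section FellerProcess.
Variables (R : realType) (d : nat).
Local Notation E := 'rV[R]_d.
Local Notation time := (measurableTypeR R).
Local Notation Om := (Omega R d).
Implicit Types (f g : E -> R) (w : Om).
Variables (Pt : R -> (E -> R) -> (E -> R)) (P : E -> probability Om R).
Hypotheses (feller : feller_semigroup Pt) (process : feller_process Pt P).

Lemma initial_negligible x : (P x).-negligible [set w | X 0 w != x].
Proof.
have mx : measurable [set w : Om | X 0 w = x].
  apply: (@measurable_X_closed _ _ 0 [set x]).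
  exact/accessible_closed_set1/hausdorff_accessible/norm_hausdorff.
exists (~` [set w | X 0 w = x]); split.
- exact: measurableC.
- by rewrite probability_setC// process.1 subee.
- by move=> w /= /eqP.
Qed.

Lemma mean_initial x f : C0 f -> mean (P x) (fun w => f (X 0 w)) = f x.
Proof.
move=> cf; rewrite -[RHS](mean_cst (P x)).
apply: (eq_mean_ae (initial_negligible x)); first exact: bmeas_fX.
  exact: bmeas_cst.
by move=> w /= /negP; rewrite negbK => /eqP ->.
Qed.

Lemma markov x (s t : R) f (A : set Om) : 0 <= s -> 0 <= t -> C0 f -> F0 s A ->
  mean (P x) (fun w => \1_A w * f (X (s + t) w)) =
  mean (P x) (fun w => \1_A w * Pt t f (X s w)).
Proof.
move=> s0 t0 cf FA; have mA := F0_measurable FA.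
have bI : bmeas (\1_A : Om -> R) by exact: bmeas_indic.
have CP : C0 (Pt t f) by case: feller => h _ _ _ _; exact: h.
have indE (h : Om -> R) : (\int[P x]_w (\1_A w * h w)%:E = \int[P x]_(w in A) (h w)%:E)%E.
  rewrite [RHS]integral_mkcond; apply: eq_integral => w _.
  by rewrite patchE indicE; case: (_ \in _); rewrite ?mul1r ?mul0r.
by rewrite /mean /Rintegral !indE process.2.
Qed.

Lemma mean_X x (s : R) f : C0 f -> mean (P x) (fun w => f (X s w)) = Qt Pt s f x.
Proof.
move=> cf; have CP t : 0 <= t -> C0 (Pt t f) by case: feller => h _ _ _ _ t0; exact: h.
have [s0|s0] := leP 0 s.
  have := markov x (lexx 0) s0 cf (@F0T _ _ 0).
  rewrite add0r /Qt; under eq_mean do rewrite indicT mul1r.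
  by under [X in _ = X -> _]eq_mean do rewrite indicT mul1r; rewrite mean_initial ?max_r//; exact: CP.
under eq_mean do rewrite X_neg//.
have -> : Qt Pt s f = Pt 0 f by rewrite /Qt max_l// ltW.
by rewrite mean_initial//; case: feller => _ _ _ [->].
Qed.
End FellerProcess.

(** Countable additivity; it serves with A k the event that a discretized time takes its k-th
    value. *)
Lemma mean_bigcup_eq0 {d} {T : measurableType d} {R : realType} (mu : probability T R)
    (A : (set T)^nat) (h : T -> R) :
  trivIset setT A -> (forall k, measurable (A k)) -> bmeas h ->
  (forall x, ~ (\bigcup_k A k) x -> h x = 0) ->
  (forall k, mean mu (fun x => \1_(A k) x * h x) = 0) -> mean mu h = 0.
Proof.
move=> tA mA bh h0 hA.
have mU : measurable (\bigcup_k A k) by exact: bigcupT_measurable.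
apply: EFin_inj; rewrite -EFin_mean//.
have intE (B : set T) : measurable B -> (\int[mu]_(x in B) (h x)%:E)%E =
    (mean mu (fun x => \1_B x * h x))%:E.
  move=> mB; have bI : bmeas (\1_B : T -> R) by exact: bmeas_indic.
  rewrite -(EFin_mean _ (bmeasM bI bh)) integral_mkcond.
  apply: eq_integral => x _.
  by rewrite patchE indicE; case: (_ \in _); rewrite ?mul1r ?mul0r.
have -> : (\int[mu]_x (h x)%:E = \int[mu]_(x in \bigcup_k A k) (h x)%:E)%E.
  rewrite [RHS]integral_mkcond; apply: eq_integral => x _.
  by rewrite patchE; case: ifPn => // /negP; rewrite inE => /h0 ->.
rewrite integral_bigcup//.
  by rewrite eseries0// => k _ _; rewrite intE// hA.
by apply: (integrableS measurableT) => //; exact: bmeas_integrable.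
Qed.

(** * Dynkin's formula at optional times *)

Section Dynkin.
Variables (R : realType) (d : nat).
Local Notation E := 'rV[R]_d.
Local Notation time := (measurableTypeR R).
Local Notation Om := (Omega R d).
Implicit Types (f g : E -> R) (w : Om) (tau : Om -> \bar R).
Variables (Pt : R -> (E -> R) -> (E -> R)) (P : E -> probability Om R).
Hypotheses (feller : feller_semigroup Pt) (process : feller_process Pt P).
Variables (lam : R) (lam0 : 0 < lam).

(** The exponential law has no atoms, so endpoints may be added to or removed from a cost
    integral. *)
Lemma expo_strict (t : R) (f : time -> R) : bmeas f ->
  mean (expo lam0) (fun s => \1_[set r : time | t < r] s * f s) =
  mean (expo lam0) (fun s => \1_[set r : time | t <= r] s * f s).
Proof.
move=> bf.
have b1 : bmeas (\1_[set r : time | t < r] : time -> R).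
  apply: bmeas_indic; rewrite (_ : [set _ | _] = `]t, +oo[%classic); first exact: measurable_itv.
  by apply/seteqP; split => s /=; rewrite in_itv /= andbT.
have b2 : bmeas (\1_[set r : time | t <= r] : time -> R).
  apply: bmeas_indic; rewrite (_ : [set _ | _] = `[t, +oo[%classic); first exact: measurable_itv.
  by apply/seteqP; split => s /=; rewrite in_itv /= andbT.
have nt : (expo lam0).-negligible [set t : time].
  exists [set t]; split => //.
  by rewrite expoE integral_set1.
apply: (eq_mean_ae nt) => [||s /= st]; [exact: bmeasM|exact: bmeasM|].
rewrite !indicE; congr (_%:R * _); congr nat_of_bool.
apply/asboolP/asboolP => /=; first exact: ltW.
by move=> ts; rewrite lt_neqAle ts andbT; apply/eqP => h; apply: st.
Qed.

(* [lam] times the cost discounted over ]tau, +oo[, i.e. after the stopping time. *)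
Definition discounted_cost f tau w : R :=
  mean (expo lam0) (fun s => \1_[set r : time | (tau w < r%:E)%E] s * f (X s w)).

Definition discounted_exit g tau w : R :=
  if tau w is z%:E then expR (- lam * z) * g (X z w) else 0.

Local Notation J := discounted_cost.
Local Notation D := discounted_exit.

Lemma bmeas_cost_joint f tau : C0 f -> measurable_fun setT tau ->
  bmeas (fun z : time * Om => \1_[set r : time | (tau z.2 < r%:E)%E] z.1 * f (X z.1 z.2)).
Proof.
move=> cf mtau.
have mA : measurable [set z : time * Om | (tau z.2 < (z.1)%:E)%E].
  rewrite -[X in measurable X]setTI; apply: measurable_lte => //.
    exact: (measurableT_comp mtau measurable_snd).
  apply/measurable_EFinP; exact: measurable_fst.
exact: (bmeasM (bmeas_indic mA) (bmeas_fX_joint cf)).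
Qed.

Lemma bmeas_cost_path f tau w : C0 f -> measurable_fun setT tau ->
  bmeas (fun s : time => \1_[set r : time | (tau w < r%:E)%E] s * f (X s w)).
Proof. by move=> cf mtau; exact: (bmeas_pair2 (bmeas_cost_joint cf mtau) w). Qed.

Lemma bmeas_cost f tau : C0 f -> measurable_fun setT tau -> bmeas (J f tau).
Proof. by move=> cf mtau; exact: (bmeas_mean2 (expo lam0) (P 0) (bmeas_cost_joint cf mtau)). Qed.

Lemma exit_bound g tau (M : R) w : 0 <= M -> (forall x, `|g x| <= M) -> (0 <= tau w)%E ->
  `|D g tau w| <= M.
Proof.
move=> M0 gM; rewrite /D; case: (tau w) => [z| |]; rewrite ?normr0// lee_fin => z0.
rewrite normrM (ger0_norm (expR_ge0 _)) -[leRHS]mul1r ler_pM ?expR_ge0//.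
by rewrite -expR0 ler_expR mulNr oppr_le0 mulr_ge0// ltW.
Qed.

Lemma bmeas_exit g tau : C0 g -> (forall w, (0 <= tau w)%E) ->
  measurable_fun setT tau -> bmeas (D g tau).
Proof.
move=> cg tau0 mtau; have [M M0 gM] := C0_bounded cg.
split; last by exists M => w; exact: exit_bound.
have -> : D g tau = (fun w => \1_[set w | (tau w < +oo)%E] w *
    (fun z : time * Om => expR (- lam * z.1) * g (X z.1 z.2)) (fine (tau w), w)).
  apply/funext => w; rewrite /D indicE.
  have := tau0 w; case tw : (tau w) => [z| |] //= _.
    by rewrite mem_set ?mul1r//= tw ltry.
  by rewrite memNset ?mul0r//= tw.
apply: measurable_funM.
  apply: measurable_indic; rewrite -[X in measurable X]setTI.
  by apply: measurable_lte => //; exact: measurable_cst.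
apply: (measurableT_comp (f := fun z : time * Om => expR (- lam * z.1) * g (X z.1 z.2))).
  apply: measurable_funM; last by case: (bmeas_fX_joint cg).
  apply: measurableT_comp; first exact: measurable_expR.
  by apply: measurable_funM; [exact: measurable_cst | exact: measurable_fst].
apply: measurable_fun_pair; last exact: measurable_id.
exact: (measurableT_comp (@fine_measurable R setT measurableT) mtau).
Qed.

(** Combine the Markov property at t, for each s > t, with the lack of memory of the clock: given
    the past, the expected cost after t is e^(-lam t) R f(X_t). *)
Lemma cost_cst_split f (t : R) x (A : set Om) : 0 <= t -> C0 f -> F0 t A ->
  mean (P x) (fun w => \1_A w * J f (fun _ => t%:E) w) =
  mean (P x) (fun w => \1_A w * D (res Pt lam0 f) (fun _ => t%:E) w).
Proof.
move=> t0 cf FA; have mA := F0_measurable FA.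
have bI : bmeas (\1_A : Om -> R) by exact: bmeas_indic.
have mt : measurable_fun setT (fun _ : Om => t%:E) by exact: measurable_cst.
have bIz : bmeas (fun z : time * Om => \1_A z.2 : R).
  have [mI [M IM]] := bI; split; last by exists M => z; exact: IM.
  exact: (measurableT_comp mI measurable_snd).
have bQ : bmeas (fun z : time * Om => \1_A z.2 * Qt Pt z.1 f (X t z.2)).
  apply: (bmeasM bIz); split; last first.
    by have [M _ fM] := C0_bounded cf; exists M => z; exact: Qt_contraction.
  apply: (@measurable_right_cvg _ _ _ (fun s w => Qt Pt s f (X t w))).
    by move=> s; apply: measurable_fX; case: (Qt_C0 feller s cf).
  by move=> w s; apply: cvg_at_right_filter; exact: continuous_Qt.
have bJ := bmeasM bIz (bmeas_cost_joint cf mt).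
pose K (s : time) := mean (P x) (fun w => \1_A w * Qt Pt s f (X t w)).
have bK : bmeas K by exact: (bmeas_mean1 (expo lam0) (P x) bQ).
transitivity (mean (expo lam0) (fun s => \1_[set r : time | t <= r] s * K (s - t))).
  have bKt : bmeas (fun s : time => K (s - t)).
    have [mK [M KM]] := bK; split; last by exists M => s; exact: KM.
    apply: (measurableT_comp mK).
    by apply: measurable_funB => //; exact: measurable_cst.
  rewrite -expo_strict//.
  transitivity (mean (P x) (fun w => mean (expo lam0) (fun s =>
      \1_A w * (\1_[set r : time | (t%:E < r%:E)%E] s * f (X s w))))).
    by apply: eq_mean => w; rewrite meanZ//; exact: (bmeas_cost_path w cf mt).
  rewrite -(mean_swap (expo lam0) (P x) bJ); apply: eq_mean => s /=.
  have -> : \1_[set r : time | (t%:E < r%:E)%E] s = \1_[set r : time | t < r] s :> R by [].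
  transitivity (\1_[set r : time | t < r] s * mean (P x) (fun w => \1_A w * f (X s w))).
    rewrite -meanZ; last exact: (bmeasM bI (bmeas_fX s cf)).
    by apply: eq_mean => w; rewrite mulrCA.
  rewrite indicE; have [ts|_] := boolP (s \in _); rewrite ?mul0r ?mul1r//.
  rewrite inE /= in ts.
  have st0 : 0 <= s - t by rewrite subr_ge0 ltW.
  rewrite /K /Qt max_r// -(markov feller process _ t0 st0 cf FA).
  by apply: eq_mean => w; rewrite addrC subrK.
rewrite expo_shift//; last first.
  have [mK [M KM]] := bK; split; last by exists M => s; exact: KM.
  apply: (measurableT_comp mK).
  by apply: measurable_funB => //; exact: measurable_cst.
have -> : mean (expo lam0) (fun s : time => K (s + t - t)) = mean (expo lam0) K.
  by apply: eq_mean => s; rewrite addrK.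
rewrite /K (mean_swap (expo lam0) (P x) bQ).
rewrite -meanZ; last exact: (bmeas_mean2 (expo lam0) (P x) bQ).
apply: eq_mean => w /=; rewrite meanZ; last exact: bmeas_Qt.
by rewrite /D /res mulrCA.
Qed.

Lemma measurable_grid n : measurable_fun setT (grid n : R -> R).
Proof.
apply: nondecreasing_measurable => //; move=> a b ab.
by rewrite /grid ler_pM2r ?invr_gt0// ler_int lerD2r le_floor// ler_pM2r.
Qed.

Definition grid_time n tau w : \bar R := er_map (grid n) (tau w).

Lemma measurable_grid_time n tau : measurable_fun setT tau ->
  measurable_fun setT (grid_time n tau).
Proof. by move=> mtau; exact: (measurableT_comp (@measurable_er_map _ Om R _ (measurable_grid n)) mtau). Qed.

Lemma grid_time_ge0 n tau w : (0 <= tau w)%E -> (0 <= grid_time n tau w)%E.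
Proof.
rewrite /grid_time; case: (tau w) => [z| |] //=; rewrite !lee_fin => z0.
by apply/ltW/(le_lt_trans z0)/grid_gt.
Qed.

(** The discretized time takes countably many finite values, and on each of these events
    [cost_cst_split] applies at a constant time. *)
Lemma dynkin_grid f tau n x : C0 f -> optional tau ->
  mean (P x) (J f (grid_time n tau)) = mean (P x) (D (res Pt lam0 f) (grid_time n tau)).
Proof.
move=> cf otau; have [tau0 tauF] := otau.
have mtau := optional_measurable otau.
have mg := measurable_grid_time n mtau.
have g0 w := grid_time_ge0 n (tau0 w).
have cu : C0 (res Pt lam0 f) by exact: res_C0.
have bJ := bmeas_cost cf mg; have bD := bmeas_exit cu g0 mg.
apply/eqP; rewrite -subr_eq0 -meanB//; apply/eqP.
pose c (k : nat) : R := k%:R / n.+1%:R.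
(* On this event the discretized time is c (k+1). Rounding up places the event in the past of
   exactly that time. *)
pose A k := [set w | ((c k)%:E <= tau w)%E /\ (tau w < (c k.+1)%:E)%E].
have FA k : F0 (c k.+1) (A k).
  have -> : A k = ~` [set w | (tau w < (c k)%:E)%E] `&` [set w | (tau w < (c k.+1)%:E)%E].
    by apply/seteqP; split => w /= [h1 h2]; split => //; [apply/negP; rewrite -leNgt | rewrite leNgt; apply/negP].
  apply: F0I; last by apply: tauF; rewrite divr_gt0.
  apply: F0C; have ck : c k <= c k.+1 by rewrite ler_pM2r ?invr_gt0// ler_nat.
  (* [optional] says nothing at t = 0, but there the event [tau < 0] is empty. *)
  case: k ck => [|k] ck; last by apply: (F0_mono ck); apply: tauF; rewrite divr_gt0.
  rewrite (_ : [set _ | _] = ~` setT); first by apply: F0C; exact: F0T.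
  apply/seteqP; split => w //=; rewrite /c mul0r => h _.
  by move: h; rewrite ltNge tau0.
have inA k w : A k w -> grid_time n tau w = (c k.+1)%:E.
  rewrite /A /grid_time /=; case: (tau w) => [z| |] [] //=; rewrite lee_fin lte_fin => h1 h2.
  congr EFin; rewrite /grid /c; congr (_ / _).
  rewrite (@floor_def _ _ k%:Z) ?intrD ?natr1//.
  by move: h1 h2; rewrite /c ler_pdivrMr// ltr_pdivlMr// => -> /=; rewrite -natr1.
apply: (@mean_bigcup_eq0 _ _ _ (P x) A).
- apply/trivIsetP => i j _ _ ij; rewrite -subset0 => w [wi wj].
  move: ij; suff -> : i = j by rewrite eqxx.
  have := inA _ _ wi; rewrite (inA _ _ wj) => -[/eqP].
  rewrite /c eqr_div ?pnatr_eq0//.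
  by rewrite (inj_eq (mulIf _)) ?pnatr_eq0// eqr_nat => /eqP[->].
- by move=> k; exact: F0_measurable (FA k).
- exact: bmeasB.
- move=> w nA; have tauy : tau w = +oo%E.
    case tw : (tau w) (tau0 w) => [z| |] //; rewrite lee_fin => z0.
    exfalso; apply: nA; exists (Num.truncn (z * n.+1%:R)) => //.
    rewrite /A /= tw lee_fin lte_fin /c ler_pdivrMr// ltr_pdivlMr//.
    by apply/andP/truncn_itv; rewrite mulr_ge0.
  rewrite /J /D /grid_time tauy /= subr0.
  rewrite -[RHS](mean_cst (expo lam0)); apply: eq_mean => s.
  by rewrite indicE memNset ?mul0r//= => /lt_le_trans/(_ (leey _)); rewrite ltxx.
- move=> k; have mA := F0_measurable (FA k).
  have bI : bmeas (\1_(A k) : Om -> R) by exact: bmeas_indic.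
  have ck0 : 0 <= c k.+1 by rewrite divr_ge0.
  have := cost_cst_split x ck0 cf (FA k).
  have mc : measurable_fun setT (fun _ : Om => (c k.+1)%:E) by exact: measurable_cst.
  move/eqP; rewrite -subr_eq0 -meanB; first last.
  + by apply: (bmeasM bI); apply: bmeas_exit => // w; rewrite lee_fin.
  + exact: (bmeasM bI (bmeas_cost cf mc)).
  move/eqP => <-; apply: eq_mean => w; rewrite -mulrBr indicE.
  have [wA|_] := boolP (w \in A k); last by rewrite !mul0r.
  by rewrite /J /D (inA k w)//; exact/set_mem.
Qed.

(** The discretized times tend to tau strictly from the right: right continuity of paths gives the
    limit of the exit term, and the strict inequality in the cost gives that of the indicator. *)
Theorem dynkin f tau x : C0 f -> optional tau ->
  mean (P x) (J f tau) = mean (P x) (D (res Pt lam0 f) tau).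
Proof.
move=> cf otau; have [tau0 _] := otau.
have mtau := optional_measurable otau.
have cu : C0 (res Pt lam0 f) by exact: res_C0.
have [M M0 fM] := C0_bounded cf; have [N N0 uN] := C0_bounded cu.
have indM (A : set time) s y : `|\1_A s * f y| <= M.
  by rewrite indicE; case: (_ \in _); rewrite ?mul1r ?mul0r ?normr0.
have cJ : mean (P x) (J f (grid_time n tau)) @[n --> \oo] --> mean (P x) (J f tau).
  apply: (fun h1 h2 h3 => proj2 (@mean_cvg _ _ _ _ _ _ M h1 h2 h3)).
  - by move=> n; case: (bmeas_cost cf (measurable_grid_time n mtau)).
  - by move=> n w; apply: mean_bound => //; exact: bmeas_cost_path (measurable_grid_time n mtau).
  move=> w; apply: (fun h1 h2 h3 => proj2 (@mean_cvg _ _ _ _ _ _ M h1 h2 h3)) => //.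
    by move=> n; case: (bmeas_cost_path w cf (measurable_grid_time n mtau)).
  move=> s; apply: cvgM; last exact: cvg_cst.
  apply: cvg_near_cst; rewrite /grid_time; case: (tau w) (tau0 w) => [z| |] //= _; last exact: nearW.
  have [zs|sz] := ltP z s.
    have sz0 : 0 < s - z by rewrite subr_gt0.
    near=> n; rewrite !indicE !mem_set//=; apply: le_lt_trans (grid_le n z) _.
    by rewrite -ltrBrDl; near: n; exact: (near_infty_natSinv_lt (PosNum sz0)).
  apply: nearW => n; rewrite !indicE !memNset//=; rewrite lte_fin => h.
    by move: h; rewrite ltNge sz.
  by move: (lt_trans (grid_gt n z) h); rewrite ltNge sz.
have cD : mean (P x) (D (res Pt lam0 f) (grid_time n tau)) @[n --> \oo] -->
    mean (P x) (D (res Pt lam0 f) tau).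
  apply: (fun h1 h2 h3 => proj2 (@mean_cvg _ _ _ _ _ _ N h1 h2 h3)).
  - move=> n; case: (bmeas_exit cu (fun w => grid_time_ge0 n (tau0 w)) (measurable_grid_time n mtau)) => //.
  - by move=> n w; apply: exit_bound => //; exact: grid_time_ge0.
  move=> w; rewrite /D /grid_time; case: (tau w) => [z| |] /=; [|exact: cvg_cst..].
  apply: (cvg_comp (fun n => grid n z) (fun s => expR (- lam * s) * res Pt lam0 f (X s w))); first exact: cvg_grid.
  apply: cvgM; last by apply: right_cont_fX; case: cu.
  apply: cvg_at_right_filter.
  apply: continuous_comp; last exact: continuous_expR.
  by apply: continuousM; [exact: cst_continuous | exact: id].
have eqn : (fun n => mean (P x) (J f (grid_time n tau))) =
           (fun n => mean (P x) (D (res Pt lam0 f) (grid_time n tau))).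
  by apply/funext => n; exact: dynkin_grid.
rewrite eqn in cJ; exact: (cvg_unique _ cJ cD).
Unshelve. all: by end_near. Qed.

End Dynkin.

(** * Resolvent, maximum principle and penalization *)

Section ResolventTheory.
Variables (R : realType) (d : nat).
Local Notation E := 'rV[R]_d.
Local Notation time := (measurableTypeR R).
Local Notation Om := (Omega R d).
Implicit Types (f g u k q : E -> R) (w : Om).
Variables (Pt : R -> (E -> R) -> (E -> R)) (P : E -> probability Om R).
Hypotheses (feller : feller_semigroup Pt) (process : feller_process Pt P).

Let PtC t f : 0 <= t -> C0 f -> C0 (Pt t f).
Proof. by case: feller => h _ _ _ _; exact: h. Qed.

Lemma Qt_le (s c : R) f x : C0 f -> (forall y, f y <= c) -> Qt Pt s f x <= c.
Proof.
move=> cf fc; rewrite -(mean_X feller process)// -[leRHS](mean_cst (P x)).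
by apply: le_mean => //; [exact: bmeas_fX | exact: bmeas_cst].
Qed.

Lemma Qt_pos (s : R) : 0 <= s -> Qt Pt s = Pt s.
Proof. by move=> s0; rewrite /Qt max_r. Qed.

Lemma Qt_zero f : C0 f -> Qt Pt 0 f = f.
Proof. by rewrite Qt_pos//; case: feller => _ _ _ [h _] _; exact: h. Qed.

Section FixedRate.
Variables (lam : R) (lam0 : 0 < lam).
Local Notation res := (res Pt lam0).
Local Notation nu := (expo lam0).

Let bI (t : R) : bmeas (\1_[set r : time | t <= r] : time -> R).
Proof.
apply: bmeas_indic; rewrite (_ : [set _ | _] = `[t, +oo[%classic); first exact: measurable_itv.
by apply/seteqP; split => s /=; rewrite in_itv /= andbT.
Qed.

Lemma mean_expo_ge (t : R) : 0 <= t -> mean nu (\1_[set r : time | t <= r]) = expR (- lam * t).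
Proof.
move=> t0; rewrite mean_indic.
  rewrite (_ : [set _ | _] = `[t, +oo[%classic).
    by rewrite expo_ge/= max_r.
  by apply/seteqP; split => s /=; rewrite in_itv /= andbT.
rewrite (_ : [set _ | _] = `[t, +oo[%classic); first exact: measurable_itv.
by apply/seteqP; split => s /=; rewrite in_itv /= andbT.
Qed.

Lemma res_le f (c : R) x : C0 f -> (forall y, f y <= c) -> res f x <= c.
Proof.
move=> cf fc; rewrite -[leRHS](mean_cst nu).
apply: le_mean; [exact: bmeas_Qt | exact: bmeas_cst |].
by move=> s; exact: Qt_le.
Qed.

Lemma Pt_res (t : R) f x : 0 <= t -> C0 f ->
  Pt t (res f) x = expR (lam * t) * mean nu (fun s => \1_[set r : time | t <= r] s * Qt Pt s f x).
Proof.
move=> t0 cf.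
have mt : measurable_fun setT (fun _ : Om => t%:E) by exact: measurable_cst.
have := cost_cst_split feller process lam0 x t0 cf (@F0T R d t).
under eq_mean do rewrite indicT mul1r.
under [X in _ = X -> _]eq_mean do rewrite indicT mul1r /discounted_exit.
rewrite meanZ; last by apply: bmeas_fX; exact: res_C0.
rewrite (mean_X feller process); last exact: res_C0.
rewrite Qt_pos// /discounted_cost.
rewrite -(mean_swap nu (P x) (bmeas_cost_joint cf mt)) /=.
rewrite -expo_strict; last exact: bmeas_Qt.
move=> h; rewrite -[LHS]mul1r -expR0 -(subrr (lam * t)) expRD -mulNr -mulrA -h.
congr (_ * _); apply: eq_mean => s.
rewrite meanZ; last exact: bmeas_fX.
by rewrite (mean_X feller process).
Qed.

Lemma Pt_res_comm (t : R) f : 0 <= t -> C0 f -> Pt t (res f) = res (Pt t f).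
Proof.
move=> t0 cf; apply/funext => x; rewrite Pt_res//.
rewrite expo_shift//; last exact: bmeas_Qt.
rewrite mulrA -expRD mulNr subrr expR0 mul1r.
have nN : nu.-negligible `]-oo, 0[%classic.
  exists `]-oo, 0[%classic; split => //; exact: expo_neg.
apply: (eq_mean_ae nN).
- have [mK [M KM]] := bmeas_Qt feller x cf; split; last by exists M => s; exact: KM.
  by apply: (measurableT_comp mK); apply: measurable_funD.
- by apply: bmeas_Qt => //; exact: PtC.
move=> s /=; rewrite in_itv /= => /negP; rewrite -leNgt => s0.
have [_ _ _ [_ PD] _] := feller.
by rewrite !Qt_pos ?addr_ge0// PD.
Qed.

(* The contribution of [0,t) to the resolvent integral is (1 - exp(-lam t)) f up to the modulus of continuity of s |-> P_s f. *)
Lemma Pt_res_diff f (e : R) : C0 f -> 0 < e -> exists2 r : R, 0 < r &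
  forall t, 0 < t -> t < r -> forall x,
  `|Pt t (res f) x - res f x - (expR (lam * t) - 1) * (res f x - f x)| <=
  (expR (lam * t) - 1) * e.
Proof.
move=> cf e0; have [r r0 hr] := Pt_modulus feller cf e0.
exists r => // t t0 tr x; rewrite (Pt_res _ (ltW t0) cf).
set I := mean _ _.
have Iexp : 0 < expR (lam * t) by exact: expR_gt0.
have bQ := bmeas_Qt feller x cf.
have e1 : `|res f x - I - (1 - expR (- lam * t)) * f x| <= (1 - expR (- lam * t)) * e.
  have -> : res f x - I - (1 - expR (- lam * t)) * f x =
      mean nu (fun s => (1 - \1_[set r : time | t <= r] s) * (Qt Pt s f x - f x)).
    rewrite -(mean_expo_ge (ltW t0)) /I /res -[1](mean_cst nu).
    have b1 := @bmeas_cst _ time R 1.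
    rewrite -(meanB _ b1 (bI t)) -(meanB _ bQ (bmeasM (bI t) bQ)).
    rewrite mulrC -(meanZ _ _ (bmeasB b1 (bI t))) -meanB; first last.
    - exact: (bmeasZ _ (bmeasB b1 (bI t))).
    - exact: (bmeasB bQ (bmeasM (bI t) bQ)).
    by apply: eq_mean => s; rewrite mean_cst; ring.
  have hs s : `|(1 - \1_[set r : time | t <= r] s) * (Qt Pt s f x - f x)| <=
      (1 - \1_[set r : time | t <= r] s) * e.
    rewrite indicE; have [|] := boolP (s \in _); first by rewrite subrr !mul0r normr0.
    rewrite notin_setE /= => /negP; rewrite -ltNge => st.
    rewrite subr0 !mul1r; rewrite -[X in _ - X x](Qt_zero cf) /Qt maxxx.
    apply: hr => //; first by rewrite le_max lexx.
    by rewrite add0r gt_max r0 (lt_trans st).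
  have b1 := bmeasB (@bmeas_cst _ time R 1) (bI t).
  have b2 : bmeas (fun s : time => (1 - \1_[set r : time | t <= r] s) * (Qt Pt s f x - f x)).
    by apply: (bmeasM b1); apply: bmeasB => //; exact: bmeas_cst.
  rewrite -(mean_expo_ge (ltW t0)) -[X in X - _](mean_cst nu).
  rewrite -(meanB _ (bmeas_cst 1) (bI t)) mulrC -meanZ//.
  rewrite ler_norml; apply/andP; split.
    rewrite -mulN1r -meanZ; last exact: (bmeasZ _ b1).
    apply: le_mean => // [|s]; first by do 2 apply: bmeasZ.
    by have := hs s; rewrite ler_norml mulN1r [e * _]mulrC => /andP[].
  apply: le_mean => // [|s]; first exact: bmeasZ.
  by have := hs s; rewrite ler_norml [e * _]mulrC => /andP[].
have eM : expR (lam * t) * expR (- lam * t) = 1.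
  by rewrite -expRD mulNr subrr expR0.
have -> : expR (lam * t) * I - res f x - (expR (lam * t) - 1) * (res f x - f x) =
   - (expR (lam * t) * (res f x - I - (1 - expR (- lam * t)) * f x)).
  transitivity (expR (lam * t) * I - expR (lam * t) * res f x + expR (lam * t) * f x
      - expR (lam * t) * expR (- lam * t) * f x); last by ring.
  by rewrite eM; ring.
have -> : (expR (lam * t) - 1) * e = expR (lam * t) * ((1 - expR (- lam * t)) * e).
  by rewrite mulrA mulrBr eM mulr1.
by rewrite normrN normrM gtr0_norm// ler_pM2l.
Qed.

Lemma expR_slope (t : R) : 0 < t -> lam * t <= 2^-1 ->
  `|(expR (lam * t) - 1) / t - lam| <= 2 * lam ^+ 2 * t.
Proof.
move=> t0 lt.
have l1 : lam <= (expR (lam * t) - 1) / t.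
  by rewrite ler_pdivlMr// lerBrDl; exact: expR_ge1Dx.
(* This is e^(-x) >= 1 - x multiplied by e^x; with x <= 1/2 it bounds e^x by 2. *)
have l2 : expR (lam * t) * (1 - lam * t) <= 1.
  rewrite [leRHS](_ : 1 = expR (lam * t) * expR (- (lam * t))); last first.
    by rewrite -expRD subrr expR0.
  by rewrite ler_pM2l ?expR_gt0//; exact: expR_ge1Dx.
have l3 : expR (lam * t) <= 2.
  have := expR_gt0 (lam * t); nra.
rewrite ger0_norm ?subr_ge0// lerBlDr ler_pdivrMr//.
have := expR_gt0 (lam * t).
have : 0 < lam * t by rewrite mulr_gt0.
nra.
Qed.

(** By [Pt_res_diff] the difference quotient is (e^(lam t) - 1)/t times R f - f, up to a uniform
    error, and this slope tends to lam. *)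
Lemma generator_res f : C0 f -> is_generator Pt (res f) (fun x => lam * (res f x - f x)).
Proof.
move=> cf; have cu : C0 (res f) by exact: res_C0.
split => //; first by apply: C0Z; exact: C0B.
move=> e e0; have [M M0 dM] := C0_bounded (C0B cu cf).
(* The slope (e^(lam t) - 1)/t stays below 2 lam + 2, so this error contributes at most e / 2. *)
have el : 0 < e / (4 * lam + 4) by rewrite divr_gt0// addr_gt0// mulr_gt0.
have [r r0 hr] := Pt_res_diff cf el.
have K0 : 0 < 4 * lam ^+ 2 * (M + 1).
  by rewrite !mulr_gt0 ?exprn_gt0// ltr_wpDl.
near=> t => x.
have t0 : 0 < t by near: t; exact: nbhs_right_gt.
have tr : t < r by near: t; exact: nbhs_right_lt.
have tl : lam * t <= 2^-1.
  rewrite mulrC -ler_pdivlMr//; near: t; apply: nbhs_right_le.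
  by rewrite divr_gt0// invr_gt0.
have tK : 4 * lam ^+ 2 * (M + 1) * t < e.
  rewrite mulrC -ltr_pdivlMr//; near: t; apply: nbhs_right_lt.
  by rewrite divr_gt0.
have h1 := hr t t0 tr x; have h2 := expR_slope t0 tl; have h3 := dM x.
set a := expR (lam * t) - 1 in h1 h2.
have a0 : 0 <= a by rewrite subr_ge0 -expR0 ler_expR mulr_ge0// ltW.
have at0 : 0 <= a / t by rewrite divr_ge0// ltW.
have at2 : a / t <= 2 * lam + 2.
  have h4 : lam ^+ 2 * t <= lam * 2^-1 by rewrite expr2 -mulrA ler_pM2l.
  by move: h2; rewrite ler_norml => /andP[_]; lra.
have -> : (Pt t (res f) x - res f x) / t - lam * (res f x - f x) =
    (Pt t (res f) x - res f x - a * (res f x - f x)) / t +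
    (a / t - lam) * (res f x - f x).
  by field; rewrite gt_eqF.
apply: le_lt_trans (ler_normD _ _) _.
have b1 : `|(Pt t (res f) x - res f x - a * (res f x - f x)) / t| <= e / 2.
  rewrite normrM normfV (gtr0_norm t0) ler_pdivrMr//.
  apply: (le_trans h1).
  have : a <= (2 * lam + 2) * t by rewrite -ler_pdivrMr.
  move=> h; apply: le_trans (_ : (2 * lam + 2) * t * (e / (4 * lam + 4)) <= _).
    by rewrite ler_pM2r.
  rewrite le_eqVlt; apply/orP; left; apply/eqP; field.
  by rewrite gt_eqF// addr_gt0// mulr_gt0.
have b2 : `|(a / t - lam) * (res f x - f x)| < e / 2.
  rewrite normrM; apply: le_lt_trans (_ : 2 * lam ^+ 2 * t * (M + 1) < _).
    by rewrite ler_pM// (le_trans h3)// lerDl.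
  by lra.
lra.
Unshelve. all: by end_near. Qed.

(** R commutes with P_t, so it maps the difference quotients of u, which tend to k, to those of R u,
    whose limit is given by [generator_res]. *)
Lemma res_generator u k : is_generator Pt u k -> forall x, res k x = lam * (res u x - u x).
Proof.
move=> [cu ck gk] x.
have [_ _ gr] := generator_res cu.
apply/eqP; rewrite -subr_eq0 -normr_le0; apply/ler_addgt0Pr => e e0; rewrite add0r.
have e20 : 0 < e / 2 by rewrite divr_gt0.
have [t [t0 [h1 h2]]] : exists t : R, 0 < t /\ ((forall x, `|(Pt t u x - u x) / t - k x| < e / 2) /\
    (forall x, `|(Pt t (res u) x - res u x) / t - lam * (res u x - u x)| < e / 2)).
  apply: (@filter_ex _ (0^'+)).
  near=> t; split; first by near: t; exact: nbhs_right_gt.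
  by split; near: t; [exact: gk | exact: gr].
have h3 : `|(Pt t (res u) x - res u x) / t - res k x| <= e / 2.
  rewrite (Pt_res_comm (ltW t0) cu) mulrC.
  have cPu : C0 (Pt t u) by apply: PtC => //; exact: ltW.
  have -> : t^-1 * (res (Pt t u) x - res u x) - res k x =
      res (fun y => t^-1 * (Pt t u y - u y) - k y) x.
    rewrite resB//; last by apply: C0Z; exact: C0B.
    by rewrite resZ ?resB//; exact: C0B.
  apply: res_contraction => //; first by apply: C0B => //; apply: C0Z; exact: C0B.
  by move=> y; have := ltW (h1 y); rewrite mulrC.
have := h2 x; move: h3; rewrite !ler_norml !ltr_norml => /andP[? ?] /andP[? ?].
by apply/andP; split; lra.
Unshelve. all: by end_near. Qed.

(** Represents every function of the domain, in particular every test function, as a value of R. *)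
Lemma generator_resE u k : is_generator Pt u k ->
  u = res (fun x => u x - lam^-1 * k x).
Proof.
move=> gk; have [cu ck _] := gk; apply/funext => x.
rewrite resB//; last exact: C0Z.
by rewrite resZ// (res_generator gk) mulKf ?gt_eqF// opprB addrC subrK.
Qed.

End FixedRate.

(** The resolvent at rate mu lands in the domain of the generator, so it can be represented again at
    rate lam. Changing the rate drives the maximum principle and the penalization. *)
Lemma resolvent_equation (lam mu : R) (lam0 : 0 < lam) (mu0 : 0 < mu) f : C0 f ->
  res Pt mu0 f = res Pt lam0 (fun x => res Pt mu0 f x - lam^-1 * (mu * (res Pt mu0 f x - f x))).
Proof. by move=> cf; apply: generator_resE; exact: generator_res. Qed.

(** The normalized resolvent at rate mu tends to the identity as mu grows, and [resolvent_equation]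
    makes its values also values of the resolvent at rate lam. *)
Lemma res_approx (lam e : R) (lam0 : 0 < lam) f : C0 f -> 0 < e ->
  exists2 b, C0 b & forall x, `|res Pt lam0 b x - f x| <= e.
Proof.
move=> cf e0; have e20 : 0 < e / 2 by rewrite divr_gt0.
have [r r0 hr] := Pt_modulus feller cf e20.
have [M M0 fM] := C0_bounded cf.
(* Chosen so that 2 M e^(-mu r) <= e / 2, using e^(-x) (1 + x) <= 1: times beyond r, outside the
   modulus of continuity, weigh little. *)
pose mu := 4 * M / (e * r) + 1.
have mu0 : 0 < mu by rewrite ltr_wpDl// divr_ge0// ?mulr_ge0// ?ltW.
exists (fun x => res Pt mu0 f x - lam^-1 * (mu * (res Pt mu0 f x - f x))).
  by apply: C0B; [exact: res_C0 | do 2 apply: C0Z; apply: C0B => //; exact: res_C0].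
rewrite -resolvent_equation// => x.
have bI : bmeas (\1_[set s : time | r <= s] : time -> R).
  apply: bmeas_indic; rewrite (_ : [set _ | _] = `[r, +oo[%classic); first exact: measurable_itv.
  by apply/seteqP; split => s /=; rewrite in_itv /= andbT.
have bQ := bmeas_Qt feller x cf.
have bf := @bmeas_cst _ time R (f x).
rewrite -[X in _ - X](mean_cst (expo mu0)) -(meanB _ bQ bf).
have hs s : `|Qt Pt s f x - f x| <= e / 2 + 2 * M * \1_[set s : time | r <= s] s.
  rewrite indicE; have [|] := boolP (s \in _).
    move=> _; rewrite mulr1; apply: (le_trans (ler_normB _ _)).
    have := fM x; have := Qt_contraction feller s cf fM x; lra.
  rewrite notin_setE /= => /negP; rewrite -ltNge => st.
  rewrite mulr0 addr0; rewrite -[X in _ - X x](Qt_zero cf) /Qt maxxx.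
  apply: hr => //; first by rewrite le_max lexx.
  by rewrite add0r gt_max r0.
have bR : bmeas (fun s : time => e / 2 + 2 * M * \1_[set s : time | r <= s] s).
  by apply: bmeasD; [exact: bmeas_cst | exact: bmeasZ].
have mR : mean (expo mu0) (fun s : time => e / 2 + 2 * M * \1_[set s : time | r <= s] s) <= e.
  rewrite meanD; [|exact: bmeas_cst|exact: bmeasZ].
  rewrite mean_cst meanZ// (mean_expo_ge _ (ltW r0)).
  have h1 : expR (- mu * r) * (1 + mu * r) <= 1.
    rewrite [leRHS](_ : 1 = expR (- mu * r) * expR (mu * r)); last first.
      by rewrite -expRD mulNr addNr expR0.
    by rewrite ler_pM2l ?expR_gt0//; exact: expR_ge1Dx.
  have h2 : 4 * M <= e * (1 + mu * r).
    have -> : e * (1 + mu * r) = e + 4 * M + e * r.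
      by rewrite /mu; field; rewrite !gt_eqF.
    have : 0 < e * r by rewrite mulr_gt0.
    lra.
  have h3 : 4 * M * expR (- mu * r) <= e * (1 + mu * r) * expR (- mu * r).
    by rewrite ler_pM2r// expR_gt0.
  have h4 : e * (expR (- mu * r) * (1 + mu * r)) <= e * 1 by rewrite ler_pM2l.
  by lra.
apply: le_trans mR; rewrite ler_norml; apply/andP; split.
  rewrite lerNl -mulN1r -meanZ; last exact: bmeasB.
  apply: le_mean => // [|s]; first by apply: bmeasZ; exact: bmeasB.
  by have := hs s; rewrite ler_norml mulN1r => /andP[? _]; rewrite lerNl.
apply: le_mean => // [|s]; first exact: bmeasB.
by have := hs s; rewrite ler_norml => /andP[].
Qed.

Section MaximumPrinciple.
Variables (lam : R) (lam0 : 0 < lam).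
Local Notation Rl := (res Pt lam0).

(** At rate lam + a, R k is an average of (a R k + lam k)/(lam + a). If M = sup R k exceeded e, this
    would be at most a M/(lam + a) < M everywhere; the supremum does not have to be attained. *)
Lemma res_max_principle k (e : R) : C0 k -> 0 <= e ->
  (forall x, e < Rl k x -> k x <= 0) -> forall x, Rl k x <= e.
Proof.
move=> ck e0 kneg x0; rewrite leNgt; apply/negP => ex0.
have cu : C0 (Rl k) by exact: res_C0.
have [K K0 kK] := C0_bounded ck; have [N _ uN] := C0_bounded cu.
have hs : has_sup (range (Rl k)).
  split; first by exists (Rl k x0), x0.
  by exists N => _ [y _ <-]; apply: le_trans (uN y); exact: ler_norm.
pose M := sup (range (Rl k)).
have uM y : Rl k y <= M by apply: ub_le_sup; [case: hs | exists y].
have eM : 0 < M - e by rewrite subr_gt0 (lt_le_trans ex0).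
(* This gives a e + lam K = a M, so the region R k <= e, where k is bounded only by K, obeys the
   same bound as the region where k <= 0. *)
pose a := lam * K / (M - e).
have a0 : 0 <= a by rewrite divr_ge0 ?(ltW eM)// mulr_ge0// ltW.
have la0 : 0 < lam + a by rewrite ltr_wpDr.
have M0 : 0 < M by rewrite -[M](subrK e) ltr_wpDr.
pose c := a * M / (lam + a).
have bound y : Rl k y <= c.
  rewrite (resolvent_equation la0 lam0 ck).
  apply: res_le => [|z].
    by apply: C0B => //; do 2 apply: C0Z; apply: C0B.
  have -> : Rl k z - (lam + a)^-1 * (lam * (Rl k z - k z)) =
      (a * Rl k z + lam * k z) / (lam + a) by field; rewrite gt_eqF.
  rewrite ler_pM2r ?invr_gt0//.
  have [zle|egt] := leP (Rl k z) e.
    have h1 : a * Rl k z <= a * e by rewrite ler_wpM2l.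
    have h2 : lam * k z <= lam * K.
      by rewrite ler_wpM2l ?(ltW lam0)// (le_trans (ler_norm _)).
    have h3 : lam * K = a * (M - e) by rewrite divfK// gt_eqF.
    rewrite h3 in h2; lra.
  have h1 : a * Rl k z <= a * M by rewrite ler_wpM2l.
  have h2 : lam * k z <= 0 by rewrite pmulr_rle0// kneg.
  lra.
have : M <= c by apply: ge_sup => [|_ [y _ <-]]; [case: hs | exact: bound].
rewrite ler_pdivlMr// mulrDr [M * a]mulrC gerDr.
by rewrite pmulr_lle0// leNgt M0.
Qed.

Lemma res_ge0 k x : C0 k -> (forall y, 0 <= k y) -> 0 <= Rl k x.
Proof.
move=> ck k0; apply: mean_ge0 => s.
by rewrite -(mean_X feller process)//; apply: mean_ge0.
Qed.

(* Killing at rate [lam * b * q] instead of exiting; [y] is the value of the killed problem with terminal payoff [u].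
   It is the fixed point of a contraction at the larger rate [lam * (1 + b)]. *)
Lemma penalization_exists (b : R) q u : 0 <= b -> continuous q -> (forall x, 0 <= q x <= 1) ->
  C0 u -> exists2 y, C0 y & y = Rl (fun x => b * (q x * (u x - y x))).
Proof.
move=> b0 cq q01 cu.
have b1 : 0 < 1 + b by rewrite ltr_wpDr.
have mu0 : 0 < lam * (1 + b) by rewrite mulr_gt0.
pose r := b / (1 + b).
have r01 : 0 <= r < 1.
  by rewrite divr_ge0 ?(ltW b1)//= ltr_pdivrMr// mul1r ltrDr.
have /andP[r0 r1] := r01.
have bq : exists M : R, forall x, `|q x| <= M.
  by exists 1 => x; have /andP[? ?] := q01 x; rewrite ger0_norm.
have bq' : exists M : R, forall x, `|1 - q x| <= M.
  by exists 1 => x; have /andP[? ?] := q01 x; rewrite ger0_norm ?subr_ge0// gerBl.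
have cq' : continuous (fun x => 1 - q x).
  by move=> x; apply: continuousB; [exact: cst_continuous | exact: cq].
(* With this source, y = R_mu (W y) becomes y = R (b q (u - y)) at rate lam, since (1 + b) r = b. *)
pose W y x := r * (q x * u x + (1 - q x) * y x).
have CW y : C0 y -> C0 (W y).
  by move=> cy; apply: C0Z; apply: C0D; exact: C0Ml.
have cT y : C0 y -> C0 (res Pt mu0 (W y)) by move=> /CW; exact: res_C0.
have [|y cy Ty] := @C0_banach R d (fun y => res Pt mu0 (W y)) r r01 cT.
  move=> y z c cy cz yz x.
  have -> : res Pt mu0 (W y) x - res Pt mu0 (W z) x = res Pt mu0 (fun v => W y v - W z v) x.
    by rewrite resB//; exact: CW.
  apply: res_contraction => // [|v]; first by apply: C0B; exact: CW.
  have -> : W y v - W z v = r * ((1 - q v) * (y v - z v)) by rewrite /W; ring.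
  rewrite normrM ger0_norm// ler_wpM2l// normrM.
  have /andP[q0 q1] := q01 v; rewrite -[leRHS]mul1r ler_pM//.
  by rewrite ger0_norm ?subr_ge0// gerBl.
exists y; first exact: cy.
have := resolvent_equation lam0 mu0 (CW y cy).
rewrite Ty => {1}->; congr Rl; apply/funext => x.
by rewrite /W /r; field; rewrite !gt_eqF.
Qed.

Section Penalization.
Variables (b : R) (q f y : E -> R).
Hypotheses (b0 : 0 <= b) (cq : continuous q) (q01 : forall x, 0 <= q x <= 1).
Hypotheses (cf : C0 f) (f0 : forall x, 0 <= f x) (cy : C0 y).
Hypothesis yE : y = Rl (fun x => b * (q x * (Rl f x - y x))).

Lemma C0_penalization g : C0 g -> C0 (fun x => b * (q x * g x)).
Proof.
move=> cg; apply: C0Z; apply: C0Ml => //.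
by exists 1 => x; have /andP[? ?] := q01 x; rewrite ger0_norm.
Qed.

Let cu : C0 (Rl f). Proof. exact: res_C0. Qed.

Let ck : C0 (fun x => b * (q x * (Rl f x - y x))).
Proof. by apply: C0_penalization; exact: C0B. Qed.

(** This bound and [penalization_le] are maximum principles: where one of them fails, the sign of R
    f - y fixes the sign of the charge, as the principle requires. *)
Lemma penalization_ge0 x : 0 <= y x.
Proof.
rewrite -oppr_le0.
have yN v : - y v = Rl (fun x => -1 * (b * (q x * (Rl f x - y x)))) v.
  by rewrite resZ// {1}yE mulN1r.
rewrite yN; apply: res_max_principle => //; first exact: C0Z.
move=> v; rewrite -yN oppr_gt0 => yv.
rewrite mulN1r oppr_le0 !mulr_ge0//; first by case/andP: (q01 v).
by rewrite subr_ge0 (le_trans (ltW yv))// res_ge0.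
Qed.

Lemma penalization_le x : y x <= Rl f x.
Proof.
rewrite -subr_le0.
have yN v : y v - Rl f v = Rl (fun x => b * (q x * (Rl f x - y x)) - f x) v.
  by rewrite resB// -yE.
rewrite yN; apply: res_max_principle => //; first exact: C0B.
move=> v; rewrite -yN subr_gt0 => yv.
rewrite subr_le0 (le_trans _ (f0 v))// mulr_ge0_le0// mulr_ge0_le0//.
  by case/andP: (q01 v).
by rewrite subr_le0 ltW.
Qed.

End Penalization.

(** y is compared with R f - R c, where R c is within e of (1 - q) R f, because q R f itself need
    not be a value of R. *)
Lemma penalization_exhausts f q (eps : R) : C0 f -> (forall x, 0 <= f x) ->
  continuous q -> (forall x, 0 <= q x <= 1) -> 0 < eps ->
  exists b y, [/\ 0 <= b, C0 y, y = Rl (fun x => b * (q x * (Rl f x - y x))),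
    (forall x, 0 <= y x <= Rl f x) & forall x, q x * Rl f x - eps <= y x].
Proof.
move=> cf f0 cq q01 eps0.
have cu : C0 (Rl f) by exact: res_C0.
pose e := eps / 4; have e0 : 0 < e by rewrite divr_gt0.
have cq' : continuous (fun x => 1 - q x).
  by move=> x; apply: continuousB; [exact: cst_continuous | exact: cq].
have ca0 : C0 (fun x => (1 - q x) * Rl f x).
  by apply: C0Ml => //; exists 1 => x; have /andP[? ?] := q01 x; rewrite ger0_norm ?subr_ge0// gerBl.
have [c cc ca] := res_approx lam0 ca0 e0.
have [U U0 uU] := C0_bounded cu; have [F F0 fF] := C0_bounded (C0B cf cc).
(* Where the comparison fails by more than 3 e, both R f - y and q R f are at least 2 e; this b then
   makes the charge at least F, which dominates f - c. *)
pose b := F * (U + 1) / (4 * e ^+ 2).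
have b0 : 0 <= b by apply: divr_ge0; rewrite mulr_ge0 ?addr_ge0 ?sqr_ge0.
have [y cy yE] := penalization_exists b0 cq q01 cu.
have y0 := penalization_ge0 b0 cq q01 cf f0 cy yE.
have yu := penalization_le b0 cq q01 cf f0 cy yE.
exists b, y; split => // [x|x]; first by rewrite y0 yu.
have ck : C0 (fun x => b * (q x * (Rl f x - y x))) by apply: C0_penalization => //; exact: C0B.
pose k v := f v - c v - b * (q v * (Rl f v - y v)).
have kE v : Rl k v = Rl f v - Rl c v - y v.
  by rewrite /k resB//; [rewrite resB// -yE | exact: C0B].
have e30 : 0 <= 3 * e by rewrite mulr_ge0// ltW.
suff : Rl k x <= 3 * e.
  rewrite kE; have := ca x; rewrite ler_norml => /andP[_ h].
  have -> : eps = 4 * e by rewrite /e; field.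
  by lra.
apply: (res_max_principle _ e30); first by apply: C0B => //; exact: C0B.
move=> v; rewrite kE /k => h.
have := ca v; rewrite ler_norml => /andP[h1 _].
have /andP[q0 q1] := q01 v; have yv0 := y0 v; have u0 := res_ge0 v cf f0.
have uU1 : Rl f v <= U + 1.
  by rewrite (le_trans (ler_norm _))// (le_trans (uU v))// lerDl.
have qu0 : 0 <= (1 - q v) * Rl f v by rewrite mulr_ge0// subr_ge0.
have z2 : 2 * e <= Rl f v - y v by lra.
have qu : 2 * e <= q v * Rl f v by lra.
have qU : 2 * e <= q v * (U + 1) by apply: (le_trans qu); rewrite ler_wpM2l.
have h2 : F <= b * (q v * (Rl f v - y v)).
  have h3 : 4 * e ^+ 2 <= (U + 1) * (q v * (Rl f v - y v)).
    have -> : 4 * e ^+ 2 = (2 * e) * (2 * e) by ring.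
    have e2 : 0 <= 2 * e by rewrite mulr_ge0// ltW.
    rewrite [leRHS]mulrA [(U + 1) * _]mulrC; exact: ler_pM.
  have -> : b * (q v * (Rl f v - y v)) = F * ((U + 1) * (q v * (Rl f v - y v)) / (4 * e ^+ 2)).
    by rewrite /b; field; rewrite gt_eqF.
  by rewrite ler_peMr// ler_pdivlMr ?mul1r// mulr_gt0// exprn_gt0.
have := fF v; rewrite ler_norml => /andP[_]; lra.
Qed.

End MaximumPrinciple.

End ResolventTheory.

(** * Distance to a set *)

Section Distance.
Variables (R : realType) (d : nat).
Local Notation E := 'rV[R]_d.
Variable A : set E.
Hypothesis A0 : A !=set0.

Definition dist (x : E) : R := inf [set `|x - a| | a in A].

Let hinf x : has_inf [set `|x - a| | a in A].
Proof.
split; first by have [a Aa] := A0; exists `|x - a|, a.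
by exists 0 => _ [a _ <-].
Qed.

Lemma dist_ge0 x : 0 <= dist x.
Proof. by apply: lb_le_inf => [|_ [a _ <-]//]; case: (hinf x). Qed.

Lemma dist_in x : A x -> dist x = 0.
Proof.
move=> Ax; apply/eqP; rewrite eq_le dist_ge0 andbT -(normr0 E) -(subrr x).
by apply: ge_inf; [case: (hinf x) | exists x].
Qed.

Lemma dist_lip x y : `|dist x - dist y| <= `|x - y|.
Proof.
have h u v : dist u <= dist v + `|u - v|.
  rewrite -lerBlDr; apply: lb_le_inf => [|_ [a Aa <-]]; first by case: (hinf v).
  rewrite lerBlDr; apply: le_trans (_ : `|u - a| <= _).
    by apply: ge_inf; [case: (hinf u) | exists a].
  have -> : u - a = (u - v) + (v - a) by rewrite addrA subrK.
  by rewrite addrC; exact: ler_normD.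
have := h x y; have := h y x; rewrite (distrC y x) ler_norml => ? ?.
by apply/andP; split; lra.
Qed.

Lemma continuous_dist : continuous dist.
Proof.
apply/continuous_distP => x e e0.
have /cvgrPdist_le/(_ _ e0) := @cvg_id _ (nbhs x).
by apply: filterS => y; apply: le_trans; exact: dist_lip.
Qed.

Lemma dist_gt0 x : closed A -> ~ A x -> 0 < dist x.
Proof.
move=> cA nAx; have : nbhs x (~` A).
  by apply: open_nbhs_nbhs; split => //; exact: closed_openC.
move=> /nbhs_ballP[e /= e0 eA]; apply: (lt_le_trans e0).
apply: lb_le_inf => [|_ [a Aa <-]]; first by case: (hinf x).
rewrite leNgt; apply/negP => xa; apply: (eA a) => //.
by rewrite -ball_normE.
Qed.

End Distance.

(** * Exit times and exit values *)

Section ExitPaths.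
Variables (R : realType) (d : nat).
Local Notation E := 'rV[R]_d.
Local Notation Om := (Omega R d).
Implicit Types (B C G : set E) (w : Om).

Lemma exit_time_ge0 B w : (0 <= exit_time B w)%E.
Proof. by apply: le_ereal_inf_tmp => _ [t [t0 _] <-]; rewrite lee_fin ltW. Qed.

Lemma before_exit B w (s : R) : 0 < s -> (s%:E < exit_time B w)%E -> B (X s w).
Proof.
move=> s0; apply: contraPP => nB; apply/negP; rewrite -leNgt.
by apply: ereal_inf_lbound; exists s.
Qed.

Lemma exit_time_le_sub B C w : B `<=` C -> (exit_time B w <= exit_time C w)%E.
Proof.
move=> BC; apply: ereal_inf_le_tmp => _ [t [t0 nC] <-]; exists t => //.
by split => // /BC.
Qed.

Lemma right_cont_nbhs w (z : R) G : open G -> G (X z w) ->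
  exists2 e : R, 0 < e & forall t, z <= t -> t < z + e -> G (X t w).
Proof.
move=> oG Gz; have nG : nbhs (X z w) G by exact: open_nbhs_nbhs.
have : \forall x \near z^'+, G (X x w) by exact: (right_cont_X nG).
move=> [e /= e0 he]; exists e => // t; rewrite le_eqVlt => /orP[/eqP <- //|zt] te.
by apply: he => //=; rewrite ltr0_norm ?subr_lt0// opprB ltrBlDl.
Qed.

(** Right continuity keeps the path in G just after z; this covers z = 0, although exit times look
    only at t > 0. *)
Lemma exit_time_le_open w (z : R) G : open G -> 0 <= z -> G (X z w) ->
  (exit_time (~` G) w <= z%:E)%E.
Proof.
move=> oG z0 Gz; have [e e0 he] := right_cont_nbhs oG Gz.
apply/lee_addgt0Pr => r r0; pose t := Num.min r (e / 2).
have t0 : 0 < t by rewrite lt_min r0 divr_gt0.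
apply: (@le_trans _ _ (z + t)%:E).
  apply: ereal_inf_lbound; exists (z + t) => //; split; first by rewrite ltr_wpDl.
  apply; apply: he; first by rewrite lerDl ltW.
  by rewrite ltrD2l gt_min; apply/orP; right; rewrite ltr_pdivrMr// ltr_pMr// ltr1n.
by rewrite -EFinD lee_fin lerD2l ge_min lexx.
Qed.

(** Points outside B occur at z or arbitrarily soon after it, and the path is right-continuous at
    z. *)
Lemma exit_closure B w (z : R) : exit_time B w = z%:E -> closure (~` B) (X z w).
Proof.
move=> ez V /nbhs_interior nV.
have [||e e0 he] := @right_cont_nbhs w z (interior V).
- exact: open_interior.
- exact: nbhs_singleton.
have : (exit_time B w < (z + e)%:E)%E by rewrite ez lte_fin ltrDl.
move=> /ereal_inf_lt[_ [t [t0 nB] <-]]; rewrite lte_fin => te.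
have zt : z <= t by rewrite -lee_fin -ez; apply: ereal_inf_lbound; exists t.
exists (X t w); split => //; apply: interior_subset; exact: he.
Qed.

End ExitPaths.

Section ExitValue.
Variables (R : realType) (d : nat).
Local Notation E := 'rV[R]_d.
Local Notation time := (measurableTypeR R).
Local Notation Om := (Omega R d).
Implicit Types (f g u k q : E -> R) (w : Om) (tau : Om -> \bar R).
Variables (Pt : R -> (E -> R) -> (E -> R)) (P : E -> probability Om R).
Hypotheses (feller : feller_semigroup Pt) (process : feller_process Pt P).
Variables (lam : R) (lam0 : 0 < lam).
Local Notation Rl := (res Pt lam0).
Local Notation J := (discounted_cost lam0).
Local Notation D := (discounted_exit lam).

Lemma res_cost f x : C0 f -> Rl f x = mean (P x) (J f (fun _ => 0%E)).
Proof.
move=> cf; have := cost_cst_split feller process lam0 x (lexx 0) cf (@F0T R d 0).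
under eq_mean do rewrite indicT mul1r.
under [X in _ = X -> _]eq_mean do rewrite indicT mul1r /discounted_exit mulr0 expR0 mul1r.
by move=> ->; rewrite (mean_initial process)//; exact: res_C0.
Qed.

Lemma le_cost f tau tau' w : C0 f -> (forall x, 0 <= f x) ->
  measurable_fun setT tau -> measurable_fun setT tau' ->
  (tau w <= tau' w)%E -> J f tau' w <= J f tau w.
Proof.
move=> cf f0 mt mt' tt'.
apply: le_mean; [exact: (bmeas_cost_path w cf mt') | exact: (bmeas_cost_path w cf mt) |].
move=> s; rewrite ler_wpM2r// !indicE.
have [/set_mem /= h|_] := boolP (s \in [set r | (tau' w < r%:E)%E]); last first.
  by rewrite ler0n.
by rewrite mem_set//=; exact: le_lt_trans h.
Qed.

(** Before the exit the path stays in B, where k vanishes, and the exit time itself is null for the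
    clock. *)
Lemma cost_no_charge k (B : set E) w : closed B -> C0 k -> (forall x, B x -> k x = 0) ->
  J k (exit_time B) w = J k (fun _ => 0%E) w.
Proof.
move=> cB ck kB.
have mt := optional_measurable (optional_exit cB).
have m0 : measurable_fun setT (fun _ : Om => 0%E : \bar R) by exact: measurable_cst.
pose N : set time := [set s | exit_time B w = s%:E].
have nN : (expo lam0).-negligible N.
  case e : (exit_time B w) => [z| |].
  - exists [set z]; split => //; last by move=> s; rewrite /N /= e => -[->].
    by rewrite expoE integral_set1.
  - by exists set0; split => // s; rewrite /N /= e.
  - by exists set0; split => // s; rewrite /N /= e.
apply: (eq_mean_ae nN); [exact: (bmeas_cost_path w ck mt) | exact: (bmeas_cost_path w ck m0) |].
move=> s /= ns; rewrite !indicE.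
have [/set_mem /= h1|/negP h1] := boolP (s \in [set r | (exit_time B w < r%:E)%E]).
  by rewrite mem_set//=; apply: le_lt_trans h1; exact: exit_time_ge0.
have [/set_mem /= h2|_ //] := boolP (s \in [set r | (0%E < r%:E)%E]).
rewrite mul0r mul1r kB//; apply: before_exit => //.
rewrite lt_neqAle; apply/andP; split; first by apply/eqP => /esym.
by rewrite leNgt; apply/negP => h; apply: h1; rewrite inE.
Qed.

Variable O : set E.
Local Notation zeta := (exit_time (closure O)).

Definition exit_value g x := mean (P x) (D g zeta).
Local Notation H := exit_value.

Lemma opt_zeta : optional zeta.
Proof. by apply: optional_exit; exact: closed_closure. Qed.

Lemma bmeas_zeta g : C0 g -> bmeas (D g zeta).
Proof.
move=> cg; apply: bmeas_exit => //; last exact: optional_measurable opt_zeta.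
exact: exit_time_ge0.
Qed.

Lemma exit_valueB f g : C0 f -> C0 g ->
  H (fun x => f x - g x) = (fun x => H f x - H g x).
Proof.
move=> cf cg; apply/funext => x; rewrite /H -meanB; [|exact: bmeas_zeta..].
apply: eq_mean => w; rewrite /discounted_exit.
by case: (zeta w) => [z| |]; rewrite ?subr0// mulrBr.
Qed.

Lemma exit_value_bound f (M : R) x : 0 <= M -> C0 f -> (forall y, `|f y| <= M) -> `|H f x| <= M.
Proof.
move=> M0 cf fM; apply: mean_bound; first exact: bmeas_zeta.
by move=> w; apply: exit_bound => //; exact: exit_time_ge0.
Qed.

Lemma exit_value_immediate f x : C0 f -> (P x).-negligible [set w | zeta w != 0%E] ->
  H f x = f x.
Proof.
move=> cf n0; rewrite -(mean_initial process x cf).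
apply: (eq_mean_ae n0); [exact: bmeas_zeta | exact: bmeas_fX|].
move=> w /negP; rewrite negbK => /eqP e0.
by rewrite /discounted_exit e0 /= mulr0 expR0 mul1r.
Qed.

Lemma immediate_outside x : ~ closure O x -> (P x).-negligible [set w | zeta w != 0%E].
Proof.
move=> nO; apply: (negligibleS _ (initial_negligible process x)).
move=> w; apply: contraNneq => X0.
rewrite eq_le exit_time_ge0 andbT -[closure O]setCK.
apply: exit_time_le_open => //; first exact/closed_openC/closed_closure.
by rewrite X0.
Qed.

(** Since k charges nothing before zeta, Dynkin's formula leaves only the exit term. *)
Lemma exit_value_martingale k x : C0 k -> (forall y, closure O y -> k y = 0) ->
  Rl k x = H (Rl k) x.
Proof.
move=> ck k0; rewrite (res_cost x ck) /H.
rewrite -(dynkin feller process lam0 x ck opt_zeta).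
by apply: eq_mean => w; rewrite (cost_no_charge w (@closed_closure _ O) ck k0).
Qed.

Lemma bmeas_J f tau : C0 f -> optional tau -> bmeas (J f tau).
Proof. by move=> cf ot; apply: (bmeas_cost P) => //; exact: optional_measurable. Qed.

Lemma exit_value_dynkin f x : C0 f -> H (Rl f) x = mean (P x) (J f zeta).
Proof. by move=> cf; rewrite /H -(dynkin feller process lam0 x cf opt_zeta). Qed.

(* Optional sampling for the nonnegative supermartingale exp(-lam t) R k(X_t), entered at a time when R k dominates R f - e. *)
Lemma supermartingale_entry k f (B : set E) (e : R) x : C0 k -> (forall y, 0 <= k y) ->
  C0 f -> 0 <= e -> closed B ->
  (forall y, closure (~` B) y -> Rl f y - e <= Rl k y) ->
  mean (P x) (J f (exit_time B)) - e <= Rl k x.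
Proof.
move=> ck k0 cf e0 cB kf.
have ot := optional_exit cB.
have mt := optional_measurable ot.
have m0 : measurable_fun setT (fun _ : Om => 0%E : \bar R) by exact: measurable_cst.
have cuk : C0 (Rl k) by exact: res_C0.
have cuf : C0 (Rl f) by exact: res_C0.
have bD g : C0 g -> bmeas (D g (exit_time B)).
  by move=> cg; apply: bmeas_exit => // w; exact: exit_time_ge0.
apply: (@le_trans _ _ (mean (P x) (J k (exit_time B)))); last first.
  rewrite (res_cost x ck); apply: le_mean; [exact: bmeas_J | exact: (bmeas_cost P lam0 ck m0) |].
  by move=> w; apply: le_cost => //; exact: exit_time_ge0.
rewrite (dynkin feller process lam0 x cf ot) (dynkin feller process lam0 x ck ot).
rewrite -[X in _ - X](mean_cst (P x)) -(meanB _ (bD _ cuf) (bmeas_cst e)).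
apply: le_mean; [exact: (bmeasB (bD _ cuf) (bmeas_cst e)) | exact: bD |].
move=> w; rewrite /discounted_exit; case ez : (exit_time B w) => [z| |].
- have z0 : 0 <= z by rewrite -lee_fin -ez exit_time_ge0.
  have := kf _ (exit_closure ez).
  have h1 : 0 < expR (- lam * z) by exact: expR_gt0.
  have h2 : expR (- lam * z) <= 1.
    by rewrite -expR0 ler_expR mulNr oppr_le0 mulr_ge0// ltW.
  move=> h3; have h4 : expR (- lam * z) * (Rl f (X z w) - e) <= expR (- lam * z) * Rl k (X z w).
    by rewrite ler_pM2l.
  have h5 : expR (- lam * z) * e <= e by rewrite ler_piMl.
  by rewrite mulrBr in h4; lra.
- by rewrite sub0r oppr_le0.
- by rewrite sub0r oppr_le0.
Qed.

End ExitValue.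

(** * Approximation of the exit value by penalization *)

Section Exhaustion.
Variables (R : realType) (d : nat).
Local Notation E := 'rV[R]_d.
Local Notation time := (measurableTypeR R).
Local Notation Om := (Omega R d).
Implicit Types (f g u k q : E -> R) (w : Om) (tau : Om -> \bar R).
Variables (Pt : R -> (E -> R) -> (E -> R)) (P : E -> probability Om R).
Hypotheses (feller : feller_semigroup Pt) (process : feller_process Pt P).
Variables (lam : R) (lam0 : 0 < lam).
Local Notation Rl := (res Pt lam0).
Local Notation J := (discounted_cost lam0).
Local Notation D := (discounted_exit lam).
Variable O : set E.
Hypothesis O0 : closure O !=set0.
Local Notation zeta := (exit_time (closure O)).
Local Notation H := (exit_value P lam O).
Local Notation del := (dist (closure O)).

(** For n > 0 it vanishes up to distance 1/n and equals 1 from distance 2/n on. The dead zone makes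
    [cutoff m] equal to 1 wherever [cutoff n] is nonzero, once m >= 2 n. *)
Definition cutoff (n : nat) (x : E) : R := Num.max 0 (Num.min 1 (n%:R * del x - 1)).

Lemma continuous_cutoff n : continuous (cutoff n).
Proof.
move=> x; apply: (continuous_max (@cst_continuous _ _ 0 x)).
apply: (continuous_min (@cst_continuous _ _ (1 : R) x)).
apply: (@continuousB _ _ _ (fun x => n%:R * del x) (fun=> 1)); last exact: cst_continuous.
by apply: continuousM; [exact: cst_continuous | exact: continuous_dist].
Qed.

Lemma cutoff01 n x : 0 <= cutoff n x <= 1.
Proof. by rewrite le_max lexx ge_max ler01 ge_min lexx. Qed.

Lemma cutoff_in n x : closure O x -> cutoff n x = 0.
Proof.
by move=> Ox; rewrite /cutoff dist_in// mulr0 sub0r min_r ?max_l ?oppr_le0// lerN10.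
Qed.

Lemma cutoff_eq1 n x : 2 <= n%:R * del x -> cutoff n x = 1.
Proof. by move=> h; rewrite /cutoff min_l ?max_r//; lra. Qed.

Lemma cutoff_neq0 n x : cutoff n x != 0 -> 1 <= n%:R * del x.
Proof.
apply: contraR; rewrite -ltNge => h; apply/eqP; rewrite /cutoff max_l//.
by rewrite ge_min; apply/orP; right; lra.
Qed.

Variables (f : E -> R) (cf : C0 f) (f0 : forall x, 0 <= f x).

Definition exhaustion (y : nat -> E -> R) := forall n,
  exists b, [/\ 0 <= b, C0 (y n), y n = Rl (fun x => b * (cutoff n x * (Rl f x - y n x))),
    (forall x, 0 <= y n x <= Rl f x) &
    forall x, cutoff n x * Rl f x - n.+1%:R^-1 <= y n x].

Lemma exhaustion_exists : exists y, exhaustion y.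
Proof.
have /choice[y hy] : forall n : nat, exists y : E -> R,
    exists b, [/\ 0 <= b, C0 y, y = Rl (fun x => b * (cutoff n x * (Rl f x - y x))),
    (forall x, 0 <= y x <= Rl f x) & forall x, cutoff n x * Rl f x - n.+1%:R^-1 <= y x].
  move=> n; have n0 : 0 < n.+1%:R^-1 :> R by rewrite invr_gt0.
  have [b [y hy]] := penalization_exhausts feller process lam0 cf f0
    (@continuous_cutoff n) (cutoff01 n) n0.
  by exists y, b.
by exists y.
Qed.

Variable y : nat -> E -> R.
Hypothesis hy : exhaustion y.

Let cy n : C0 (y n). Proof. by have [b []] := hy n. Qed.
Let y0u n x : 0 <= y n x <= Rl f x. Proof. by have [b []] := hy n. Qed.
Let ylo n x : cutoff n x * Rl f x - n.+1%:R^-1 <= y n x. Proof. by have [b []] := hy n. Qed.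
Let cu : C0 (Rl f). Proof. exact: res_C0. Qed.

Lemma exhaustion_charge n : exists k, [/\ C0 k, (forall x, 0 <= k x),
  (forall x, closure O x -> k x = 0) & y n = Rl k].
Proof.
have [b [b0 _ yE yu _]] := hy n.
exists (fun x => b * (cutoff n x * (Rl f x - y n x))); split => //.
- apply: (C0_penalization b (@continuous_cutoff n) (cutoff01 n)).
  exact: C0B.
- move=> x; have /andP[c0 _] := cutoff01 n x; rewrite !mulr_ge0// subr_ge0.
  by case/andP: (yu x).
- by move=> x Ox; rewrite cutoff_in// mul0r mulr0.
Qed.

Lemma exhaustion_le n x : y n x <= H (Rl f) x.
Proof.
have [k [ck k0 kO yk]] := exhaustion_charge n.
have -> : y n x = H (y n) x.
  by rewrite yk; exact: exit_value_martingale.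
apply: le_mean; [exact: bmeas_zeta | exact: bmeas_zeta |].
move=> w; rewrite /discounted_exit; case: (zeta w) => // z.
by rewrite ler_pM2l ?expR_gt0//; case/andP: (y0u n (X z w)).
Qed.

(** The radius is such that [cutoff n.+1] equals 1 off [B n]. *)
Let B (n : nat) : set E := [set x | del x <= 2 / n.+1%:R].

Let closedB n : closed (B n).
Proof.
have -> : B n = del @^-1` [set r : R | r <= 2 / n.+1%:R] by [].
apply: closed_comp; last exact: closed_le.
by move=> x _; exact: continuous_dist.
Qed.

Lemma exhaustion_ge n x : mean (P x) (J f (exit_time (B n))) - n.+2%:R^-1 <= y n.+1 x.
Proof.
have [k [ck k0 kO yk]] := exhaustion_charge n.+1; rewrite yk.
have n0 : 0 <= n.+2%:R^-1 :> R by rewrite invr_ge0.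
have := @supermartingale_entry R d Pt P feller process lam lam0 k f (B n) (n.+2%:R^-1) x
  ck k0 cf n0 (@closedB n).
apply.
move=> v hv; rewrite -yk; apply: le_trans (ylo n.+1 v).
rewrite cutoff_eq1 ?mul1r//.
have : closed [set x | 2 / n.+1%:R <= del x].
  have -> : [set x | 2 / n.+1%:R <= del x] = del @^-1` [set r : R | 2 / n.+1%:R <= r] by [].
  apply: closed_comp; last exact: closed_ge.
  by move=> z _; exact: continuous_dist.
move=> /closure_id clE.
have : closure [set x | 2 / n.+1%:R <= del x] v.
  by apply: closureS hv => z /= /negP; rewrite -ltNge => /ltW.
by rewrite -clE /= ler_pdivrMr// mulrC.
Qed.

(** A path outside [closure O] at a time t < s has positive distance there, hence is outside [B n]
    for large n: the exit times from [B n] come down to zeta. *)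
Lemma cvg_cost_exit x :
  mean (P x) (J f (exit_time (B n))) @[n --> \oo] --> mean (P x) (J f zeta).
Proof.
have [M M0 fM] := C0_bounded cf.
have mB n := optional_measurable (optional_exit (@closedB n)).
apply: (fun h1 h2 h3 => proj2 (@mean_cvg _ _ _ _ _ _ M h1 h2 h3)).
- by move=> n; case: (bmeas_cost P lam0 cf (mB n)).
- move=> n w; apply: mean_bound => [|s]; first exact: bmeas_cost_path (mB n).
  by rewrite indicE; case: (_ \in _); rewrite ?mul1r ?mul0r ?normr0.
move=> w; apply: (fun h1 h2 h3 => proj2 (@mean_cvg _ _ _ _ _ _ M h1 h2 h3)).
- by move=> n; case: (bmeas_cost_path w cf (mB n)).
- by move=> n s; rewrite indicE; case: (_ \in _); rewrite ?mul1r ?mul0r ?normr0.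
move=> s; apply: cvgM; last exact: cvg_cst.
apply: cvg_near_cst.
have [zs|sz] := ltP (zeta w) s%:E; last first.
  apply: nearW => n; rewrite !indicE !memNset//= => h.
    by move: h; rewrite ltNge sz.
  have : (zeta w <= exit_time (B n) w)%E.
    by apply: exit_time_le_sub => v Ov; rewrite /B /= dist_in.
  by move=> /le_lt_trans/(_ h); rewrite ltNge sz.
move: (zs) => /ereal_inf_lt[_ [t [t0 nO] <-]]; rewrite lte_fin => ts.
have dt : 0 < del (X t w) by apply: dist_gt0 => //; exact: closed_closure.
have d2 : 0 < del (X t w) / 2 by rewrite divr_gt0.
near=> n; rewrite !indicE !mem_set//=.
apply: (@le_lt_trans _ _ t%:E); last by rewrite lte_fin.
apply: ereal_inf_lbound; exists t => //; split => // /=.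
rewrite /B /= => h.
have : n.+1%:R^-1 < del (X t w) / 2 by near: n; exact: (near_infty_natSinv_lt (PosNum d2)).
by move: h; set a := _^-1 => h h2; lra.
Unshelve. all: by end_near. Qed.

Lemma cvg_exhaustion x : y n x @[n --> \oo] --> H (Rl f) x.
Proof.
rewrite -cvg_shiftS /=.
have hl : mean (P x) (J f (exit_time (B n))) - n.+2%:R^-1 @[n --> \oo] --> H (Rl f) x.
  rewrite (exit_value_dynkin feller process lam0 O x cf) -[X in _ --> X]subr0.
  apply: cvgB; first exact: cvg_cost_exit.
  apply/cvgrPdist_lt => e e0; near=> n; rewrite sub0r normrN ger0_norm ?invr_ge0//.
  apply: (@le_lt_trans _ _ n.+1%:R^-1); first by rewrite lef_pV2 ?posrE// ler_nat.
  by near: n; exact: (near_infty_natSinv_lt (PosNum e0)).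
apply: (squeeze_cvgr _ hl (@cvg_cst _ (H (Rl f) x) _ _ _)).
by apply: nearW => n; rewrite exhaustion_ge exhaustion_le.
Unshelve. all: by end_near. Qed.

(** Where [cutoff n] is nonzero, [cutoff m] is 1 and y m >= R f - 1/(m+1). There an excess of y n
    over y m by more than 1/(m+1) makes the charge of y n nonpositive, so the maximum principle
    applies. This stands in for monotonicity in Dini's argument. *)
Lemma exhaustion_almost_mono n m x : (n.*2 <= m)%N -> y n x <= y m x + m.+1%:R^-1.
Proof.
move=> nm; have [b [b0 _ yE _ _]] := hy n.
have [k [ck k0 kO yk]] := exhaustion_charge m.
have ckn : C0 (fun x => b * (cutoff n x * (Rl f x - y n x))).
  by apply: (C0_penalization b (@continuous_cutoff n) (cutoff01 n)); exact: C0B.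
pose h x := b * (cutoff n x * (Rl f x - y n x)) - k x.
have hE v : Rl h v = y n v - y m v by rewrite /h resB// -yE -yk.
have e0 : 0 <= m.+1%:R^-1 :> R by rewrite invr_ge0.
suff : Rl h x <= m.+1%:R^-1 by rewrite hE lerBlDl.
apply: (res_max_principle feller process) => //; first exact: C0B.
move=> v; rewrite hE /h => hv; rewrite subr_le0 (le_trans _ (k0 v))//.
have [->|c0] := eqVneq (cutoff n v) 0; first by rewrite mul0r mulr0.
have d1 := cutoff_neq0 c0.
have : cutoff m v = 1.
  apply: cutoff_eq1; apply: (@le_trans _ _ ((n.*2)%:R * del v)).
    by rewrite -muln2 natrM; lra.
  by rewrite ler_wpM2r ?ler_nat// dist_ge0.
move=> cm; have := ylo m v; rewrite cm mul1r => hm.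
rewrite mulr_ge0_le0// mulr_ge0_le0//; first by case/andP: (cutoff01 n v).
by move: hv hm; set e := _^-1 => hv hm; lra.
Qed.

End Exhaustion.

Lemma three_eps {R : realFieldType} (a b p q e : R) :
  `|a - p| <= e / 3 -> `|p - q| <= e / 3 -> `|b - q| <= e / 3 -> `|a - b| <= e.
Proof.
rewrite !ler_norml => /andP[? ?] /andP[? ?] /andP[? ?].
by apply/andP; split; lra.
Qed.

Lemma three_eps_sub {R : realFieldType} (a b c p q e : R) :
  `|(a - b) - c| <= e / 3 -> `|a - p| <= e / 3 -> `|b - q| <= e / 3 -> `|c - (p - q)| <= e.
Proof.
rewrite !ler_norml => /andP[? ?] /andP[? ?] /andP[? ?].
by apply/andP; split; lra.
Qed.

(** * Continuity of the exit value *)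

Section ExitContinuity.
Variables (R : realType) (d : nat).
Local Notation E := 'rV[R]_d.
Local Notation time := (measurableTypeR R).
Local Notation Om := (Omega R d).
Implicit Types (f g u k q : E -> R) (w : Om) (tau : Om -> \bar R).
Variables (Pt : R -> (E -> R) -> (E -> R)) (P : E -> probability Om R).
Hypotheses (feller : feller_semigroup Pt) (process : feller_process Pt P).
Variables (lam : R) (lam0 : 0 < lam).
Local Notation Rl := (res Pt lam0).
Local Notation J := (discounted_cost lam0).
Local Notation D := (discounted_exit lam).
Variables (O N1 : set E).
Hypotheses (oO : open O) (oN1 : open N1) (bN1 : boundary1 P O `<=` N1).
Hypothesis exitN1 : forall x, closure O x -> (P x).-negligible (exit_pos_in O (closure N1)).
Local Notation zeta := (exit_time (closure O)).
Local Notation H := (exit_value P lam O).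

Let K : set E := ~` (O `|` N1).

Let closedK : closed K.
Proof. by apply: open_closedC; exact: openU. Qed.

Lemma immediate_exit x : K x -> (P x).-negligible [set w | zeta w != 0%E].
Proof.
move=> Kx; have [clOx|nclOx] := pselect (closure O x); last first.
  exact: (immediate_outside process).
apply: contrapT => nreg; apply: (Kx); right; apply: bN1; split.
  by split => // Ox; apply: Kx; left.
by move=> [_].
Qed.

(** At its exit from O the path is outside O and, almost surely, outside N1, hence in K and so in
    the open set G where y > R f - e. Thus G is reached no later than zeta, and
    [supermartingale_entry] applies. *)
Lemma exit_value_le (f y : E -> R) (e : R) k x : C0 f -> (forall v, 0 <= f v) -> 0 < e ->
  C0 k -> (forall v, 0 <= k v) -> y = Rl k -> (forall v, K v -> Rl f v - e < y v) ->
  closure O x -> H (Rl f) x - e <= y x.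
Proof.
move=> cf f0 e0 ck k0 yE Ky clOx.
have cu : C0 (Rl f) by exact: res_C0.
have cy : C0 y by rewrite yE; exact: res_C0.
pose G := [set v : E | Rl f v - e < y v].
have cGf : continuous (fun v => y v - Rl f v).
  by case: (C0B cy cu).
have oG : open G.
  have -> : G = (fun v => y v - Rl f v) @^-1` [set r : R | - e < r].
    by apply/seteqP; split => v /=; rewrite /G /=; lra.
  by apply: open_comp; [move=> v _; exact: cGf | exact: open_gt].
have clG v : closure G v -> Rl f v - e <= y v.
  have cl : closed [set v : E | Rl f v - e <= y v].
    have -> : [set v : E | Rl f v - e <= y v] = (fun v => y v - Rl f v) @^-1` [set r : R | - e <= r].
      by apply/seteqP; split => z /=; lra.
    by apply: closed_comp; [move=> z _; exact: cGf | exact: closed_ge].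
  have sG : G `<=` [set v : E | Rl f v - e <= y v] by move=> z /ltW.
  by move=> /(closureS sG); move/closure_id : cl => <-.
have cG : closed (~` G) by exact: open_closedC.
have step : mean (P x) (J f (exit_time (~` G))) - e <= Rl k x.
  apply: (@supermartingale_entry R d Pt P feller process lam lam0 k f (~` G) e x ck k0 cf (ltW e0) cG).
  by move=> v; rewrite setCK -yE; exact: clG.
rewrite yE; apply: le_trans step; rewrite lerB//.
rewrite (exit_value_dynkin feller process lam0 O x cf).
have ot := optional_exit cG.
apply: (le_mean_ae (exitN1 clOx)).
- exact: (bmeas_J P lam0 cf (opt_zeta O)).
- exact: (bmeas_J P lam0 cf ot).
move=> w nw; apply: le_cost => //; [exact: optional_measurable ot | exact: optional_measurable (opt_zeta O) |].
case ez : (zeta w) => [z| |]; [|exact: leey|]; last first.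
  by have := exit_time_ge0 (closure O) w; rewrite ez.
have hz : (exit_time O w <= z%:E)%E.
  by rewrite -ez; apply: exit_time_le_sub; exact: subset_closure.
case ez' : (exit_time O w) (exit_time_ge0 O w) => [z'| |] // z0; last by rewrite ez' in hz.
rewrite lee_fin in z0; apply: le_trans hz; rewrite ez'.
apply: exit_time_le_open => //; apply: Ky.
have clC : closure (~` O) (X z' w) by exact: exit_closure.
have nO : ~ O (X z' w).
  by move: clC; have /closure_id <- := open_closedC oO.
move=> [//|hN]; apply: nw; exists z'; split => //.
exact: subset_closure.
Qed.

Lemma exit_value_uniform f (e : R) : closure O !=set0 -> C0 f -> (forall v, 0 <= f v) -> 0 < e ->
  exists2 y, C0 y & forall x, closure O x -> `|H (Rl f) x - y x| <= e.
Proof.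
move=> O0 cf f0 e0.
have cu : C0 (Rl f) by exact: res_C0.
have [y hy] := exhaustion_exists feller process lam0 O0 cf f0.
pose r := e / 6; have r0 : 0 < r by rewrite divr_gt0.
have cy n : C0 (y n) by have [b []] := hy n.
have [N uN] := cu.2 _ r0.
pose M := Num.max 0 N.
(* K may be unbounded. Beyond radius M one has R f < r and y m >= 0, so Dini's argument is required
   only on this compact piece. *)
pose KM := K `&` [set x : E | `|x| <= M].
have cKM : compact KM.
  apply: bounded_closed_compact.
    exists M; split; first exact: num_real.
    by move=> m Mm x [_ /= /le_trans]; apply; exact: ltW.
  apply: closedI => //.
  have -> : [set x : E | `|x| <= M] = (fun x : E => `|x|) @^-1` [set a : R | a <= M] by [].
  apply: closed_comp; last exact: closed_le.
  by move=> x _; exact: norm_continuous.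
have inv_near : \forall m \near \oo, m.+1%:R^-1 < r.
  exact: (near_infty_natSinv_lt (PosNum r0)).
have : \forall m \near \oo, KM `<=` [set x | Rl f x - 2 * r < y m x].
  (* Compactness as near covering: a neighbourhood and a rank around each point yield one rank for
     all of KM. One r is spent on convergence at rank n, the other on passing from y n to y m. *)
  have near_cover := (compact_near_coveringP KM).1 cKM.
  apply: (near_cover nat \oo (fun m x => Rl f x - 2 * r < y m x)) => x [Kx _].
  have hx : y n x @[n --> \oo] --> Rl f x.
    rewrite -(exit_value_immediate process lam0 cu (immediate_exit Kx)).
    exact: (@cvg_exhaustion R d Pt P feller process lam lam0 O O0 f cf y hy x).
  have /cvgrPdist_lt/(_ _ r0) [n _ /(_ n (leqnn n)) hn] := hx.
  have hn' : 0 < y n x - Rl f x + r by move: hn; rewrite ltr_norml => /andP[_]; lra.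
  have cny : continuous (fun v => y n v - Rl f v) by case: (C0B (cy n) cu).
  have nV : \forall x' \near x, Rl f x' - r < y n x'.
    have /continuous_distP/(_ x _ (divr_gt0 hn' (ltr0Sn _ 1))) := cny.
    apply: filterS => z; rewrite ler_norml => /andP[? ?]; lra.
  have nm : \forall m \near \oo, m.+1%:R^-1 < r /\ (n.*2 <= m)%N.
    near=> m; split; near: m => //; exact: nbhs_infty_ge.
  exists ([set x' | Rl f x' - r < y n x'], [set m | m.+1%:R^-1 < r /\ (n.*2 <= m)%N]) => //.
  move=> [x' m] [/= h1 [h2 h3]].
  have := exhaustion_almost_mono feller process O0 cf hy x' h3.
  by move: h2; set a := _^-1; lra.
move=> [m0 _ hm].
have [m m0m mr] : exists2 m : nat, (m0 <= m)%N & m.+1%:R^-1 < r.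
  have [m1 _ hm1] := inv_near.
  by exists (maxn m0 m1); [exact: leq_maxl | apply: hm1 => /=; exact: leq_maxr].
have Kym x : K x -> Rl f x - 2 * r < y m x.
  move=> Kx; have [xM|Mx] := leP `|x| M; first exact: (hm m m0m x).
  have [b [_ _ _ yu _]] := hy m.
  have /andP[ym0 _] := yu x.
  have : N < `|x| by apply: le_lt_trans Mx; rewrite le_max lexx orbT.
  by move=> /uN; rewrite ltr_norml => /andP[_]; lra.
have [k' [ck' k'0 k'O yk']] := exhaustion_charge feller O0 cf hy m.
(* Equal to 1 where y m > R f - 2 r and to 0 where y m < R f - 3 r. Penalizing with chi gives a z
   that is close to R f on K and charged only where y m is nearly R f, whence z <= y m + 3 r. *)
pose chi v := Num.max 0 (Num.min 1 ((y m v - Rl f v + 3 * r) / r)).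
have cchi : continuous chi.
  have c1 : continuous (fun v => (y m v - Rl f v + 3 * r) / r).
    move=> v; apply: (@continuousM _ _ (fun v => y m v - Rl f v + 3 * r) (fun=> r^-1)); last exact: cst_continuous.
    apply: (@continuousD _ _ _ (fun v => y m v - Rl f v) (fun=> 3 * r)); last exact: cst_continuous.
    by case: (C0B (cy m) cu) => + _; exact.
  move=> v; apply: (continuous_max (@cst_continuous _ _ (0 : R) v)).
  exact: (continuous_min (@cst_continuous _ _ (1 : R) v) (c1 v)).
have chi01 v : 0 <= chi v <= 1 by rewrite le_max lexx ge_max ler01 ge_min lexx.
have [b [z [b0 cz zE zu zlo]]] :=
  penalization_exhausts feller process lam0 cf f0 cchi chi01 r0.
have chi1 v : Rl f v - 2 * r < y m v -> chi v = 1.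
  move=> h; rewrite /chi min_l ?max_r// ler_pdivlMr// mul1r; lra.
have chi0 v : chi v != 0 -> Rl f v - 3 * r <= y m v.
  apply: contraR; rewrite -ltNge => h; apply/eqP; rewrite /chi max_l//.
  rewrite ge_min; apply/orP; right.
  by rewrite pmulr_lle0 ?invr_gt0//; lra.
have ckz : C0 (fun v => b * (chi v * (Rl f v - z v))).
  by apply: (C0_penalization b cchi chi01); exact: C0B.
have kz0 v : 0 <= b * (chi v * (Rl f v - z v)).
  have /andP[c0 _] := chi01 v; rewrite !mulr_ge0// subr_ge0.
  by case/andP: (zu v).
have upper v : z v <= y m v + 3 * r.
  pose h v := b * (chi v * (Rl f v - z v)) - k' v.
  have hE t : Rl h t = z t - y m t by rewrite /h resB// -zE -yk'.
  have r30 : 0 <= 3 * r by rewrite mulr_ge0// ltW.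
  suff : Rl h v <= 3 * r by rewrite hE lerBlDl.
  apply: (res_max_principle feller process) => //; first exact: C0B.
  move=> t; rewrite hE /h => ht; rewrite subr_le0 (le_trans _ (k'0 t))//.
  have [->|/chi0 c0] := eqVneq (chi t) 0; first by rewrite mul0r mulr0.
  rewrite mulr_ge0_le0// mulr_ge0_le0//; first by case/andP: (chi01 t).
  by lra.
exists (y m) => // x clOx.
have lower : H (Rl f) x - 2 * r <= z x.
  apply: (exit_value_le cf f0 _ ckz kz0 zE _ clOx); first by rewrite mulr_gt0.
  move=> v /Kym hv; have := zlo v; rewrite (chi1 _ hv) mul1r; lra.
have := exhaustion_le feller process O0 cf hy m x.
move: lower (upper x); set hh := H _ _; rewrite ler_norml => ? ? ?.
(* The losses are 2 r between H (R f) and z, and 3 r between z and y m. *)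
have er : e = 6 * r by rewrite /r; field.
by apply/andP; split; lra.
Unshelve. all: by end_near. Qed.

(** H is a sup-norm contraction and the range of R is dense, so g reduces to R c, and c to its
    positive and negative parts; the result is a uniform limit of continuous functions. *)
Lemma exit_value_continuous g : C0 g -> {within closure O, continuous (H g)}.
Proof.
move=> cg; have [ne0| /set0P/negP/negPn/eqP ->] := pselect (closure O !=set0); last first.
  by apply/subspace_continuousP.
have approx e : 0 < e -> exists2 y, C0 y & forall x, closure O x -> `|H g x - y x| <= e.
  move=> e0; have e30 : 0 < e / 3 by rewrite divr_gt0.
  have [c cc hc] := res_approx feller process lam0 cg e30.
  pose cp v := Num.max 0 (c v); pose cn v := Num.max 0 (- c v).
  have Cp : C0 cp by exact: C0_max.
  have Cn : C0 cn by apply: C0_max; exact: C0N.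
  have cp0 v : 0 <= cp v by rewrite le_max lexx.
  have cn0 v : 0 <= cn v by rewrite le_max lexx.
  have cE : c = (fun v => cp v - cn v).
    by apply/funext => v; rewrite /cp /cn; case: (leP 0 (c v)); case: (leP 0 (- c v)); lra.
  have [yp Yp hp] := exit_value_uniform ne0 Cp cp0 e30.
  have [yn Yn hn] := exit_value_uniform ne0 Cn cn0 e30.
  exists (fun v => yp v - yn v); first exact: C0B.
  move=> x clOx; have hpx := hp x clOx; have hnx := hn x clOx.
  have Hc : H (Rl c) x = H (Rl cp) x - H (Rl cn) x.
    have -> : Rl c = (fun v => Rl cp v - Rl cn v) by rewrite {1}cE resB.
    by rewrite exit_valueB//; exact: res_C0.
  have cu : C0 (Rl c) by exact: res_C0.
  have hg : `|H (fun v => Rl c v - g v) x| <= e / 3.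
    by apply: exit_value_bound => //; [exact: ltW | exact: C0B].
  rewrite exit_valueB// Hc in hg.
  exact: three_eps_sub hg hpx hnx.
apply/subspace_continuousP => x clOx.
apply/cvgrPdist_le => e e0; have e30 : 0 < e / 3 by rewrite divr_gt0.
have [y [cy _] hy] := approx _ e30.
have hx := hy x clOx.
have /continuous_distP/(_ x _ e30) := cy.
rewrite near_withinE; apply: filterS => z hz clOz.
exact: three_eps hx hz (hy z clOz).
Qed.

End ExitContinuity.

(** * Viscosity inequalities *)

Section Viscosity.
Variables (R : realType) (d : nat).
Local Notation E := 'rV[R]_d.
Local Notation time := (measurableTypeR R).
Local Notation Om := (Omega R d).
Implicit Types (f g u k q : E -> R) (w : Om) (tau : Om -> \bar R).
Variables (Pt : R -> (E -> R) -> (E -> R)) (P : E -> probability Om R).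
Hypotheses (feller : feller_semigroup Pt) (process : feller_process Pt P).
Variables (lam : R) (lam0 : 0 < lam).
Local Notation Rl := (res Pt lam0).
Local Notation J := (discounted_cost lam0).
Local Notation D := (discounted_exit lam).
Local Notation stop tau h := (fun w => Order.min (tau w) h%:E).
Local Notation late tau h := [set w | (h%:E <= tau w)%E].

Lemma optional_min tau (h : R) : 0 <= h -> optional tau -> optional (stop tau h).
Proof.
move=> h0 [t0 ot]; split=> [w|t t_gt0]; first by rewrite le_min t0 lee_fin.
have [ht|th] := ltP h t.
  rewrite (_ : [set w | _] = setT); first exact: F0T.
  by apply/seteqP; split => // w _ /=; rewrite gt_min lte_fin ht orbT.
rewrite (_ : [set w | _] = [set w | (tau w < t%:E)%E]); first exact: ot.
by apply/seteqP; split => w /=; rewrite gt_min lte_fin (ltNge h t) th orbF.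
Qed.

Lemma measurable_late tau (h : R) : 0 < h -> optional tau -> measurable (late tau h : set Om).
Proof.
move=> h0 [_ ot]; rewrite (_ : late tau h = ~` [set w | (tau w < h%:E)%E]).
  by apply: measurableC; apply: F0_measurable; exact: ot.
by apply/seteqP; split => w /=; rewrite leNgt => /negP.
Qed.

Lemma exit_min u tau (h : R) w : D u (stop tau h) w =
  D u tau w - \1_(late tau h) w * (D u tau w - expR (- lam * h) * u (X h w)).
Proof.
rewrite indicE; have [hw|hw] := leP h%:E (tau w).
  by rewrite mem_set// mul1r /discounted_exit min_r// opprB addrC subrK.
rewrite memNset ?mul0r ?subr0 /=; last by apply/negP; rewrite -ltNge.
by rewrite /discounted_exit min_l// ltW.
Qed.

Lemma discount_le1 (h : R) : 0 <= h -> expR (- lam * h) <= 1.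
Proof. by move=> h0; rewrite -expR0 ler_expR mulNr oppr_le0 mulr_ge0// ltW. Qed.

Variable O : set E.
Local Notation zeta := (exit_time (closure O)).
Local Notation H := (exit_value P lam O).

Let bA (h : R) : 0 < h -> bmeas (\1_(late zeta h) : Om -> R).
Proof. by move=> h0; apply: bmeas_indic; apply: measurable_late => //; exact: opt_zeta. Qed.

(* Both sides complete E[D(Rl k) zeta; zeta < h] to a value which Dynkin's formula
   identifies with Rl k x, because k is not charged before zeta. *)
Lemma dynkin_local k (h : R) x : C0 k -> (forall y, 0 <= k y) ->
  (forall y, closure O y -> k y = 0) -> 0 < h ->
  mean (P x) (fun w => \1_(late zeta h) w * (expR (- lam * h) * Rl k (X h w))) =
  mean (P x) (fun w => \1_(late zeta h) w * D (Rl k) zeta w).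
Proof.
move=> ck k0 kO h0.
have cu : C0 (Rl k) by exact: res_C0.
have oz := @opt_zeta R d O.
have oh := optional_min (ltW h0) oz.
have bz := @bmeas_zeta R d lam lam0 O _ cu.
have bX : bmeas (fun w => expR (- lam * h) * Rl k (X h w)) by apply: bmeasZ; exact: bmeas_fX.
have e1 : mean (P x) (D (Rl k) (stop zeta h)) = H (Rl k) x.
  rewrite -(dynkin feller process lam0 x ck oh) -(exit_value_martingale feller process lam0 x ck kO).
  rewrite (res_cost feller process lam0 x ck); apply: eq_mean => w.
  have mz := optional_measurable oz; have mh := optional_measurable oh.
  have m0 : measurable_fun setT (fun _ : Om => 0%E : \bar R) by exact: measurable_cst.
  apply/eqP; rewrite eq_le; apply/andP; split.
    by apply: le_cost => //; case: oh => + _; exact.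
  rewrite -(cost_no_charge lam0 w (@closed_closure _ O) ck kO).
  by apply: le_cost => //; rewrite ge_min lexx.
apply/eqP; rewrite eq_sym -subr_eq0 -meanB; [|exact: bmeasM (bA h0) _..].
have -> : mean (P x) (fun w => \1_(late zeta h) w * D (Rl k) zeta w -
     \1_(late zeta h) w * (expR (- lam * h) * Rl k (X h w))) =
   mean (P x) (fun w => D (Rl k) zeta w - D (Rl k) (stop zeta h) w).
  by apply: eq_mean => w; rewrite exit_min opprB [RHS]addrC subrK mulrBr.
rewrite meanB//; last by apply: bmeas_exit => //; [case: oh|exact: optional_measurable].
by rewrite e1 subrr.
Qed.

Hypothesis O0 : closure O !=set0.

Lemma dynamic_programming_ge0 f (h : R) x : C0 f -> (forall y, 0 <= f y) -> 0 < h ->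
  bmeas (fun w => \1_(late zeta h) w * (expR (- lam * h) * H (Rl f) (X h w))) /\
  mean (P x) (fun w => \1_(late zeta h) w * (expR (- lam * h) * H (Rl f) (X h w))) =
  mean (P x) (fun w => \1_(late zeta h) w * D (Rl f) zeta w).
Proof.
move=> cf f0 h0.
have cu : C0 (Rl f) by exact: res_C0.
have [y hy] := exhaustion_exists feller process lam0 O0 cf f0.
have [M M0 uM] := C0_bounded cu.
have yu n v : 0 <= y n v <= Rl f v by have [b []] := hy n.
have cy n : C0 (y n) by have [b []] := hy n.
have yM n v : `|y n v| <= M.
  have /andP[y0 yle] := yu n v; rewrite ger0_norm// (le_trans yle)//.
  exact: le_trans (ler_norm _) (uM v).
pose a n w := \1_(late zeta h) w * (expR (- lam * h) * y n (X h w)).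
have ba n : bmeas (a n) by apply: bmeasM; [exact: bA | apply: bmeasZ; exact: bmeas_fX].
have aM n w : `|a n w| <= M.
  rewrite /a indicE !normrM (ger0_norm (expR_ge0 _)) mulrA -[leRHS]mul1r ler_pM ?mulr_ge0 ?expR_ge0//.
  rewrite ger0_norm ?ler0n// -[leRHS]mul1r ler_pM ?expR_ge0// ?discount_le1 ?(ltW h0)//.
  by case: (_ \in _).
have ac w : a ^~ w @ \oo --> \1_(late zeta h) w * (expR (- lam * h) * H (Rl f) (X h w)).
  apply: cvgM; first exact: cvg_cst.
  apply: cvgM; first exact: cvg_cst.
  exact: (@cvg_exhaustion R d Pt P feller process lam lam0 O O0 f cf y hy (X h w)).
have [bl cl] := @mean_cvg _ _ _ (P x) a _ M (fun n => proj1 (ba n)) aM ac.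
split=> //.
have bz g : C0 g -> bmeas (D g zeta) by move=> cg; exact: bmeas_zeta.
have eqn n : mean (P x) (a n) = mean (P x) (fun w => \1_(late zeta h) w * D (y n) zeta w).
  have [k [ck k0 kO yE]] := exhaustion_charge feller O0 cf hy n.
  by rewrite /a yE; exact: dynkin_local.
have yH n : H (y n) x = y n x.
  have [k [ck k0 kO yE]] := exhaustion_charge feller O0 cf hy n.
  by rewrite yE -(exit_value_martingale feller process lam0 x ck kO).
have Dle n w : D (y n) zeta w <= D (Rl f) zeta w.
  rewrite /discounted_exit; case: (zeta w) => // z.
  by rewrite ler_pM2l ?expR_gt0//; case/andP: (yu n (X z w)).
have c2 : mean (P x) (fun w => \1_(late zeta h) w * D (y n) zeta w) @[n --> \oo] -->
    mean (P x) (fun w => \1_(late zeta h) w * D (Rl f) zeta w).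
  apply/cvgrPdist_le => e e0.
  have /cvgrPdist_le/(_ _ e0) := @cvg_exhaustion R d Pt P feller process lam lam0 O O0 f cf y hy x.
  apply: filterS => n; apply: le_trans.
  rewrite -meanB; [|by apply: bmeasM; [exact: bA|exact: bz]..].
  have gap w : 0 <= D (Rl f) zeta w - D (y n) zeta w by rewrite subr_ge0.
  rewrite ger0_norm; last first.
    by apply: mean_ge0 => w; rewrite -mulrBr mulr_ge0// indicE ler0n.
  (* The gap on the late event is at most the gap over all paths, which is H (R f) x - y n x because
     H (y n) x = y n x. *)
  apply: le_trans (ler_norm _); rewrite -yH /exit_value -meanB; [|exact: bz..].
  apply: le_mean; [by apply: bmeasB; apply: bmeasM; [exact: bA|exact: bz|exact: bA|exact: bz] | by apply: bmeasB; exact: bz |].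
  by move=> w; rewrite -mulrBr -[leRHS]mul1r ler_wpM2r//.
rewrite (_ : (fun n => mean (P x) (a n)) =
  (fun n => mean (P x) (fun w => \1_(late zeta h) w * D (y n) zeta w))) in cl.
  exact: (cvg_unique _ cl c2).
by apply/funext => n.
Qed.

Lemma dynamic_programming f (h : R) x : C0 f -> 0 < h ->
  bmeas (fun w => \1_(late zeta h) w * (expR (- lam * h) * H (Rl f) (X h w))) /\
  mean (P x) (fun w => \1_(late zeta h) w * (expR (- lam * h) * H (Rl f) (X h w))) =
  mean (P x) (fun w => \1_(late zeta h) w * D (Rl f) zeta w).
Proof.
move=> cf h0.
pose fp v := Num.max 0 (f v); pose fn v := Num.max 0 (- f v).
have Cp : C0 fp by exact: C0_max.
have Cn : C0 fn by apply: C0_max; exact: C0N.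
have fp0 v : 0 <= fp v by rewrite le_max lexx.
have fn0 v : 0 <= fn v by rewrite le_max lexx.
have fE : f = (fun v => fp v - fn v).
  by apply/funext => v; rewrite /fp /fn; case: (leP 0 (f v)); case: (leP 0 (- f v)); lra.
have RE : Rl f = (fun v => Rl fp v - Rl fn v) by rewrite {1}fE resB.
have cup : C0 (Rl fp) by exact: res_C0.
have cun : C0 (Rl fn) by exact: res_C0.
have HE : H (Rl f) = (fun v => H (Rl fp) v - H (Rl fn) v) by rewrite RE exit_valueB.
have [bp ep] := dynamic_programming_ge0 x Cp fp0 h0.
have [bn en] := dynamic_programming_ge0 x Cn fn0 h0.
have E1 : (fun w => \1_(late zeta h) w * (expR (- lam * h) * H (Rl f) (X h w))) =
  (fun w => \1_(late zeta h) w * (expR (- lam * h) * H (Rl fp) (X h w)) -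
            \1_(late zeta h) w * (expR (- lam * h) * H (Rl fn) (X h w))).
  by apply/funext => w; rewrite HE -!mulrBr.
rewrite E1; split; first exact: (bmeasB bp bn).
have bz u : C0 u -> bmeas (fun w => \1_(late zeta h) w * D u zeta w).
  by move=> cu; apply: bmeasM; [exact: bA | exact: bmeas_zeta].
transitivity (mean (P x) (fun w => \1_(late zeta h) w * D (Rl fp) zeta w) -
              mean (P x) (fun w => \1_(late zeta h) w * D (Rl fn) zeta w)).
  by rewrite -ep -en; exact: (meanB (P x) bp bn).
apply: etrans (esym (meanB (P x) (bz _ cup) (bz _ cun))) _.
apply: eq_mean => w; rewrite -mulrBr RE; congr (_ * _).
by rewrite /discounted_exit; case: (zeta w) => [z| |]; rewrite ?subr0// mulrBr.
Qed.

(** Split H psi x at time h by dynamic programming. Exits before h are compared through psi <= R m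
    at X_zeta, known only to lie in the closure of the complement; late paths through H psi <= R m
    at X_h. Equality at x and Dynkin's formula for R m conclude. *)
Lemma stopped_cost_ge m psi (h : R) x : C0 m -> C0 psi -> 0 < h ->
  (forall y, H psi y <= Rl m y) -> (forall y, closure (~` closure O) y -> psi y <= Rl m y) ->
  H psi x = Rl m x ->
  mean (P x) (J m (fun _ => 0%E)) <= mean (P x) (J m (stop zeta h)).
Proof.
move=> cm cpsi h0 Hle ple Hx.
have oh := optional_min (ltW h0) (@opt_zeta R d O).
have cRm : C0 (Rl m) by exact: res_C0.
have bs : bmeas (D (Rl m) (stop zeta h)).
  by apply: bmeas_exit => //; [case: oh|exact: optional_measurable].
apply/ler_addgt0Pr => e e0; have e20 : 0 < e / 2 by rewrite divr_gt0.
(* Dynamic programming is stated for values of R, so psi is replaced by R c; one e / 2 is lost in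
   the value at x, the other inside the mean. *)
have [c cc hc] := res_approx feller process lam0 cpsi e20.
have cu : C0 (Rl c) by exact: res_C0.
have Hc y : `|H (Rl c) y - H psi y| <= e / 2.
  have := @exit_value_bound R d P lam lam0 O (fun v => Rl c v - psi v) _ y (ltW e20) (C0B cu cpsi) hc.
  by rewrite exit_valueB.
rewrite -(res_cost feller process lam0 x cm) -Hx (dynkin feller process lam0 x cm oh).
suff : H (Rl c) x <= mean (P x) (D (Rl m) (stop zeta h)) + e / 2.
  by have := Hc x; rewrite ler_norml => /andP[]; set a := H _ _; set b := H _ _; set s := mean _ _; lra.
have [bd ed] := dynamic_programming x cc h0.
have bz := @bmeas_zeta R d lam lam0 O _ cu.
have bAz : bmeas (fun w => \1_(late zeta h) w * D (Rl c) zeta w) by apply: bmeasM => //; exact: bA.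
have -> : H (Rl c) x = mean (P x) (fun w => (D (Rl c) zeta w - \1_(late zeta h) w * D (Rl c) zeta w) +
    \1_(late zeta h) w * (expR (- lam * h) * H (Rl c) (X h w))).
  by rewrite meanD// ?meanB// ?ed ?subrK//; exact: bmeasB.
rewrite -[e / 2 in leRHS](mean_cst (P x)) -meanD//; last exact: bmeas_cst.
apply: le_mean; [by apply: bmeasD => //; exact: bmeasB | by apply: bmeasD => //; exact: bmeas_cst |].
move=> w.
have disc (z a b : R) : 0 <= z -> a <= b + e / 2 -> expR (- lam * z) * a <= expR (- lam * z) * b + e / 2.
  move=> z0 ab; apply: (@le_trans _ _ (expR (- lam * z) * (b + e / 2))).
    by rewrite ler_pM2l ?expR_gt0.
  by rewrite mulrDr lerD2l -[leRHS]mul1r ler_pM2r// discount_le1.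
have [hw|hw] : (h%:E <= zeta w)%E \/ (zeta w < h%:E)%E.
    by case: (leP h%:E (zeta w)); [left | right].
  have -> : \1_(late zeta h) w = 1 :> R by rewrite indicE mem_set.
  rewrite !mul1r subrr add0r /discounted_exit min_r//.
  apply: disc; first exact: ltW.
  have := Hc (X h w); have := Hle (X h w); rewrite ler_norml.
  by set a := H _ _; set b := H _ _ => ? /andP[_ ?]; lra.
have -> : \1_(late zeta h) w = 0 :> R.
  by rewrite indicE memNset//=; apply/negP; rewrite -ltNge.
rewrite !mul0r subr0 addr0 /discounted_exit min_l ?(ltW hw)//.
case ez : (zeta w) (exit_time_ge0 (closure O) w) => [z| |] // z0; last by rewrite ez in hw.
rewrite lee_fin in z0; apply: disc => //.
have := hc (X z w); have := ple _ (exit_closure ez); rewrite ler_norml.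
by set a := Rl c _ => ? /andP[_ ?]; lra.
Qed.

End Viscosity.

(** * Small-time limit at a contact point *)

Section SmallTime.
Variables (R : realType) (d : nat).
Local Notation E := 'rV[R]_d.
Local Notation time := (measurableTypeR R).
Local Notation Om := (Omega R d).
Implicit Types (f g u k q : E -> R) (w : Om) (tau : Om -> \bar R).
Variables (Pt : R -> (E -> R) -> (E -> R)) (P : E -> probability Om R).
Hypotheses (feller : feller_semigroup Pt) (process : feller_process Pt P).
Variables (lam : R) (lam0 : 0 < lam).
Local Notation Rl := (res Pt lam0).
Local Notation J := (discounted_cost lam0).
Local Notation D := (discounted_exit lam).
Local Notation nu := (expo lam0).

Let I (z : R) : time -> R := \1_[set r : time | (z%:E < r%:E)%E].

Let bI z : bmeas (I z).
Proof.
apply: bmeas_indic; rewrite (_ : [set r | _] = `]z, +oo[%classic) //.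
by apply/seteqP; split => r /=; rewrite in_itv/= andbT lte_fin.
Qed.

Let mean_I z : 0 <= z -> mean nu (I z) = expR (- lam * z).
Proof.
move=> z0; rewrite -(mean_expo_ge lam0 z0).
have := @expo_strict R lam lam0 z (fun=> 1) (bmeas_cst 1).
by under eq_mean do rewrite mulr1; under [in RHS]eq_mean do rewrite mulr1.
Qed.

(** The two costs differ by the mean over clock values in ]0, z], an event of mass 1 - e^(-lam
    z). *)
Lemma cost_increment f w (z c e : R) : C0 f -> 0 <= z ->
  (forall s, 0 < s -> s <= z -> `|f (X s w) - c| <= e) ->
  `|J f (fun _ => 0%E) w - J f (fun _ => z%:E) w - (1 - expR (- lam * z)) * c| <=
  (1 - expR (- lam * z)) * e.
Proof.
move=> cf z0 hs.
have bf : bmeas (fun s : time => f (X s w)) by exact: (bmeas_pair2 (bmeas_fX_joint cf) w).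
pose K (s : time) : R := I 0 s - I z s.
have bK : bmeas K by exact: (bmeasB (bI 0) (bI z)).
have mK : mean nu K = 1 - expR (- lam * z).
  by rewrite (meanB nu (bI 0) (bI z)) !mean_I// mulr0 expR0.
have bfc : bmeas (fun s : time => f (X s w) - c) by exact: (bmeasB bf (bmeas_cst c)).
have -> : J f (fun _ => 0%E) w - J f (fun _ => z%:E) w - (1 - expR (- lam * z)) * c =
    mean nu (fun s => K s * (f (X s w) - c)).
  rewrite -mK mulrC -(meanZ nu c bK).
  have b0 := bmeasM (bI 0) bf; have bz := bmeasM (bI z) bf.
  rewrite /discounted_cost -(meanB nu b0 bz) -(meanB nu (bmeasB b0 bz) (bmeasZ c bK)).
  by apply: eq_mean => s; rewrite /K /I; ring.
have key s : - (e * K s) <= K s * (f (X s w) - c) <= e * K s.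
  rewrite /K /I !indicE.
  have [/set_mem /= h2|h2] := boolP (s \in [set r | (z%:E < r%:E)%E]).
    rewrite mem_set/=; last by rewrite lte_fin in h2; rewrite lte_fin (le_lt_trans z0).
    by rewrite subrr mulr0 oppr0 mul0r lexx.
  have [/set_mem /= h1|_] := boolP (s \in [set r | (0%:E < r%:E)%E]); last first.
    by rewrite subrr mulr0 oppr0 mul0r lexx.
  rewrite subr0 mulr1 mul1r -ler_norml; apply: hs; first by rewrite lte_fin in h1.
  by rewrite leNgt; apply: contra h2 => h; rewrite mem_set//= lte_fin.
have bm := bmeasM bK bfc.
have bKe := bmeasZ e bK.
rewrite -mK mulrC -(meanZ nu e bK) ler_norml; apply/andP; split.
  have -> : - mean nu (fun s => e * K s) = mean nu (fun s => - e * K s).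
    by rewrite !meanZ// mulNr.
  apply: le_mean => //; first exact: bmeasZ.
  by move=> s; rewrite mulNr; case/andP: (key s).
by apply: le_mean => // s; case/andP: (key s).
Qed.

Variable O : set E.
Local Notation zeta := (exit_time (closure O)).
Local Notation H := (exit_value P lam O).
Local Notation stop tau h := (fun w => Order.min (tau w) h%:E).
Hypothesis O0 : closure O !=set0.

Lemma discount_lt1 (h : R) : 0 < h -> 0 < 1 - expR (- lam * h).
Proof. by move=> h0; rewrite subr_gt0 -expR0 ltr_expR mulNr oppr_lt0 mulr_gt0. Qed.

Let h_ (n : nat) : R := n.+1%:R^-1.
Let h_gt0 n : 0 < h_ n.
Proof. by rewrite invr_gt0. Qed.

(** Dividing by the clock mass of ]0, h] instead of h makes the quotient an average of m(X_s) once h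
    <= zeta, so right continuity at 0 gives the limit; for zeta = 0 the quotient is 0. *)
Lemma cvg_small_time_cost m w : C0 m ->
  (fun n => (1 - expR (- lam * h_ n))^-1 * (J m (fun _ => 0%E) w - J m (stop zeta (h_ n)) w)) @ \oo -->
  \1_[set w | (0 < zeta w)%E] w * m (X 0 w).
Proof.
move=> cm.
have JE n z : Order.min (zeta w) (h_ n)%:E = z%:E -> J m (stop zeta (h_ n)) w = J m (fun _ => z%:E) w.
  by move=> e; rewrite /discounted_cost e.
have [z0|z0] := eqVneq (zeta w) 0%E.
  rewrite indicE memNset ?mul0r /=; last by rewrite z0 ltxx.
  rewrite (_ : (fun n : nat => _) = (fun=> 0)); first exact: cvg_cst.
  apply/funext => n; rewrite (JE _ 0) ?subrr ?mulr0// z0 min_l//.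
  by rewrite lee_fin ltW.
have zpos : (0 < zeta w)%E by rewrite lt_neqAle eq_sym z0 exit_time_ge0.
have -> : \1_[set w | (0 < zeta w)%E] w = 1 :> R by rewrite indicE mem_set.
rewrite mul1r; apply/cvgrPdist_le => e e0.
have rc := @right_cont_fX R d m 0 w (proj1 cm).
have /cvgrPdist_le/(_ _ e0) := rc.
rewrite near_withinE => -[r /= r0 hr].
have [r' r'0 hr'] : exists2 r' : R, 0 < r' & (r'%:E <= zeta w)%E.
  case: (zeta w) zpos => [z| |] // z1; last by exists 1; rewrite ?leey.
  by exists z.
have : \forall n \near \oo, h_ n < Num.min r r'.
  have mp : 0 < Num.min r r' by rewrite lt_min r0.
  exact: (near_infty_natSinv_lt (PosNum mp)).
apply: filterS => n; rewrite lt_min => /andP[hn hn'].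
rewrite (JE n (h_ n)); last by rewrite min_r// (le_trans _ hr')// lee_fin ltW.
have small s : 0 < s -> s <= h_ n -> `|m (X s w) - m (X 0 w)| <= e.
  move=> s0 sh; rewrite distrC; apply: (hr s) => //.
  by rewrite /= sub0r normrN gtr0_norm// (le_lt_trans sh).
have := cost_increment cm (ltW (h_gt0 n)) small.
have := discount_lt1 (h_gt0 n).
set a := 1 - _; set j := J _ _ _ - J _ _ _; set y := m _ => a0 hj.
have -> : y - a^-1 * j = a^-1 * - (j - a * y).
  by field; rewrite gt_eqF.
have ai : 0 < a^-1 by rewrite invr_gt0.
by rewrite normrM normrN (gtr0_norm ai) mulrC ler_pdivrMr// [e * a]mulrC.
Qed.

Lemma small_time_cost_bound m (M : R) n w : C0 m -> (forall y, `|m y| <= M) ->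
  `|(1 - expR (- lam * h_ n))^-1 * (J m (fun _ => 0%E) w - J m (stop zeta (h_ n)) w)| <= M.
Proof.
move=> cm mM; have a0 := discount_lt1 (h_gt0 n).
have M0 : 0 <= M by exact: le_trans (normr_ge0 _) (mM 0).
have ai : 0 < (1 - expR (- lam * h_ n))^-1 by rewrite invr_gt0.
rewrite normrM (gtr0_norm ai) mulrC ler_pdivrMr//.
have [z zE] : exists z, Order.min (zeta w) (h_ n)%:E = z%:E.
  case ez : (zeta w) (exit_time_ge0 (closure O) w) => [z| |] // _; last first.
    by exists (h_ n); rewrite min_r// leey.
  by exists (Num.min z (h_ n)); rewrite EFin_min.
have z0 : 0 <= z by rewrite -lee_fin -zE le_min exit_time_ge0 lee_fin ltW.
have zh : z <= h_ n by rewrite -lee_fin -zE ge_min lexx orbT.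
have -> : J m (stop zeta (h_ n)) w = J m (fun _ => z%:E) w by rewrite /discounted_cost zE.
have small s : 0 < s -> s <= z -> `|m (X s w) - 0| <= M by rewrite subr0.
have := cost_increment cm z0 small; rewrite mulr0 subr0 => /le_trans; apply.
by rewrite mulrC ler_wpM2l// lerB// ler_expR !mulNr lerN2 ler_pM2l.
Qed.

(** By [stopped_cost_ge] the quotients have nonpositive mean; their limit has mean m x times the
    probability of zeta > 0, which is positive. *)
Lemma exit_value_contact m psi x : C0 m -> C0 psi ->
  (forall y, H psi y <= Rl m y) -> (forall y, closure (~` closure O) y -> psi y <= Rl m y) ->
  H psi x = Rl m x -> ~ (P x).-negligible [set w | zeta w != 0%E] -> m x <= 0.
Proof.
move=> cm cpsi Hle ple Hx nneg.
have [M M0 mM] := C0_bounded cm.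
have oz := @opt_zeta R d O.
have b0 : bmeas (J m (fun _ => 0%E)) by apply: (bmeas_cost P) => //; exact: measurable_cst.
have bs n : bmeas (J m (stop zeta (h_ n))).
  by apply: (bmeas_J P) => //; apply: optional_min => //; exact: ltW.
pose Phi n w := (1 - expR (- lam * h_ n))^-1 * (J m (fun _ => 0%E) w - J m (stop zeta (h_ n)) w).
have bPhi n : bmeas (Phi n) by exact: (bmeasZ _ (bmeasB b0 (bs n))).
have [bl cl] := @mean_cvg _ _ _ (P x) Phi _ M (fun n => proj1 (bPhi n))
  (fun n w => small_time_cost_bound n w cm mM) (fun w => @cvg_small_time_cost m w cm).
have Phi0 n : mean (P x) (Phi n) <= 0.
  rewrite /Phi (meanZ _ _ (bmeasB b0 (bs n))) (meanB _ b0 (bs n)).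
  rewrite pmulr_rle0 ?invr_gt0 ?discount_lt1// subr_le0.
  exact: (@stopped_cost_ge R d Pt P feller process lam lam0 O O0 m psi (h_ n) x cm cpsi (h_gt0 n) Hle ple Hx).
have lim0 : mean (P x) (fun w => \1_[set w | (0 < zeta w)%E] w * m (X 0 w)) <= 0.
  apply: (ler_cvg_to cl (cvg_cst (0 : R))); exact: nearW.
have mz : measurable [set w : Om | (0 < zeta w)%E].
  rewrite -[X in measurable X]setTI; apply: measurable_lte => //.
  exact: optional_measurable.
have bz := @bmeas_indic _ Om R _ mz.
have eqm : mean (P x) (fun w => \1_[set w | (0 < zeta w)%E] w * m (X 0 w)) =
    m x * mean (P x) (\1_[set w | (0 < zeta w)%E]).
  rewrite -(meanZ (P x) (m x) bz).
  apply: (eq_mean_ae (initial_negligible process x)) => //; first exact: bmeasZ.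
  by move=> w /negP; rewrite negbK => /eqP ->; rewrite mulrC.
rewrite eqm (mean_indic (P x) mz) in lim0.
have Pfin := fin_num_measure (P x) _ mz.
have Ppos : 0 < fine (P x [set w | (0 < zeta w)%E]).
  rewrite fine_gt0// lt0e measure_ge0 andbT -ge0_fin_numE// Pfin andbT.
  apply/eqP => P0; apply: nneg; exists [set w | (0 < zeta w)%E]; split => //.
  by move=> w /= h; rewrite lt_neqAle eq_sym h exit_time_ge0.
by rewrite -(pmulr_lle0 _ Ppos).
Qed.

End SmallTime.

Lemma C0_lipschitz {R : realType} {d : nat} (f : 'rV[R]_d -> R) :
  lipschitz f -> vanish_at_infinity f -> C0 f.
Proof.
move=> [M [_ hM]] vf; split=> //; apply/continuous_distP => x e e0.
(* [lipschitz] provides the bound for every constant above M; this one is also positive. *)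
pose K := Num.max 1 (M + 1).
have K0 : 0 < K by rewrite lt_max ltr01.
have MK : M < K by rewrite lt_max ltrDl ltr01 orbT.
have := hM K MK; rewrite /= => lip.
have eK : 0 < e / K by rewrite divr_gt0.
have /cvgrPdist_le/(_ _ eK) : (y @[y --> x] --> x) by exact: cvg_id.
apply: filterS => y hy; have := lip (x, y) (conj I I) => /= /le_trans; apply.
by rewrite mulrC -ler_pdivlMr.
Qed.

(** * The value function and test functions *)

Section Value.
Variables (R : realType) (d : nat).
Local Notation E := 'rV[R]_d.
Local Notation time := (measurableTypeR R).
Local Notation Om := (Omega R d).
Implicit Types (f g u k q : E -> R) (w : Om) (tau : Om -> \bar R).
Variables (Pt : R -> (E -> R) -> (E -> R)) (P : E -> probability Om R).
Hypotheses (feller : feller_semigroup Pt) (process : feller_process Pt P).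
Variables (lam : R) (lam0 : 0 < lam).
Local Notation Rl := (res Pt lam0).
Local Notation J := (discounted_cost lam0).
Local Notation D := (discounted_exit lam).
Local Notation nu := (expo lam0).
Variable O : set E.
Local Notation zeta := (exit_time (closure O)).
Local Notation H := (exit_value P lam O).

(** The running integral over [0, zeta[ is the cost after 0 minus the cost after zeta, and the clock
    ignores the endpoints. *)
Lemma payoffE g l w : C0 l ->
  payoff O lam g l w =
  (lam^-1 * (J l (fun _ => 0%E) w - J l zeta w) + D g zeta w)%:E.
Proof.
move=> cl.
have bl : bmeas (fun s : time => l (X s w)) by exact: (bmeas_pair2 (bmeas_fX_joint cl) w).
have z0 := exit_time_ge0 (closure O) w.
pose A := [set s : time | 0 <= s /\ (s%:E < zeta w)%E].
pose A0 := [set s : time | 0 <= s].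
pose B := [set s : time | (zeta w <= s%:E)%E].
have mA0 : measurable A0.
  rewrite (_ : A0 = `[0, +oo[%classic) //.
  by apply/seteqP; split => r /=; rewrite in_itv/= andbT.
have mB : measurable B.
  rewrite -[B]setTI; apply: measurable_lee => //; exact: measurable_EFin.
have AE : A = A0 `\` B.
  by apply/seteqP; split => s /= [h1 h2]; split => //; [apply/negP; rewrite -ltNge | rewrite ltNge; apply/negP].
have mA : measurable A by rewrite AE; exact: measurableD.
have e0 : J l (fun _ => 0%E) w = mean nu (fun s => \1_A0 s * l (X s w)).
  exact: (expo_strict lam0 0 bl).
have e1 : J l zeta w = mean nu (fun s => \1_B s * l (X s w)).
  rewrite /discounted_cost /B; case: (zeta w) z0 => [z| |] // _.
  exact: (expo_strict lam0 z bl).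

rewrite /payoff (@integral_discount R lam lam0 (fun s => l (X s w)) A mA) //; last by move=> s [].
have -> : mean nu (fun s => \1_A s * l (X s w)) = J l (fun _ => 0%E) w - J l zeta w.
  rewrite e0 e1 -(meanB nu (bmeasM (bmeas_indic mA0) bl) (bmeasM (bmeas_indic mB) bl)).
  apply: eq_mean => s; rewrite -mulrBl; congr (_ * _).
  rewrite AE !indicE in_setD.
  have [/set_mem hB|_] := boolP (s \in B); last by rewrite andbT subr0.
  rewrite andbF mem_set ?subrr//; move: hB; rewrite /B /A0 /=.
  by move=> /(le_trans z0); rewrite lee_fin.
by rewrite /discounted_exit; case: (zeta w).
Qed.

Lemma value_exit g l x : C0 g -> C0 l ->
  value P O lam g l x =
  lam^-1 * Rl l x + H (fun y => g y - lam^-1 * Rl l y) x.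
Proof.
move=> cg cl.
have cu : C0 (Rl l) by exact: res_C0.
have cv : C0 (fun y => lam^-1 * Rl l y) by exact: C0Z.
have oz := @opt_zeta R d O.
have b0 : bmeas (J l (fun _ => 0%E)) by apply: (bmeas_cost P) => //; exact: measurable_cst.
have bz : bmeas (J l zeta) by exact: (bmeas_J P).
have bD : bmeas (D g zeta) by exact: bmeas_zeta.
have bd := bmeasZ lam^-1 (bmeasB b0 bz).
rewrite /value; under eq_integral do rewrite payoffE//.
rewrite (EFin_mean (P x) (bmeasD bd bD)) /= (meanD (P x) bd bD).
rewrite (meanZ (P x) lam^-1 (bmeasB b0 bz)) (meanB (P x) b0 bz).
(* By Dynkin's formula the expected cost after zeta is H (R l). *)
rewrite -(res_cost feller process lam0 x cl) -(exit_value_dynkin feller process lam0 O x cl).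
rewrite (exit_valueB _ lam0 _ cg cv).
have -> : H (fun y => lam^-1 * Rl l y) x = lam^-1 * H (Rl l) x.
  rewrite /exit_value -(meanZ (P x) lam^-1 (bmeas_zeta lam0 O cu)).
  by apply: eq_mean => w; rewrite /discounted_exit; case: (zeta w) => [z| |]; rewrite ?mulr0// mulrCA.
rewrite mulrBr -/(H g x); ring.
Qed.

Lemma value_immediate g l x : C0 g -> C0 l -> (P x).-negligible [set w | zeta w != 0%E] ->
  value P O lam g l x = g x.
Proof.
move=> cg cl n0; rewrite value_exit// (exit_value_immediate process lam0 _ n0).
  by rewrite addrC subrK.
by apply: C0B => //; apply: C0Z; exact: res_C0.
Qed.

(** Paths from x stay in O for a while, so zeta > 0 almost surely; if zeta = 0 were almost sure too,
    the whole path space would be negligible. *)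
Lemma exit_positive x : open O -> O x -> ~ (P x).-negligible [set w | zeta w != 0%E].
Proof.
move=> oO Ox n0.
have : (P x).-negligible (setT : set Om).
  apply: (negligibleS _ (negligibleU n0 (initial_negligible process x))).
  move=> w _ /=; have [X0|] := eqVneq (X 0 w) x; [left | by right].
  have OX : O (X 0 w) by rewrite X0.
  have [e e0 he] := right_cont_nbhs oO OX.
  apply: contraTneq (_ : e%:E <= zeta w)%E => [->|]; first by rewrite -ltNge lte_fin.
  apply: le_ereal_inf_tmp => _ [t [t0 nt] <-]; rewrite lee_fin leNgt.
  apply/negP => te; apply: nt; apply: subset_closure; by apply: he; [exact: ltW | rewrite add0r].
move=> [N [mN N0 sN]]; have NT : N = setT by apply/seteqP; split.
by move: N0; rewrite NT probability_setT => -[]; apply/eqP; rewrite oner_eq0.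
Qed.

Variables (g l : E -> R) (cg : C0 g) (cl : C0 l).
Hypothesis O0 : closure O !=set0.
Local Notation v := (value P O lam g l).

Let psi y := g y - lam^-1 * Rl l y.
Let cpsi : C0 psi.
Proof. by apply: C0B => //; apply: C0Z; exact: res_C0. Qed.

Section TestFunction.
Variables (phi Lphi : E -> R) (gen : is_generator Pt phi Lphi).

Let cphi : C0 phi. Proof. by case: gen. Qed.
Let cL : C0 Lphi. Proof. by case: gen. Qed.
Let m y := phi y - lam^-1 * Lphi y - lam^-1 * l y.
Let cm : C0 m.
Proof. by apply: C0B; [apply: C0B => //; exact: C0Z | exact: C0Z]. Qed.
Let mE y : phi y = lam^-1 * Rl l y + Rl m y.
Proof.
have cpL : C0 (fun z => phi z - lam^-1 * Lphi z) by apply: C0B => //; exact: C0Z.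
have cl' : C0 (fun z => lam^-1 * l z) by exact: C0Z.
rewrite {1}(generator_resE feller process lam0 gen) /m (resB feller lam0 cpL cl').
by rewrite (resZ feller lam0 _ cl) addrC subrK.
Qed.

Lemma touch_above x : (forall y, v y <= phi y) ->
  (forall y, closure (~` closure O) y -> g y <= phi y) -> phi x = v x ->
  ~ (P x).-negligible [set w | zeta w != 0%E] -> - Lphi x + lam * phi x - l x <= 0.
Proof.
move=> vphi gphi phix nneg.
have : m x <= 0.
  apply: (@exit_value_contact R d Pt P feller process lam lam0 O O0 m psi x cm cpsi) => //.
  - by move=> y; have := vphi y; rewrite value_exit// mE lerD2l.
  - by move=> y /gphi; rewrite mE /psi lerBlDl.
  - by have := phix; rewrite value_exit// mE => /addrI.
rewrite -(pmulr_rle0 _ lam0) /m !mulrBr !mulVKf ?gt_eqF//.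
by rewrite [- _ + _]addrC.
Qed.

(** Negating m and psi turns contact from below into contact from above, where [exit_value_contact]
    applies. *)
Lemma touch_below x : (forall y, phi y <= v y) ->
  (forall y, closure (~` closure O) y -> phi y <= g y) -> phi x = v x ->
  ~ (P x).-negligible [set w | zeta w != 0%E] -> 0 <= - Lphi x + lam * phi x - l x.
Proof.
move=> vphi gphi phix nneg.
have RN y : Rl (fun z => - m z) y = - Rl m y.
  have -> : (fun z => - m z) = (fun z => -1 * m z) by apply/funext => z; rewrite mulN1r.
  by rewrite (resZ feller lam0 _ cm) mulN1r.
have HN y : H (fun z => - psi z) y = - H psi y.
  rewrite /exit_value -mulN1r -(meanZ (P y) (-1) (bmeas_zeta lam0 O cpsi)).
  apply: eq_mean => w; rewrite /discounted_exit mulN1r; case: (zeta w) => [z| |]; by rewrite ?oppr0// mulrN.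
have : - m x <= 0.
  apply: (@exit_value_contact R d Pt P feller process lam lam0 O O0 (fun z => - m z) (fun z => - psi z) x (C0N cm) (C0N cpsi)) => //.
  - by move=> y; have := vphi y; rewrite value_exit// mE HN RN lerN2 lerD2l.
  - by move=> y /gphi; rewrite mE RN lerN2 /psi lerBrDl.
  - by have := phix; rewrite value_exit// mE HN RN => /addrI ->.
rewrite oppr_le0 -(pmulr_rge0 _ lam0) /m !mulrBr !mulVKf ?gt_eqF//.
by rewrite [- _ + _]addrC.
Qed.

End TestFunction.

(** Off [closure O] the exit is immediate, so v already equals g there and the envelope conditions
    compare phi with v on the whole space. *)
Lemma extend_value y : extend O v g y = v y.
Proof.
rewrite /extend; case: asboolP => // nO.
by rewrite value_immediate//; exact: (immediate_outside process).
Qed.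

Lemma le_usc_env (f : E -> R) y : ((f y)%:E <= usc_env f y)%E.
Proof.
apply: le_ereal_inf_tmp => _ [e e0 <-]; apply: ereal_sup_ubound.
by exists y => //; exact: ballxx.
Qed.

Lemma lsc_env_le (f : E -> R) y : (lsc_env f y <= (f y)%:E)%E.
Proof.
apply: ge_ereal_sup => _ [e e0 <-]; apply: ereal_inf_lbound.
by exists y => //; exact: ballxx.
Qed.

Lemma closure_le (f h : E -> R) (A : set E) : continuous f -> continuous h ->
  (forall y, A y -> f y <= h y) -> forall y, closure A y -> f y <= h y.
Proof.
move=> cf ch fh y.
have cd : continuous (fun y => h y - f y).
  by move=> z; apply: (@continuousB _ _ _ h f); [exact: ch | exact: cf].
have cc : closed [set y | f y <= h y].
  rewrite (_ : [set y | _] = (fun y => h y - f y) @^-1` [set r : R | 0 <= r]).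
    by apply: closed_comp; [move=> z _; exact: cd | exact: closed_ge].
  by apply/seteqP; split => z /=; rewrite subr_ge0.
have sA : A `<=` [set y | f y <= h y] by exact: fh.
by move=> /(closureS sA); move/closure_id : cc => <-.
Qed.

Variable L : (E -> R) -> E -> R.
Hypothesis LP : forall phi, Ccinf phi -> is_generator Pt phi (L phi).

Lemma subsolution_at x phi : Jplus O g v x phi ->
  ~ (P x).-negligible [set w | zeta w != 0%E] -> Gop L lam l phi x <= 0.
Proof.
move=> [smooth_phi phi_ge phix]; have gen := LP smooth_phi.
have vphi y : v y <= phi y.
  by rewrite -lee_fin -extend_value; exact: le_trans (le_usc_env _ y) (phi_ge y).
(* The bound is required on the closure of the complement, where X_zeta lies; continuity of g and
   phi extends it there. *)
apply: (touch_above gen vphi) => //; apply: closure_le; [by case: cg | by case: gen => -[] |].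
move=> y nO; apply: le_trans (vphi y); rewrite value_immediate//.
exact: (immediate_outside process).
Qed.

Lemma supersolution_at x phi : Jminus O g v x phi ->
  ~ (P x).-negligible [set w | zeta w != 0%E] -> 0 <= Gop L lam l phi x.
Proof.
move=> [smooth_phi phi_le phix]; have gen := LP smooth_phi.
have vphi y : phi y <= v y.
  by rewrite -lee_fin -(extend_value y); exact: le_trans (phi_le y) (lsc_env_le _ y).
apply: (touch_below gen vphi) => //; apply: closure_le; [by case: gen => -[] | by case: cg |].
move=> y nO; apply: (le_trans (vphi y)); rewrite value_immediate//.
exact: (immediate_outside process).
Qed.

End Value.

Theorem theorem2p6 (R : realType) (d : nat) (d_pos : (0 < d)%N)
    (Pt : R -> ('rV[R]_d -> R) -> ('rV[R]_d -> R))
    (L : ('rV[R]_d -> R) -> 'rV[R]_d -> R)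
    (P : 'rV[R]_d -> probability (Omega R d) R)
    (O : set 'rV[R]_d) (g l : 'rV[R]_d -> R) (lam : R) :
  feller_semigroup Pt ->
  (forall phi, Ccinf phi -> is_generator Pt phi (L phi)) ->
  feller_process Pt P ->
  open O -> connected O -> bounded_set O ->
  lipschitz g -> vanish_at_infinity g ->
  lipschitz l -> vanish_at_infinity l ->
  0 < lam ->
  (exists N1 : set 'rV[R]_d,
     [/\ open N1, boundary1 P O `<=` N1 &
         forall x, closure O x ->
           (P x).-negligible (exit_pos_in O (closure N1))]) ->
  gen_visc_sol L lam l g O (value P O lam g l) /\
  boundary0 P O `<=` [set x | boundary O x /\ value P O lam g l x = g x].
Proof.
move=> feller LP process oO _ _ lip_g vg lip_l vl lam0 [N1 [oN1 bN1 exitN1]].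
have cg := C0_lipschitz lip_g vg; have cl := C0_lipschitz lip_l vl.
have cRl : C0 (res Pt lam0 l) by exact: res_C0.
have reg x : boundary0 P O x -> value P O lam g l x = g x.
  by move=> [_]; exact: (value_immediate feller process lam0 cg cl).
have nreg x : boundary O x -> ~ boundary0 P O x ->
    ~ (P x).-negligible [set w | exit_time (closure O) w != 0%E].
  by move=> bx nx n0; apply: nx.
have cv : {within closure O, continuous (value P O lam g l)}.
  have -> : value P O lam g l = (fun x => lam^-1 * res Pt lam0 l x +
      exit_value P lam O (fun y => g y - lam^-1 * res Pt lam0 l y) x).
    by apply/funext => x; exact: (value_exit feller process lam0).
  have cvl : C0 (fun y => lam^-1 * res Pt lam0 l y) by exact: C0Z.
  (* The exit condition on N1 acts here, through the continuity of H on [closure O]. *)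
  have ce := exit_value_continuous feller process lam0 oO oN1 bN1 exitN1 (C0B cg cvl).
  apply/subspace_continuousP => x clx; apply: cvgD; last first.
    by move/subspace_continuousP : ce; exact.
  by apply: cvg_within_filter; case: cvl => + _; exact.
have cvd x e : closure O x -> 0 < e -> \forall y \near x, closure O y ->
    `|value P O lam g l x - value P O lam g l y| < e.
  move=> clx e0; move/subspace_continuousP : cv => /(_ x clx)/cvgrPdist_lt/(_ _ e0).
  by rewrite near_withinE.
split; last by move=> x bx; split; [case: bx | exact: reg].
split=> //; split.
- move=> x clx e e0; apply: filterS (cvd x e clx e0) => y h /h.
  by rewrite ltr_norml => /andP[+ _]; lra.
- move=> x phi Ox Jx.
  have clx : closure O x by exact: subset_closure.
  apply: (subsolution_at feller process lam0 cg cl (ex_intro _ x clx) LP Jx).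
  exact: (exit_positive process oO Ox).
(* On [boundary0] the difference v - g is 0, which settles the minimum; elsewhere on the boundary
   zeta > 0 with positive probability, and the contact argument gives the equation itself. *)
- move=> x phi bx Jx; have [/reg ->|nx] := pselect (boundary0 P O x).
    by rewrite subrr ge_min lexx orbT.
  rewrite ge_min; apply/orP; left.
  apply: (subsolution_at feller process lam0 cg cl (ex_intro _ x (proj1 bx)) LP Jx).
  exact: nreg.
- move=> x clx e e0; apply: filterS (cvd x e clx e0) => y h /h.
  by rewrite ltr_norml => /andP[_]; lra.
- move=> x phi Ox Jx.
  have clx : closure O x by exact: subset_closure.
  apply: (supersolution_at feller process lam0 cg cl (ex_intro _ x clx) LP Jx).
  exact: (exit_positive process oO Ox).
- move=> x phi bx Jx; have [/reg ->|nx] := pselect (boundary0 P O x).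
    by rewrite subrr le_max lexx orbT.
  rewrite le_max; apply/orP; left.
  apply: (supersolution_at feller process lam0 cg cl (ex_intro _ x (proj1 bx)) LP Jx).
  exact: nreg.
Qed.
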